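(* Let $p$ be a prime and let $n\ge2$. Let $G$ be the group generated by $\{\sigma,\tau,Z,U,V\}$, omitting $V$ if $n=2$, subject to the following relations, where $U'=UZ^2$ if $p$ is odd and $U'=U$ if $p=2$. Then $G$ is isomorphic to $\mathrm{Sp}(2n,p)$. (i) Defining relations for $S_n$ on $\{U,V\}$ (on $\{U\}$ if $n=2$), with $U=(1,2)$, $V=(1,2,\dots,n)$; $Z^m=1$, where $m=2$ if $p=2$ and $m=4$ if $p$ is odd; $[Z,U^V]=1$ if $n>2$; $[Z,VU]=1$ if $n>3$; $[Z,Z^U]=1$. (ii) Relations stating that $\sigma$ is centralised by: $ZUZ^{-1}$; $U^{V^2}$ if $n>3$; $VUU^V$ if $n>4$; $Z^{V^2}$ if $n>2$; $[Z^2,U]$ if $p$ is odd. Relations stating that $\tau$ is centralised by: $Z^U$; $U^V$ if $n>2$; $VU$ if $n>3$ and $p=2$; $Z^2$ if $p$ is odd. (iii) Relations that present $\mathrm{SL}(2,p)$ on $\{\sigma,U'\}$. (iv) Relations that present $\mathrm{SL}(2,p)$ on $\{\tau,Z\}$. (v) (a) if $n>2$ then $[\sigma,\sigma^V]=\sigma^{VU}$; (b) if $n>2$ then $[\sigma,\sigma^{VU}]=1$; (c) if $n>2$ then $[\sigma,\sigma^{UV}]=1$; (d) if $n>3$ then $[\sigma,\sigma^{V^2}]=1$; (e) if $p$ is odd then $[\sigma,\sigma^Z]=\tau^{2ZU}$, else $[\sigma,\sigma^Z]=1$; (f) $[\sigma,\tau]=1$; (g) $[\sigma,\tau^U]=\sigma^{Z^U}\tau^{-1}$;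 (h) if $n>2$ then $[\sigma,\tau^{V^2}]=1$; (j) $[\tau,\tau^U]=1$.
   Context: Conventions: $x^y=y^{-1}xy$, $[x,y]=x^{-1}y^{-1}xy$, $x^{ky}=(x^k)^y$ for $k$ an integer and $x,y$ group elements (so $\tau^{2ZU}=(\tau^2)^{ZU}$). Linear maps act on the right and fix unmentioned basis vectors. Generators of the presented group are denoted by the same symbols as the corresponding matrices. ''Relations that present (defining relations for) a group on given elements $g_1,\dots,g_k$'' means any set of relators in the free group on $k$ letters whose normal closure is the kernel of the natural map onto $\langle g_1,\dots,g_k\rangle$. Matrices: $e_1,f_1,\dots,e_n,f_n$ is a hyperbolic basis of the natural module for $\mathrm{Sp}(2n,p)$. $Z=(e_1\mapsto f_1,\ f_1\mapsto-e_1)$; $\tau=(e_1\mapsto e_1+f_1)$; $\sigma=(e_1\mapsto e_1+e_2,\ f_2\mapsto f_2-f_1)$; $U$ interchanges $e_1,e_2$ and $f_1,f_2$; $V=(e_1,\dots,e_n)(f_1,\dots,f_n)$ cyclically permutes the $e_i$ and the $f_i$ (if $n>2$). The matrix groups $\langle\sigma,U'\rangle$ (acting on $\langle e_1,e_2\rangle$) and $\langle\tau,Z\rangle$ (acting on $\langle e_1,f_1\rangle$) are copies of $\mathrm{SL}(2,p)$ with the two generators acting as $\begin{pmatrix}1&1\\0&1\end{pmatrix}$ and $\begin{pmatrix}0&1\\-1&0\end{pmatrix}$ respectively. *)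

(* Defs.v *)
From HB Require Import structures.
From mathcomp Require Import all_boot all_fingroup all_algebra.
From mathcomp Require Import boolp classical_sets.

Set Implicit Arguments.
Unset Strict Implicit.
Unset Printing Implicit Defensive.

Import GroupScope.
Local Open Scope group_scope.

Definition isomorphic (G H : groupType) : Prop :=
  exists f : {multiplicative G -> H}, bijective f.

(* The letter (x, false) stands for x and (x, true) for x^-1; the elements of
   the free group on X are the reduced words. *)
Section FreeGroup.
Variable X : choiceType.
Implicit Types (a b : X * bool) (u v w : seq (X * bool)).

Definition inv_letter a := (a.1, ~~ a.2).

Definition reduced w := sorted [rel a b | b != inv_letter a] w.

Definition push a w :=
  if w is b :: w' then if b == inv_letter a then w' else a :: w else [:: a].

Definition word_mul u v := foldr push v u.
Definition word_inv w := rev (map inv_letter w).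

Record free_group := FreeGroup {
  free_word :> seq (X * bool);
  free_word_reduced : reduced free_word }.

HB.instance Definition _ := [isSub of free_group for free_word].
HB.instance Definition _ := [Choice of free_group by <:].

Lemma inv_letterK : involutive inv_letter.
Proof. by case=> x b; rewrite /inv_letter /= negbK. Qed.

Lemma push_reduced a w : reduced w -> reduced (push a w).
Proof.
case: w => [//|b w] /= red_w; case: eqP => [_|/eqP ba].
  exact: path_sorted red_w.
by rewrite /= ba.
Qed.

Lemma pushK a w : reduced w -> push (inv_letter a) (push a w) = w.
Proof.
case: w => [|b w] /=; first by rewrite inv_letterK eqxx.
case: eqP => [->|_ _ /=]; last by rewrite inv_letterK eqxx.
by case: w => [//|c w] /= /andP[/negPf->].
Qed.

Lemma word_mul_reduced u v : reduced v -> reduced (word_mul u v).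
Proof. by move=> red_v; elim: u => //= a u; apply: push_reduced. Qed.

Lemma word_mul1 w : reduced w -> word_mul w [::] = w.
Proof.
elim: w => [//|a w IHw] red_w /=; rewrite IHw; last exact: path_sorted red_w.
by case: w red_w {IHw} => [//|b w] /= /andP[/negPf->].
Qed.

Lemma word_mul_push a u v :
  reduced v -> word_mul (push a u) v = push a (word_mul u v).
Proof.
move=> red_v; case: u => [//|b u] /=; case: eqP => [->|//] /=.
by rewrite -{1}(inv_letterK a) pushK //; apply: word_mul_reduced.
Qed.

Lemma word_mulA u v w :
  reduced w -> word_mul u (word_mul v w) = word_mul (word_mul u v) w.
Proof. by move=> red_w; elim: u => //= a u ->; rewrite word_mul_push. Qed.

Lemma word_mulV w u : reduced u -> word_mul (word_inv w) (word_mul w u) = u.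
Proof.
rewrite /word_inv /word_mul => red_u; elim: w => [//|a w IHw] /=.
by rewrite rev_cons foldr_rcons pushK //; apply: word_mul_reduced.
Qed.

Lemma word_inv_reduced w : reduced w -> reduced (word_inv w).
Proof.
rewrite /reduced /word_inv rev_sorted; case: w => [//|a w] /=.
elim: w a => [//|b w IHw] a /= /andP[ba red_w]; rewrite IHw // andbT.
by rewrite inv_letterK; apply: contra ba => /eqP->.
Qed.

Definition free_one := @FreeGroup [::] isT.
Definition free_mul (u v : free_group) :=
  FreeGroup (word_mul_reduced u (free_word_reduced v)).
Definition free_inv (u : free_group) :=
  FreeGroup (word_inv_reduced (free_word_reduced u)).

Lemma free_mulA : associative free_mul.
Proof. by move=> u v w; apply/val_inj/word_mulA/free_word_reduced. Qed.

Lemma free_mul1 : right_id free_one free_mul.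
Proof. by move=> u; apply/val_inj/word_mul1/free_word_reduced. Qed.

Lemma free_1mul : left_id free_one free_mul.
Proof. by move=> u; apply/val_inj. Qed.

Lemma free_mulV : left_inverse free_one free_inv free_mul.
Proof.
move=> u; apply/val_inj; rewrite /= -[in RHS](@word_mulV u [::]) //.
by rewrite word_mul1 //; apply: free_word_reduced.
Qed.

Lemma free_invK (u : free_group) : free_inv (free_inv u) = u.
Proof.
apply/val_inj; rewrite /= /word_inv map_rev revK -map_comp -[RHS]map_id.
by apply: eq_map => a; apply: inv_letterK.
Qed.

Lemma free_mulr : right_inverse free_one free_inv free_mul.
Proof. by move=> u; rewrite -{1}(free_invK u) free_mulV. Qed.

HB.instance Definition _ := isGroup.Build free_group
  free_mulA free_1mul free_mul1 free_mulV free_mulr.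

Definition free_gen (x : X) : free_group := @FreeGroup [:: (x, false)] isT.

Definition free_eval (gT : groupType) (f : X -> gT) (w : free_group) : gT :=
  \prod_(a <- free_word w) (if a.2 then (f a.1)^-1 else f a.1).

Lemma free_eval_gen (gT : groupType) (f : X -> gT) x :
  free_eval f (free_gen x) = f x.
Proof. by rewrite /free_eval big_seq1. Qed.

Lemma free_evalM (gT : groupType) (f : X -> gT) :
  {morph free_eval f : u v / u * v}.
Proof.
move=> [u red_u] [v red_v]; rewrite /free_eval /=.
elim: u {red_u} => [|a u IHu] /=; first by rewrite big_nil mul1g.
rewrite big_cons -mulgA -IHu; case: (word_mul u v) => [|b w] /=.
  by rewrite big_cons.
case: eqP => [->|_]; last by rewrite [LHS]big_cons.
by rewrite big_cons mulgA /=; case: a.2; rewrite /= ?mulVg ?mulgV mul1g.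
Qed.

End FreeGroup.

Section NormalClosure.
Variable gT : groupType.

Definition normal_subgroup (N : set gT) : Prop :=
  [/\ N 1, forall x y, N x -> N y -> N (x * y^-1) &
      forall x y, N x -> N (x ^ y)].

Definition normal_closure (R : set gT) : set gT := smallest normal_subgroup R.

Lemma normal_closureP R : normal_subgroup (normal_closure R).
Proof.
split=> [N [[]]//|x y Nx Ny N NR|x y Nx N NR]; have [[_ NM NJ] _] := NR.
  by apply: NM; [apply: Nx | apply: Ny].
by apply: NJ; apply: Nx.
Qed.

End NormalClosure.

Lemma mulVM_conj (gT : groupType) (x y x' y' : gT) :
  (x' * y')^-1 * (x * y) = (x'^-1 * x) ^ y' * (y'^-1 * y).
Proof. by rewrite conjgE invMg -!mulgA mulKVg. Qed.

Lemma conjVM (gT : groupType) (x y : gT) : (x^-1 * y) ^ x^-1 = y * x^-1.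
Proof. by rewrite conjgE invgK -mulgA mulKVg. Qed.

Section PresentedGroup.
Variables (X : choiceType) (R : set (free_group X)).
Local Notation F := (free_group X).
Let N := normal_closure R.

Definition pres_rel (x y : F) : bool := `[< N (x^-1 * y) >].

Lemma pres_relP x y : reflect (N (x^-1 * y)) (pres_rel x y).
Proof. exact: asboolP. Qed.

Let N1 : N 1. Proof. by case: (normal_closureP R). Qed.
Let NF x y : N x -> N y -> N (x * y^-1).
Proof. by case: (normal_closureP R) => _ + _; apply. Qed.
Let NJ x y : N x -> N (x ^ y).
Proof. by case: (normal_closureP R) => _ _; apply. Qed.
Let NV x : N x -> N x^-1.
Proof. by move=> Nx; rewrite -[_^-1]mul1g; apply: NF. Qed.
Let NM x y : N x -> N y -> N (x * y).
Proof. by move=> Nx /NV Ny; rewrite -[y]invgK; apply: NF. Qed.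

Lemma pres_rel_equiv : equiv_class_of pres_rel.
Proof.
split=> [x|x y|y x z].
- by apply/pres_relP; rewrite mulVg.
- by apply/idP/idP=> /pres_relP/NV; rewrite invMg invgK => ?; apply/pres_relP.
move=> /pres_relP xy /pres_relP yz; apply/pres_relP.
by have := NM xy yz; rewrite -mulgA mulKVg.
Qed.

Canonical pres_equiv := EquivRelPack pres_rel_equiv.

Definition presented := {eq_quot pres_equiv}%qT.

HB.instance Definition _ := Choice.on presented.
HB.instance Definition _ := Quotient.on presented.
HB.instance Definition _ := EqQuotient.on presented.

Definition pres_pi (x : F) : presented := (\pi_presented x)%qT.

Lemma pres_piP x y : pres_pi x = pres_pi y <-> N (x^-1 * y).
Proof. by split=> [/eqmodP/pres_relP|xy]; last exact/eqmodP/pres_relP. Qed.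

Definition pres_repr (x : presented) : F := generic_quotient.repr x.

Lemma pres_reprK (x : presented) : pres_pi (pres_repr x) = x.
Proof. exact: reprK. Qed.

Definition pres_mul (x y : presented) := pres_pi (pres_repr x * pres_repr y).
Definition pres_inv (x : presented) := pres_pi (pres_repr x)^-1.

Lemma pres_piM x y : pres_mul (pres_pi x) (pres_pi y) = pres_pi (x * y).
Proof.
apply/pres_piP.
set x' := pres_repr (pres_pi _); set y' := pres_repr (pres_pi _).
have /pres_piP Nx : pres_pi x' = pres_pi x by apply: pres_reprK.
have /pres_piP Ny : pres_pi y' = pres_pi y by apply: pres_reprK.
by rewrite mulVM_conj; apply: NM => //; apply: NJ.
Qed.

Lemma pres_piV x : pres_inv (pres_pi x) = pres_pi x^-1.
Proof.
apply/pres_piP; rewrite invgK.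
have /pres_piP Nx : pres_pi (pres_repr (pres_pi x)) = pres_pi x.
  exact: pres_reprK.
have := NV (NJ (pres_repr (pres_pi x))^-1 Nx).
by rewrite conjVM invMg invgK.
Qed.

Lemma pres_ind (P : presented -> Prop) :
  (forall x, P (pres_pi x)) -> forall x, P x.
Proof. by move=> Ppi x; rewrite -(pres_reprK x). Qed.

Lemma pres_mulA : associative pres_mul.
Proof.
elim/pres_ind=> x; elim/pres_ind=> y; elim/pres_ind=> z.
by rewrite !pres_piM mulgA.
Qed.

Lemma pres_1mul : left_id (pres_pi 1) pres_mul.
Proof. by elim/pres_ind=> x; rewrite pres_piM mul1g. Qed.

Lemma pres_mul1 : right_id (pres_pi 1) pres_mul.
Proof. by elim/pres_ind=> x; rewrite pres_piM mulg1. Qed.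

Lemma pres_mulV : left_inverse (pres_pi 1) pres_inv pres_mul.
Proof. by elim/pres_ind=> x; rewrite pres_piV pres_piM mulVg. Qed.

Lemma pres_mulr : right_inverse (pres_pi 1) pres_inv pres_mul.
Proof. by elim/pres_ind=> x; rewrite pres_piV pres_piM mulgV. Qed.

HB.instance Definition _ := isGroup.Build presented
  pres_mulA pres_1mul pres_mul1 pres_mulV pres_mulr.

End PresentedGroup.

(* R is a set of defining relators for the subgroup generated by the g x. *)
Definition presents (X : choiceType) (gT : groupType) (g : X -> gT)
    (R : set (free_group X)) : Prop :=
  normal_closure R = [set w | free_eval g w = 1]%classic.

Section LinearGroups.
Variable p : nat.
Local Open Scope ring_scope.
Import GRing.Theory.

Definition SL (k : nat) := {M : 'M['F_p]_k | \det M == 1}.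

(* Gram matrix in the basis e_1, ..., e_n, f_1, ..., f_n of the alternating
   form with (e_i, f_i) = 1; matrices act on row vectors on the right. *)
Definition symp_form (n : nat) : 'M['F_p]_(n + n) :=
  block_mx 0 1%:M (- 1%:M) 0.

Definition Sp (n : nat) :=
  {M : 'M['F_p]_(n + n) | M *m symp_form n *m M^T == symp_form n}.

Section SLgroup.
Variable k : nat.
HB.instance Definition _ := [Finite of SL k by <:].

Lemma SL_unit (M : SL k) : val M \in unitmx.
Proof. by rewrite unitmxE (eqP (valP M)) unitr1. Qed.

Lemma SL1_subproof : \det (1%:M : 'M['F_p]_k) == 1.
Proof. by rewrite det1. Qed.
Lemma SLM_subproof (M M' : SL k) : \det (val M *m val M') == 1.
Proof. by rewrite det_mulmx (eqP (valP M)) (eqP (valP M')) mulr1. Qed.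
Lemma SLV_subproof (M : SL k) : \det (invmx (val M)) == 1.
Proof. by rewrite det_inv (eqP (valP M)) invr1. Qed.

Definition SL_one : SL k := exist (fun M => \det M == 1) _ SL1_subproof.
Definition SL_mul (M M' : SL k) : SL k :=
  exist (fun M => \det M == 1) _ (SLM_subproof M M').
Definition SL_inv (M : SL k) : SL k :=
  exist (fun M => \det M == 1) _ (SLV_subproof M).

Lemma SL_mulA : associative SL_mul.
Proof. by move=> M1 M2 M3; apply/val_inj/mulmxA. Qed.
Lemma SL_1mul : left_id SL_one SL_mul.
Proof. by move=> M; apply/val_inj/mul1mx. Qed.
Lemma SL_mul1 : right_id SL_one SL_mul.
Proof. by move=> M; apply/val_inj/mulmx1. Qed.
Lemma SL_mulV : left_inverse SL_one SL_inv SL_mul.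
Proof. by move=> M; apply/val_inj/mulVmx/SL_unit. Qed.
Lemma SL_mulr : right_inverse SL_one SL_inv SL_mul.
Proof. by move=> M; apply/val_inj/mulmxV/SL_unit. Qed.

HB.instance Definition _ := isGroup.Build (SL k)
  SL_mulA SL_1mul SL_mul1 SL_mulV SL_mulr.

End SLgroup.

Section SpGroup.
Variable n : nat.
Let J := symp_form n.
HB.instance Definition _ := [Finite of Sp n by <:].

Lemma symp_form_unit : J \in unitmx.
Proof.
suff /mulmx1_unit[] : J *m (- J) = 1%:M by [].
rewrite mulmxN /J /symp_form mulmx_block !mul0mx !mulmx0 !add0r !addr0.
rewrite mulmx1 mul1mx opp_block_mx !oppr0 opprK.
by rewrite [RHS]scalar_mx_block.
Qed.

Lemma isometry_unit (A : 'M_(n + n)) : A *m J *m A^T = J -> A \in unitmx.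
Proof.
move=> isoA; have := symp_form_unit; rewrite -isoA !unitmx_mul.
by case/andP=> /andP[].
Qed.

Lemma isometry_inv (A : 'M_(n + n)) :
  A *m J *m A^T = J -> invmx A *m J *m (invmx A)^T = J.
Proof.
move=> isoA; have unitA := isometry_unit isoA.
rewrite -{1}isoA !mulmxA mulVmx // mul1mx -mulmxA.
by rewrite -trmx_mul mulVmx // trmx1 mulmx1.
Qed.

Lemma Sp_unit (M : Sp n) : val M \in unitmx.
Proof. exact/isometry_unit/eqP/(valP M). Qed.

Lemma Sp1_subproof : 1%:M *m J *m 1%:M^T == J.
Proof. by rewrite trmx1 mulmx1 mul1mx. Qed.
Lemma SpM_subproof (M M' : Sp n) :
  (val M *m val M') *m J *m (val M *m val M')^T == J.
Proof.
case: M M' => [A /= /eqP isoA] [B /= /eqP isoB].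
by rewrite trmx_mul -!mulmxA (mulmxA J) (mulmxA B) (mulmxA B) isoB mulmxA isoA.
Qed.
Lemma SpV_subproof (M : Sp n) : invmx (val M) *m J *m (invmx (val M))^T == J.
Proof. exact/eqP/isometry_inv/eqP/(valP M). Qed.

Definition Sp_one : Sp n := exist (fun M => M *m J *m M^T == J) _ Sp1_subproof.
Definition Sp_mul (M M' : Sp n) : Sp n :=
  exist (fun M => M *m J *m M^T == J) _ (SpM_subproof M M').
Definition Sp_inv (M : Sp n) : Sp n :=
  exist (fun M => M *m J *m M^T == J) _ (SpV_subproof M).

Lemma Sp_mulA : associative Sp_mul.
Proof. by move=> M1 M2 M3; apply/val_inj/mulmxA. Qed.
Lemma Sp_1mul : left_id Sp_one Sp_mul.
Proof. by move=> M; apply/val_inj/mul1mx. Qed.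
Lemma Sp_mul1 : right_id Sp_one Sp_mul.
Proof. by move=> M; apply/val_inj/mulmx1. Qed.
Lemma Sp_mulV : left_inverse Sp_one Sp_inv Sp_mul.
Proof. by move=> M; apply/val_inj/mulVmx/Sp_unit. Qed.
Lemma Sp_mulr : right_inverse Sp_one Sp_inv Sp_mul.
Proof. by move=> M; apply/val_inj/mulmxV/Sp_unit. Qed.

HB.instance Definition _ := isGroup.Build (Sp n)
  Sp_mulA Sp_1mul Sp_mul1 Sp_mulV Sp_mulr.

End SpGroup.

Definition mx2 (a b c d : 'F_p) : 'M['F_p]_2 :=
  \matrix_(i, j) (if i == 0 then if j == 0 then a else b
                  else if j == 0 then c else d).

Lemma det_mx2 a b c d : \det (mx2 a b c d) = a * d - b * c.
Proof.
rewrite (expand_det_row _ 0) !big_ord_recl big_ord0 /cofactor !det_mx11 !mxE /=.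
by rewrite expr0 expr1 mul1r mulN1r mulrN addr0.
Qed.

Lemma SL2_transvection_subproof : \det (mx2 1 1 0 1) == 1.
Proof. by rewrite det_mx2 mulr1 mulr0 subr0. Qed.
Lemma SL2_weyl_subproof : \det (mx2 0 1 (-1) 0) == 1.
Proof. by rewrite det_mx2 mul0r mulrN1 sub0r opprK. Qed.

(* The action of sigma and U' on <e_1, e_2>, and of tau and Z on <e_1, f_1>. *)
Definition SL2_transvection : SL 2 :=
  exist (fun M => \det M == 1) _ SL2_transvection_subproof.
Definition SL2_weyl : SL 2 := exist (fun M => \det M == 1) _ SL2_weyl_subproof.

End LinearGroups.

Definition letter_pair (T : Type) (x y : T) (b : bool) : T := if b then y else x.

Section Generators.
Variable n : nat.

(* Letters for the generators U = (1,2) and V = (1,...,n) of S_n; there is no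
   letter V when n = 2. *)
Inductive sym_letter := SymU | SymV of (2 < n)%N.

Definition sym_code (g : sym_letter) := if g is SymV _ then true else false.
Definition sym_decode (b : bool) :=
  if b then if (2 < n)%N =P true is ReflectT h then Some (SymV h) else None
  else Some SymU.
Lemma sym_codeK : pcancel sym_code sym_decode.
Proof.
case=> //= h; case: eqP => [h'|/(_ h)//].
by congr (Some (SymV _)); apply: bool_irrelevance.
Qed.
HB.instance Definition _ := Countable.copy sym_letter (pcan_type sym_codeK).

Inductive sp_letter := LSigma | LTau | LZ | LU | LV of (2 < n)%N.

Definition sp_code (g : sp_letter) : nat :=
  match g with LSigma => 0 | LTau => 1 | LZ => 2 | LU => 3 | LV _ => 4 end.
Definition sp_decode (k : nat) :=
  match k with
  | 0 => Some LSigma | 1 => Some LTau | 2 => Some LZ | 3 => Some LU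
  | _ => if (2 < n)%N =P true is ReflectT h then Some (LV h) else None
  end.
Lemma sp_codeK : pcancel sp_code sp_decode.
Proof.
case=> //= h; case: eqP => [h'|/(_ h)//].
by congr (Some (LV _)); apply: bool_irrelevance.
Qed.
HB.instance Definition _ := Countable.copy sp_letter (pcan_type sp_codeK).

(* Permutations compose from left to right; the points 1, ..., n are
   0, ..., n.-1 here. *)
Definition sym_gen (n_ge2 : (2 <= n)%N) (g : sym_letter) : 'S_n :=
  match g with
  | SymU => tperm (Ordinal (ltnW n_ge2)) (Ordinal n_ge2)
  | SymV _ => perm (@ordS_inj n)
  end.

End Generators.

Section Relators.
Variables (p n : nat).
(* RS: defining relators for S_n on U, V; RU: for SL(2,p) on sigma, U';
   RZ: for SL(2,p) on tau, Z. *)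
Variables (RS : set (free_group (sym_letter n))).
Variables (RU RZ : set (free_group bool)).

Local Notation sigma := (free_gen (LSigma n)).
Local Notation tau := (free_gen (LTau n)).
Local Notation Z := (free_gen (LZ n)).
Local Notation U := (free_gen (LU n)).
Local Notation V h := (free_gen (LV h)).
Local Notation U' := (if odd p then U * Z ^+ 2 else U).

Definition sym_word (g : sym_letter n) : free_group (sp_letter n) :=
  match g with SymU => U | SymV h => V h end.

(* A relation x = y is encoded by the relator x * y^-1, and "x is centralised by
   y" by the relator [~ x, y]. *)
Inductive sp_relators : set (free_group (sp_letter n)) :=
| rel_sym r : RS r -> sp_relators (free_eval sym_word r)
| rel_Z_order : sp_relators (Z ^+ (if p == 2 then 2 else 4))
| rel_Z_UV (h : (2 < n)%N) : sp_relators [~ Z, U ^ V h]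
| rel_Z_VU (h : (2 < n)%N) : (3 < n)%N -> sp_relators [~ Z, V h * U]
| rel_Z_ZU : sp_relators [~ Z, Z ^ U]
| rel_sigma_ZUZ : sp_relators [~ sigma, Z * U * Z^-1]
| rel_sigma_UV2 (h : (2 < n)%N) :
    (3 < n)%N -> sp_relators [~ sigma, U ^ (V h ^+ 2)]
| rel_sigma_VUUV (h : (2 < n)%N) :
    (4 < n)%N -> sp_relators [~ sigma, V h * U * U ^ V h]
| rel_sigma_ZV2 (h : (2 < n)%N) : sp_relators [~ sigma, Z ^ (V h ^+ 2)]
| rel_sigma_Z2U : odd p -> sp_relators [~ sigma, [~ Z ^+ 2, U]]
| rel_tau_ZU : sp_relators [~ tau, Z ^ U]
| rel_tau_UV (h : (2 < n)%N) : sp_relators [~ tau, U ^ V h]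
| rel_tau_VU (h : (2 < n)%N) :
    (3 < n)%N -> p = 2 -> sp_relators [~ tau, V h * U]
| rel_tau_Z2 : odd p -> sp_relators [~ tau, Z ^+ 2]
| rel_SL_sigma_U r : RU r -> sp_relators (free_eval (letter_pair sigma U') r)
| rel_SL_tau_Z r : RZ r -> sp_relators (free_eval (letter_pair tau Z) r)
| rel_sigma_sigmaV (h : (2 < n)%N) :
    sp_relators ([~ sigma, sigma ^ V h] * (sigma ^ (V h * U))^-1)
| rel_sigma_sigmaVU (h : (2 < n)%N) : sp_relators [~ sigma, sigma ^ (V h * U)]
| rel_sigma_sigmaUV (h : (2 < n)%N) : sp_relators [~ sigma, sigma ^ (U * V h)]
| rel_sigma_sigmaV2 (h : (2 < n)%N) :
    (3 < n)%N -> sp_relators [~ sigma, sigma ^ (V h ^+ 2)]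
| rel_sigma_sigmaZ_odd :
    odd p -> sp_relators ([~ sigma, sigma ^ Z] * ((tau ^+ 2) ^ (Z * U))^-1)
| rel_sigma_sigmaZ_even : ~~ odd p -> sp_relators [~ sigma, sigma ^ Z]
| rel_sigma_tau : sp_relators [~ sigma, tau]
| rel_sigma_tauU :
    sp_relators ([~ sigma, tau ^ U] * (sigma ^ (Z ^ U) * tau^-1)^-1)
| rel_sigma_tauV2 (h : (2 < n)%N) : sp_relators [~ sigma, tau ^ (V h ^+ 2)]
| rel_tau_tauU : sp_relators [~ tau, tau ^ U].

End Relators.

(* Main.v *)
From HB Require Import structures.
Require Import Defs.
From mathcomp Require Import all_boot all_fingroup all_algebra.
From mathcomp Require Import boolp classical_sets.
From mathcomp Require Import ring zify.

Set Implicit Arguments.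
Unset Strict Implicit.
Unset Printing Implicit Defensive.

Import GroupScope.
Local Open Scope group_scope.

(** The relators hold for the matrices, so there is a homomorphism phi from the
presented group G to Sp(2n,p) ([sp_gen_rel]).  It is onto because the images of
the generators yield all symplectic transvections along basis vectors and enough
products of two transvections to clear the coordinates of any vector one at a
time ([Sp_generated]).  What has to be shown is that phi is injective, and this
is done by finding in G the BN-structure of Sp(2n,p), a Chevalley group of type
C_n.

The relations of S_n and those of SL(2,p) on {tau, Z} give homomorphisms rho from
S_n and mu from SL(2,p) into G.
The central calculation takes place in two blocks.  Put b = sigma^(Z^U).  The
relations give [sigma, b] = tau^2, so that sigma, b and tau generate an image of
a Heisenberg group; expanding Z^U as a word in conjugates of tau shows that
(Z^U)^2 inverts sigma, and then the second copy of SL(2,p) acts on this Heisenberg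
group as on its natural module ([heis_act]).  In particular a diagonal matrix
conjugates sigma to a power of sigma.

It follows that conjugating sigma or tau by a monomial element w (a product of
permutations and of signed or diagonal block matrices) gives a subgroup that
depends only on the lines to which w sends the basis vectors f_0 and e_1 that
define sigma, respectively f_0 for tau.  This attaches a root subgroup of G to
each pair {a, b} of basis vectors (up to sign) with b different from -a, the
vector paired with a by the form.  Monomial elements move any two roots to a
standard position, where a commutator relation or the action on the Heisenberg
group gives their commutator; the resulting Chevalley formula is [comm_weight].

Ordering the roots by weight, the commutator formula lets one sort a product of
positive root elements, and the matrix of the product, which is unitriangular,
determines its factors one after the other: phi is injective on the group U
generated by the positive root elements ([positive_inj]).  The relations of
SL(2,p) on {sigma, U'} and on {tau, Z} provide the rank one identities
([rank_one]) with which the set U N U, for N the monomial subgroup, is seen to be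
closed under right multiplication by the generators, hence equal to G
([bruhat_all]).  If u w u' is in the kernel of phi then the matrix of w is
unitriangular as well as monomial, so it is 1; the subgroup N embeds in Sp(2n,p)
([monomial_eq1]), so w = 1, and u u' is an element of U in the kernel, hence
trivial. *)

(** * Presentations and homomorphisms *)

Notation ghom := UMagmaMorphism.type.

Lemma homP (gT hT : groupType) (f : gT -> hT) :
  {morph f : x y / x * y} -> exists h : ghom gT hT, h =1 f.
Proof.
move=> fM; have f1 : f 1 = 1 by apply: (mulgI (f 1)); rewrite -fM !mulg1.
pose hm := isUMagmaMorphism.Build gT hT f (f1, fM).
by exists (HB.pack f hm : ghom gT hT).
Qed.

Section FreeEval.
Variable X : choiceType.
Implicit Types (w r : free_group X).

Lemma free_eval1 (gT : groupType) (f : X -> gT) : free_eval f 1 = 1.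
Proof. by apply: (mulgI (free_eval f 1)); rewrite -free_evalM !mulg1. Qed.

Lemma free_evalV (gT : groupType) (f : X -> gT) w :
  free_eval f w^-1 = (free_eval f w)^-1.
Proof. by apply/esym/mulg1_eq; rewrite -free_evalM mulgV free_eval1. Qed.

Lemma free_evalX (gT : groupType) (f : X -> gT) w k :
  free_eval f (w ^+ k) = free_eval f w ^+ k.
Proof.
by elim: k => [|k IHk]; rewrite ?free_eval1 // !expgS free_evalM IHk.
Qed.

Lemma free_eval_hom (gT : groupType) (f : X -> gT) :
  exists E : ghom (free_group X) gT, E =1 free_eval f.
Proof. by apply: homP => u v; apply: free_evalM. Qed.

Lemma hom_free_eval (gT hT : groupType) (h : ghom gT hT) (f : X -> gT) w :
  h (free_eval f w) = free_eval (h \o f) w.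
Proof.
by rewrite gmulf_prod; apply: eq_bigr => -[x b] _ /=; case: b; rewrite ?gmulfV.
Qed.

Lemma eq_free_eval (gT : groupType) (f f' : X -> gT) w :
  f =1 f' -> free_eval f w = free_eval f' w.
Proof. by move=> ff'; apply: eq_bigr => -[x b] _; rewrite ff'. Qed.

Lemma normal_closure_eval (gT : groupType) (f : X -> gT) R w :
  (forall r, R r -> free_eval f r = 1) -> normal_closure R w ->
  free_eval f w = 1.
Proof.
move=> fR Rw; apply: (Rw [set v | free_eval f v = 1]%classic).
split=> [|//]; split=> [|x y /= fx fy|x y /= fx] /=.
- exact: free_eval1.
- by rewrite free_evalM free_evalV fx fy invg1 mulg1.
by rewrite conjgE !free_evalM fx mul1g free_evalV mulVg.
Qed.

Lemma presents_eval (gT hT : groupType) (g : X -> gT) (f : X -> hT) R w :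
  presents g R -> (forall r, R r -> free_eval f r = 1) ->
  free_eval g w = 1 -> free_eval f w = 1.
Proof. by move=> gR fR gw; apply: normal_closure_eval fR _; rewrite gR. Qed.

Lemma presents_rel (gT : groupType) (g : X -> gT) R r :
  presents g R -> R r -> free_eval g r = 1.
Proof.
move=> gR Rr; have: normal_closure R r by move=> N [_]; apply.
by rewrite gR.
Qed.

(** The classical substitution test (von Dyck); surjectivity of the evaluation
lets a word be chosen for each element of the source. *)
Lemma presents_hom (gT hT : groupType) (g : X -> gT) (f : X -> hT) R :
    presents g R -> (forall x, exists w, free_eval g w = x) ->
    (forall r, R r -> free_eval f r = 1) ->
  exists h : ghom gT hT, forall x, h (g x) = f x.
Proof.
move=> gR g_surj fR; have [s gs] := choice g_surj.
have E w : free_eval f (s (free_eval g w)) = free_eval f w.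
  apply/(mulIg (free_eval f w)^-1); rewrite mulgV -free_evalV -free_evalM.
  by apply: presents_eval gR fR _; rewrite free_evalM gs free_evalV mulgV.
have [x y|h hE] := @homP gT hT (fun x => free_eval f (s x)).
  by rewrite -[x]gs -[y]gs -free_evalM !E free_evalM.
by exists h => x; rewrite hE -{1}(free_eval_gen g) E free_eval_gen.
Qed.

(** The tail of a reduced word is reduced, so induction on the underlying list
stays inside the free group. *)
Lemma free_ind (P : free_group X -> Prop) :
  P 1 -> (forall x u, P u -> P (free_gen x * u)) ->
  (forall x u, P u -> P ((free_gen x)^-1 * u)) -> forall u, P u.
Proof.
move=> P1 Pg PV [u red_u]; elim: u red_u => [|[x b] u IHu] red_u.
  by rewrite (_ : FreeGroup _ = 1) //; apply: val_inj.
have red_u' : reduced u by apply: path_sorted red_u.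
suff -> : FreeGroup red_u =
    (if b then (free_gen x)^-1 else free_gen x) * FreeGroup red_u'.
  by case: b red_u => _; [apply: PV | apply: Pg].
apply: val_inj; case: b red_u => /=; case: u {IHu} red_u' => //= a u _;
  by rewrite /push /= => /andP[/negPf->].
Qed.

End FreeEval.

Section Presented.
Variables (X : choiceType) (R : set (free_group X)).

Lemma pres_hom : exists pi : ghom (free_group X) (presented R),
  pi =1 @pres_pi X R.
Proof. by apply: homP => x y; rewrite -pres_piM. Qed.

Lemma pres_pi_rel r : R r -> pres_pi R r = 1.
Proof.
move=> Rr; apply/esym/pres_piP; rewrite invg1 mul1g => N [_]; exact.
Qed.

Lemma presented_hom (hT : groupType) (f : X -> hT) :
    (forall r, R r -> free_eval f r = 1) ->
  exists h : ghom (presented R) hT,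
    forall w, h (pres_pi R w) = free_eval f w.
Proof.
move=> fR; pose h (x : presented R) := free_eval f (pres_repr x).
have E w : h (pres_pi R w) = free_eval f w.
  have /pres_piP/(normal_closure_eval fR) := pres_reprK (pres_pi R w).
  by rewrite free_evalM free_evalV => /mulg1_eq; rewrite invgK.
have [|h' h'E] := @homP (presented R) hT h; last first.
  by exists h' => w; rewrite h'E E.
by elim/pres_ind=> x; elim/pres_ind=> y; rewrite [_ * _]pres_piM !E free_evalM.
Qed.

End Presented.

(** * Generation of SL(2,p) and of the symmetric group *)

Section SL2.
Variable p : nat.
Import GRing.Theory.
Local Open Scope ring_scope.
Implicit Types (k a b c d : 'F_p) (g : SL p 2).

Local Notation T := (SL2_transvection p).
Local Notation W := (SL2_weyl p).

Lemma mx2_mul a b c d a' b' c' d' :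
  mx2 a b c d *m mx2 a' b' c' d' =
  mx2 (a * a' + b * c') (a * b' + b * d') (c * a' + d * c') (c * b' + d * d').
Proof.
apply/matrixP=> i j; rewrite !mxE big_ord_recl big_ord1 !mxE /=.
by case: ifP; case: ifP.
Qed.

Lemma ord2_cases (i : 'I_2) : (i == 0) || (i == 1).
Proof. by case: i => -[|[|]]. Qed.

Lemma mx2_eta (M : 'M['F_p]_2) : M = mx2 (M 0 0) (M 0 1) (M 1 0) (M 1 1).
Proof.
apply/matrixP=> i j; rewrite mxE.
by case/orP: (ord2_cases i) => /eqP->; case/orP: (ord2_cases j) => /eqP->.
Qed.

Lemma mx2_1 : mx2 1 0 0 1 = 1%:M :> 'M['F_p]_2.
Proof. by rewrite [RHS]mx2_eta !mxE. Qed.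

Fact sl2_subproof a b c d (h : a * d - b * c = 1) : \det (mx2 a b c d) == 1.
Proof. by rewrite det_mx2 h. Qed.
Definition sl2 a b c d (h : a * d - b * c = 1) : SL p 2 :=
  exist (fun M => \det M == 1) _ (sl2_subproof h).

Lemma SL2_det g : val g 0 0 * val g 1 1 - val g 0 1 * val g 1 0 = 1.
Proof. by have /eqP := valP g; rewrite {1}(mx2_eta (val g)) det_mx2. Qed.

Lemma SL2_valM (g h : SL p 2) : val (g * h)%g = val g *m val h.
Proof. by []. Qed.

Lemma SL2_mulE g h i j :
  val (g * h)%g i j = val g i 0 * val h 0 j + val g i 1 * val h 1 j :> 'F_p.
Proof.
rewrite SL2_valM mxE big_ord_recl big_ord1.
by have -> : lift ord0 ord0 = 1 :> 'I_2 by apply: val_inj.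
Qed.

Lemma SL2_val1 : val (1%g : SL p 2) = 1%:M.
Proof. by []. Qed.

Lemma SL2_eq g h : val g = val h -> g = h. Proof. exact: val_inj. Qed.

Lemma upperX (m : nat) : val (T ^+ m)%g = mx2 1 m%:R 0 1.
Proof.
elim: m => [|m IHm]; first by rewrite /= mx2_1.
by rewrite expgSr SL2_valM IHm mx2_mul -natr1; congr mx2; ring.
Qed.

Definition upper k : SL p 2 := (T ^+ (k : nat))%g.
Lemma upperE k : val (upper k) = mx2 1 k 0 1.
Proof. by rewrite upperX natr_Zp. Qed.

Lemma weyl2 : val (W * W)%g = mx2 (-1) 0 0 (-1).
Proof. by rewrite SL2_valM mx2_mul; congr mx2; ring. Qed.

(** Lower unitriangular matrices are written as W^-1 * upper * W with W^3 for
W^-1, so that they are words without inverses in T and W. *)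
Lemma lowerE k : val (W * W * W * upper (- k) * W)%g = mx2 1 0 k 1.
Proof.
by rewrite !SL2_valM upperE !mx2_mul; congr mx2; ring.
Qed.

(** Upper and lower unitriangular matrices are words in T and W, and a matrix
with nonzero lower left entry is a product upper * lower * upper; the other
matrices are brought to this form by a lower unitriangular factor. *)
Lemma SL2_gen_ind (P : SL p 2 -> Prop) :
  P 1%g -> (forall g h, P g -> P h -> P (g * h)%g) -> P T -> P W ->
  forall g, P g.
Proof.
move=> P1 PM PT PW.
have PU k : P (upper k).
  rewrite /upper; elim: (nat_of_ord k) => // m IHm.
  by rewrite expgS; apply: PM.
have [L [PL LE]] : exists L : 'F_p -> SL p 2,
    (forall k, P (L k)) /\ forall k, val (L k) = mx2 1 0 k 1.
  exists (fun k => W * W * W * upper (- k) * W)%g; split=> k; last exact: lowerE.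
  by apply: (PM) => //; apply: (PM) => //; apply: (PM) => //; apply: PM.
have main g : val g 1 0 != 0 -> P g.
  pose a : 'F_p := val g 0 0; pose b : 'F_p := val g 0 1.
  pose c : 'F_p := val g 1 0; pose d : 'F_p := val g 1 1.
  rewrite -/c => c0; have det : a * d - b * c = 1 by apply: SL2_det.
  suff -> : g = (upper ((a - 1) / c)%R * L c * upper ((d - 1) / c)%R)%g.
    exact: PM (PM _ _ (PU _) (PL _)) (PU _).
  apply: SL2_eq; rewrite !SL2_valM !upperE LE !mx2_mul [LHS]mx2_eta.
  rewrite -/a -/b -/c -/d; have bE : b = (a * d - 1) / c.
    by apply: (mulIf c0); rewrite mulfVK // -det; ring.
  by congr mx2; rewrite ?bE; field.
move=> g; case: (eqVneq (val g 1 0) 0) => [c0|]; last exact: main.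
have a0 : val g 0 0 != 0.
  apply/eqP => a0; have := SL2_det g; rewrite a0 c0 mul0r mulr0 subr0.
  by apply/eqP; rewrite eq_sym oner_neq0.
suff -> : g = (L (-1)%R * (L 1%R * g))%g.
  apply: (PM _ _ (PL _)); apply: main; rewrite SL2_valM LE [val g]mx2_eta mx2_mul.
  by rewrite mxE /= c0 mulr0 addr0 mul1r.
rewrite mulgA; apply: SL2_eq; rewrite !SL2_valM !LE mx2_mul.
rewrite -[LHS]mul1mx -mx2_1; congr (_ *m _).
by congr mx2; ring.
Qed.

End SL2.

Section SymmetricGroup.
Variable n : nat.
Implicit Types (s : 'S_n) (i j k : 'I_n).

Section Generation.
Variable P : 'S_n -> Prop.
Hypotheses (P1 : P 1) (PM : forall s t, P s -> P t -> P (s * t)).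

(** Adjacent transpositions above k generate the stabiliser of the first k
points: conjugation gives all transpositions, and these successively bring the
image of each point back. *)
Lemma sym_adjacent_ind (k : nat) :
  (forall i j, (k <= i)%N -> j = i.+1 :> nat -> P (tperm i j)) ->
  forall s, (forall i, (i < k)%N -> s i = i) -> P s.
Proof.
move=> Padj.
have Plt d i j : (k <= i)%N -> j = (i + d.+1)%N :> nat -> P (tperm i j).
  elim: d i j => [|d IHd] i j ki ij; first by apply: Padj; rewrite // ij addn1.
  have lt_l : (i + d.+1 < n)%N.
    by apply: leq_ltn_trans (ltn_ord j); rewrite ij; lia.
  pose l := Ordinal lt_l.
  have lj : j = l.+1 :> nat by rewrite ij /=; lia.
  have kl : (k <= l)%N by rewrite /=; lia.
  have -> : tperm i j = tperm l j * (tperm i l * tperm l j).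
    rewrite -{1}(tpermV l j) -conjgE tpermJ tpermL tpermD //.
      by rewrite -val_eqE /=; lia.
    by rewrite -val_eqE /=; lia.
  by apply: (PM); [apply: Padj|apply: (PM); [apply: IHd|apply: Padj]].
move=> s; have [m] := ubnP (n - k); elim: m k s Padj Plt => // m IHm k s Padj Plt.
move=> lt_nk fix_s; have [le_nk|lt_kn] := leqP n k.
  suff -> : s = 1 by [].
  by apply/permP => i; rewrite perm1 fix_s // (leq_trans (ltn_ord i)).
pose x := Ordinal lt_kn; pose s' := s * tperm x (s x).
have -> : s = s' * tperm x (s x) by rewrite -mulgA tperm2 mulg1.
have le_ks : (k <= s x)%N.
  rewrite leqNgt; apply/negP => lt_sk; have := fix_s _ lt_sk.
  by move/perm_inj => sx; rewrite sx /= ltnn in lt_sk.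
apply: (PM); last first.
  case: (ltngtP k (s x)) le_ks => // [lt_ks|eq_ks] _.
    by apply: (Plt (s x - k).-1) => //=; lia.
  suff -> : s x = x by rewrite tperm1.
  exact/val_inj.
apply: (IHm k.+1) => [i j ki|d i j ki||i]; [apply: Padj|apply: Plt| |]; try lia.
rewrite ltnS leq_eqVlt => /orP[/eqP ik|lt_ik].
  by have -> : i = x; [exact/val_inj|rewrite permM tpermR].
have si := fix_s _ lt_ik; rewrite permM si tpermD //.
  by rewrite -val_eqE /=; lia.
by rewrite -(inj_eq val_inj) /=; lia.
Qed.

(** A permutation that shifts the points above k conjugates the transposition
(k, k+1) to all the adjacent transpositions above k.  The generators of S_n, and
the permutations that centralise Z or sigma in the relations, have this form
for k = 0, 1, 2. *)
Lemma sym_shift_ind (k : nat) (r : 'S_n) :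
  (forall i j, i = k :> nat -> j = k.+1 :> nat -> P (tperm i j)) ->
  ((k.+2 < n)%N ->
     P r /\ forall i, (k <= i)%N -> (i.+1 < n)%N -> r i = i.+1 :> nat) ->
  forall s, (forall i, (i < k)%N -> s i = i) -> P s.
Proof.
move=> Pk Pr; apply: sym_adjacent_ind => i j ki ij.
have [ik|ik] := eqVneq (i : nat) k; first by apply: Pk => //; rewrite ij ik.
have [|{}Pr shift] := Pr; first by have := ltn_ord j; lia.
have PX d : P (r ^+ d) by elim: d => // d IHd; rewrite expgS; apply: PM.
have rX d (l : 'I_n) : (k <= l)%N -> (l + d < n)%N -> (r ^+ d) l = (l + d)%N :> nat.
  move=> kl; elim: d => [|d IHd] ld; first by rewrite perm1 addn0.
  have ld' : (l + d < n)%N by lia.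
  by rewrite expgSr permM shift IHd //; lia.
have lt_k : (k < n)%N by have := ltn_ord i; lia.
have lt_k1 : (k.+1 < n)%N by have := ltn_ord j; lia.
pose x := Ordinal lt_k; pose y := Ordinal lt_k1.
have -> : tperm i j = (r ^+ (i - k))^-1 * (tperm x y * r ^+ (i - k)).
  rewrite -conjgE tpermJ; congr tperm; apply: val_inj; rewrite /= rX //=;
    by have := ltn_ord j; lia.
rewrite invg_expg -expgnA; apply: (PM); first exact: PX.
by apply: (PM); [apply: Pk|apply: PX].
Qed.

End Generation.

Lemma cyclic_permX d i : val ((perm (@ordS_inj n) ^+ d) i) = (i + d) %% n.
Proof.
elim: d => [|d IHd]; first by rewrite perm1 addn0 modn_small.
by rewrite expgSr permM permE /= IHd -(addn1 (_ %% _)) modnDml addn1 addnS.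
Qed.

Variable n_ge2 : (2 <= n)%N.

Lemma sym_gen_ind (P : 'S_n -> Prop) :
  P 1 -> (forall s t, P s -> P t -> P (s * t)) ->
  (forall g, P (sym_gen n_ge2 g)) -> forall s, P s.
Proof.
move=> P1 PM Pg s.
pose r : 'S_n := perm (@ordS_inj n).
apply: (@sym_shift_ind P P1 PM 0 r) => // [i j i0 j1|n3].
  suff -> : tperm i j = sym_gen n_ge2 (SymU n) by [].
  by congr tperm; apply: val_inj.
split=> [|i _ lt_in]; last by rewrite permE /= modn_small.
exact: (Pg (SymV n3)).
Qed.

(** One step in extending a partial injection to a permutation. *)
Lemma perm_extend s x y :
  exists t : 'S_n, t x = y /\ forall z, z != x -> s z != y -> t z = s z.
Proof.
exists (s * tperm (s x) y); split=> [|z zx szy]; rewrite permM ?tpermL //.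
by rewrite tpermD // 1?(inj_eq perm_inj) eq_sym.
Qed.

Lemma perm_map2 x1 x2 y1 y2 : x1 != x2 -> y1 != y2 ->
  exists s : 'S_n, s x1 = y1 /\ s x2 = y2.
Proof.
move=> x12 y12; have [s1 [E1 _]] := perm_extend 1 x1 y1.
have [s2 [E2 /(_ x1 x12)]] := perm_extend s1 x2 y2.
by rewrite E1 => /(_ y12) F1; exists s2.
Qed.

Lemma perm_map3 x1 x2 x3 y1 y2 y3 :
  uniq [:: x1; x2; x3] -> uniq [:: y1; y2; y3] ->
  exists s : 'S_n, [/\ s x1 = y1, s x2 = y2 & s x3 = y3].
Proof.
rewrite /= !inE !negb_or !andbT => /andP[/andP[x12 x13] x23].
move=> /andP[/andP[y12 y13] y23]; have [s2 [E1 E2]] := perm_map2 x12 y12.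
have [s3 [E3 F]] := perm_extend s2 x3 y3.
by exists s3; split; rewrite // F ?E1 ?E2.
Qed.

Lemma perm_map4 x1 x2 x3 x4 y1 y2 y3 y4 :
  uniq [:: x1; x2; x3; x4] -> uniq [:: y1; y2; y3; y4] ->
  exists s : 'S_n, [/\ s x1 = y1, s x2 = y2, s x3 = y3 & s x4 = y4].
Proof.
rewrite /= !inE !negb_or !andbT.
move=> /and3P[/and3P[x12 x13 x14] /andP[x23 x24] x34].
move=> /and3P[/and3P[y12 y13 y14] /andP[y23 y24] y34].
have ux : uniq [:: x1; x2; x3] by rewrite /= !inE !negb_or x12 x13 x23.
have uy : uniq [:: y1; y2; y3] by rewrite /= !inE !negb_or y12 y13 y23.
have [s3 [E1 E2 E3]] := perm_map3 ux uy.
have [s4 [E4 F]] := perm_extend s3 x4 y4.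
by exists s4; split; rewrite // F ?E1 ?E2 ?E3.
Qed.

End SymmetricGroup.

Section Stabilizers.
Variables (n : nat) (n_ge2 : (2 <= n)%N).
Local Notation i0 := (Ordinal (ltnW n_ge2)).
Local Notation i1 := (Ordinal n_ge2).
Local Notation u := (tperm i0 i1 : 'S_n).
Local Notation v := (perm (@ordS_inj n) : 'S_n).

Lemma cycS (i : 'I_n) : (i.+1 < n)%N -> v i = i.+1 :> nat.
Proof. by move=> lt_i; rewrite permE /= modn_small. Qed.

Lemma tperm01_big (i : 'I_n) : (1 < i)%N -> u i = i.
Proof. by move=> i_gt1; rewrite tpermD // -(inj_eq val_inj) /=; lia. Qed.

Lemma cyc0 : v i0 = i1.
Proof. by apply: val_inj; rewrite /= cycS. Qed.

Lemma tperm01V (i j : 'I_n) : i = 1%N :> nat -> j = 2 :> nat -> tperm i j = u ^ v.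
Proof.
move=> i1E j2E; rewrite tpermJ cyc0; congr tperm; apply: val_inj => //=.
by rewrite cycS //= -j2E.
Qed.

Lemma fix_below1 (s : 'S_n) : s i0 = i0 -> forall i : 'I_n, (i < 1)%N -> s i = i.
Proof. by move=> s0 i; rewrite ltnS leqn0 => /eqP i0E; have -> : i = i0 by apply: val_inj. Qed.

Lemma fix_below2 (s : 'S_n) : s i0 = i0 -> s i1 = i1 ->
  forall i : 'I_n, (i < 2)%N -> s i = i.
Proof.
move=> s0 s1 i; rewrite ltnS leq_eqVlt ltnS leqn0 => /orP[] /eqP iE.
  by have -> : i = i1 by apply: val_inj.
by have -> : i = i0 by apply: val_inj.
Qed.

Section Induction.
Variable P : 'S_n -> Prop.
Hypotheses (P1 : P 1) (PM : forall s t, P s -> P t -> P (s * t)).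

(** In the words of the relations, U^V is the transposition of the points 1 and
2, and V U fixes the point 0 and shifts the points 1, 2, and so on. *)
Lemma stab1_ind : ((2 < n)%N -> P (u ^ v)) -> ((3 < n)%N -> P (v * u)) ->
  forall s : 'S_n, s i0 = i0 -> P s.
Proof.
move=> Puv Pvu s /fix_below1; apply: (@sym_shift_ind n P P1 PM 1 (v * u)).
  by move=> i j iE jE; rewrite (tperm01V iE jE); apply: Puv; rewrite -jE.
move=> n3; split=> [|i i_gt0 lt_in]; first exact: Pvu.
by rewrite permM tperm01_big cycS.
Qed.

(** Here U^(V^2) is the transposition of the points 2 and 3, and V U U^V fixes
the points 0 and 1 and shifts the others. *)
Lemma stab2_ind : ((3 < n)%N -> P (u ^ (v ^+ 2))) ->
  ((4 < n)%N -> P (v * u * u ^ v)) ->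
  forall s : 'S_n, s i0 = i0 -> s i1 = i1 -> P s.
Proof.
move=> Puv Pvu s s0 s1; move: (fix_below2 s0 s1).
apply: (@sym_shift_ind n P P1 PM 2 (v * u * u ^ v)).
  move=> i j iE jE; suff -> : tperm i j = u ^ (v ^+ 2) by apply: Puv; rewrite -jE.
  have lt2 : (2 < n)%N by rewrite -iE.
  rewrite expg2 conjgM -(@tperm01V i1 (Ordinal lt2)) // tpermJ.
  congr tperm; apply: val_inj; rewrite /= cycS ?iE ?jE //=.
  by rewrite -jE.
move=> n4; split=> [|i i_gt1 lt_in]; first exact: Pvu.
have lt2 : (2 < n)%N by lia.
rewrite permM -(@tperm01V i1 (Ordinal lt2)) // permM tperm01_big ?cycS //; last lia.
by rewrite tpermD ?cycS // -(inj_eq val_inj) /= cycS //=; lia.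
Qed.

(** Of the adjacent transpositions fixing 0, only that of 1 and 2 moves 1.  This
serves for odd p, where tau^2, and hence tau, commutes with the permutations that
fix both points. *)
Lemma stab12_ind : ((2 < n)%N -> P (u ^ v)) ->
  (forall s : 'S_n, s i0 = i0 -> s i1 = i1 -> P s) -> forall s : 'S_n, s i0 = i0 -> P s.
Proof.
move=> Puv P2 s /fix_below1; apply: (@sym_adjacent_ind n P P1 PM 1).
move=> i j i_gt0 ij; have [i1E|i_gt1] := eqVneq (i : nat) 1%N.
  have jE : j = 2 :> nat by rewrite ij i1E.
  by rewrite (tperm01V i1E jE); apply: Puv; rewrite -jE.
apply: P2; rewrite tpermD // -(inj_eq val_inj) /=; lia.
Qed.

End Induction.
End Stabilizers.

(** * Symplectic matrices acting on row vectors *)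

(** The basis vector e_i is (i, false) and f_i is (i, true), so that the
symmetries of the basis act on an index and a sign separately. *)
Definition basis_pt (n : nat) := ('I_n * bool)%type.
Definition opp_point n (u : basis_pt n) : basis_pt n := (u.1, ~~ u.2).

Lemma opp_pointK n : involutive (@opp_point n).
Proof. by case=> i e; rewrite /opp_point /= negbK. Qed.

Section Symplectic.
Variables p n : nat.
Import GRing.Theory.
Local Open Scope ring_scope.
Local Notation F := 'F_p.
Local Notation V := ('rV[F]_(n + n)).
Local Notation Pt := (basis_pt n).
Local Notation J := (symp_form p n).
Implicit Types (u v w : V) (a b : Pt) (c : F) (M N : Sp p n).

Definition pt a : 'I_(n + n) := if a.2 then rshift n a.1 else lshift n a.1.
Definition qt (x : 'I_(n + n)) : Pt :=
  match split x with inl i => (i, false) | inr i => (i, true) end.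

Lemma ptK : cancel pt qt.
Proof.
by case=> i [] /=; rewrite /qt /pt /=; case: split_ordP => k // /eqP;
  rewrite ?(inj_eq (@lshift_inj _ _)) ?(inj_eq (@rshift_inj _ _)) ?eq_rlshift
          ?eq_lrshift // => /eqP->.
Qed.

Lemma qtK : cancel qt pt.
Proof. by move=> x; rewrite /qt /pt; case: split_ordP => k /= ->. Qed.

Definition bv a : V := delta_mx 0 (pt a).

Lemma bvE a b : bv a 0 (pt b) = (a == b)%:R.
Proof. by rewrite mxE eqxx (inj_eq (can_inj ptK)) eq_sym. Qed.

Lemma coordD u v a : (u + v) 0 (pt a) = u 0 (pt a) + v 0 (pt a).
Proof. by rewrite mxE. Qed.

Lemma coord_bv c a b : (c *: bv a) 0 (pt b) = c * (a == b)%:R.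
Proof. by rewrite mxE bvE. Qed.

Lemma rV_point_eq u v : (forall a, u 0 (pt a) = v 0 (pt a)) -> u = v.
Proof. by move=> uv; apply/rowP => x; rewrite -(qtK x) uv. Qed.

Lemma sum_point (T : nmodType) (f : 'I_(n + n) -> T) :
  \sum_x f x = \sum_(i < n) (f (pt (i, false)) + f (pt (i, true))).
Proof. by rewrite big_split_ord big_split. Qed.

Lemma rV_decomp u :
  u = \sum_(i < n) (u 0 (pt (i, false)) *: bv (i, false) +
                    u 0 (pt (i, true)) *: bv (i, true)).
Proof. by rewrite {1}[u]row_sum_delta sum_point. Qed.

(** The form and the action on vectors are locked: unification would otherwise
unfold them down to the arithmetic of the prime field. *)
Definition sform_def u v : F := (u *m J *m v^T) 0 0.
Fact sform_key : unit. Proof. by []. Qed.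
Definition sform := locked_with sform_key sform_def.
Lemma sform_unlock u v : sform u v = (u *m J *m v^T) 0 0.
Proof. by rewrite /sform unlock. Qed.

Lemma sformDl u v w : sform (u + v) w = sform u w + sform v w.
Proof. by rewrite !sform_unlock !mulmxDl mxE. Qed.
Lemma sformDr u v w : sform w (u + v) = sform w u + sform w v.
Proof. by rewrite !sform_unlock linearD /= mulmxDr mxE. Qed.
Lemma sformZl c u v : sform (c *: u) v = c * sform u v.
Proof. by rewrite !sform_unlock -!scalemxAl mxE. Qed.
Lemma sformZr c u v : sform u (c *: v) = c * sform u v.
Proof. by rewrite !sform_unlock linearZ /= -scalemxAr mxE. Qed.
Lemma sform0r u : sform u 0 = 0. Proof. by rewrite !sform_unlock trmx0 mulmx0 mxE. Qed.

Definition sgn a : F := if a.2 then -1 else 1.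

Lemma sform_pt u a : sform u (bv a) = - sgn a * u 0 (pt (opp_point a)).
Proof.
rewrite !sform_unlock trmx_delta -colE mxE mxE sum_point.
case: a => i e; rewrite (bigD1 i) //= big1 ?addr0 => [|j ji]; last first.
  rewrite /pt /= /symp_form; case: e;
  rewrite ?block_mxEul ?block_mxEur ?block_mxEdl ?block_mxEdr !mxE;
  by rewrite ?(negPf ji) ?mulr0n ?oppr0 ?mulr0 ?addr0.
rewrite /pt /= /symp_form; case: e;
  rewrite ?block_mxEul ?block_mxEur ?block_mxEdl ?block_mxEdr !mxE eqxx.
  by rewrite /sgn /=; ring.
by rewrite /sgn /=; ring.
Qed.

Lemma sform_bv a b : sform (bv a) (bv b) = if b == opp_point a then sgn a else 0.
Proof.
rewrite sform_pt bvE; case: a b => [i e] [j e'] /=.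
rewrite /sgn /opp_point !xpair_eqE /= (eq_sym i).
by case: eqP => //= _; case: e; case: e' => //=; ring.
Qed.

Definition sp_act_def u M : V := u *m val M.
Fact sp_act_key : unit. Proof. by []. Qed.
Definition sp_act := locked_with sp_act_key sp_act_def.
Lemma sp_act_unlock u M : sp_act u M = u *m val M.
Proof. by rewrite /sp_act unlock. Qed.
Local Notation "u ** M" := (sp_act u M) (at level 40, left associativity).

Lemma spactDl u v M : (u + v) ** M = u ** M + v ** M.
Proof. by rewrite !sp_act_unlock; apply: mulmxDl. Qed.
Lemma spactZl c v M : (c *: v) ** M = c *: (v ** M).
Proof. by rewrite !sp_act_unlock -scalemxAl. Qed.
Lemma spactNl v M : (- v) ** M = - (v ** M).
Proof. by rewrite !sp_act_unlock; apply: mulNmx. Qed.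
Lemma spact0l M : 0 ** M = 0.
Proof. by rewrite !sp_act_unlock; apply: mul0mx. Qed.
Lemma spactM v M N : v ** (M * N)%g = v ** M ** N.
Proof. by rewrite !sp_act_unlock; apply: mulmxA. Qed.
Lemma spact1 v : v ** 1%g = v.
Proof. by rewrite !sp_act_unlock; apply: mulmx1. Qed.
Lemma spactKV M v : v ** M ** M^-1%g = v.
Proof. by rewrite -spactM mulgV spact1. Qed.
Lemma spactK M v : v ** M^-1%g ** M = v.
Proof. by rewrite -spactM mulVg spact1. Qed.

Lemma sform_act M u v : sform (u ** M) (v ** M) = sform u v.
Proof.
by rewrite !sform_unlock !sp_act_unlock trmx_mul -!mulmxA (mulmxA (val M)) (mulmxA (val M *m J))
  (eqP (valP M)).
Qed.

Lemma Sp_eq M N : (forall a, bv a ** M = bv a ** N) -> M = N.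
Proof.
move=> MN; apply: val_inj; apply/row_matrixP => x.
by have := MN (qt x); rewrite !sp_act_unlock /bv qtK -!rowE.
Qed.

Lemma Sp_eqv M N : (forall v, v ** M = v ** N) -> M = N.
Proof. by move=> MN; apply: Sp_eq. Qed.

Lemma Sp_formP (A : 'M[F]_(n + n)) :
  (forall a b, sform (bv a *m A) (bv b *m A) = sform (bv a) (bv b)) ->
  A *m J *m A^T == J.
Proof.
move=> isoA; apply/eqP/matrixP => x y.
have E (B : 'M[F]_(n + n)) : (bv (qt x) *m B *m (bv (qt y))^T) 0 0 = B x y.
  by rewrite /bv !qtK trmx_delta -colE -rowE !mxE.
have := isoA (qt x) (qt y); rewrite !sform_unlock trmx_mul E => <-.
by rewrite -E !mulmxA.
Qed.

Lemma spact_insubd (A : 'M[F]_(n + n)) v :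
  (forall a b, sform (bv a *m A) (bv b *m A) = sform (bv a) (bv b)) ->
  v ** insubd (1%g : Sp p n) A = v *m A.
Proof. by move=> /Sp_formP isoA; rewrite !sp_act_unlock val_insubd isoA. Qed.

(** Meaningful only when the images of the basis vectors have the right products;
the default value 1 makes the definition total. *)
Definition Sp_of (f : Pt -> V) : Sp p n :=
  insubd (1%g : Sp p n) (\matrix_x f (qt x)).

Lemma Sp_ofE (f : Pt -> V) a :
  (forall a b, sform (f a) (f b) = sform (bv a) (bv b)) ->
  bv a ** Sp_of f = f a.
Proof.
have bvM b : bv b *m (\matrix_x f (qt x)) = f b.
  by rewrite /bv -rowE rowK ptK.
move=> isof; rewrite !sp_act_unlock val_insubd ifT ?bvM //.
by apply: Sp_formP => b c; rewrite !bvM.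
Qed.

End Symplectic.

Notation "u ** M" := (sp_act u M) (at level 40, left associativity).

(** * Transvection calculus over an alternating form *)

(* The calculations are done over an abstract module with enough coordinates,
   where they are insensitive to how the prime field and row vectors are built. *)
Section Transvections.
Import GRing.Theory.
Local Open Scope ring_scope.
Variables (F : comNzRingType) (V : lmodType F) (I : Type).
Variables (co : I -> V -> F) (B : V -> V -> F).
Hypotheses (coD : forall x, {morph co x : u v / u + v})
  (coZ : forall x c u, co x (c *: u) = c * co x u)
  (co_inj : forall u v, (forall x, co x u = co x v) -> u = v)
  (BDl : forall u v w, B (u + v) w = B u w + B v w)
  (BZl : forall c u v, B (c *: u) v = c * B u v)
  (BC : forall u v, B v u = - B u v) (Balt : forall u, B u u = 0).
Implicit Types (u v w x : V) (c d : F).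

Let BDr u v w : B w (u + v) = B w u + B w v.
Proof. by rewrite !(BC _ w) BDl opprD. Qed.
Let BZr c u v : B u (c *: v) = c * B u v.
Proof. by rewrite !(BC _ u) BZl mulrN. Qed.
Let coN y : {morph co y : u / - u}.
Proof. by move=> u; rewrite -scaleN1r coZ mulN1r. Qed.
Let co0 y : co y 0 = 0.
Proof. by rewrite -(scale0r 0) coZ mul0r. Qed.
Let BNl u v : B (- u) v = - B u v.
Proof. by rewrite -scaleN1r BZl mulN1r. Qed.
Let BNr u v : B u (- v) = - B u v.
Proof. by rewrite -scaleN1r BZr mulN1r. Qed.

(** For an alternating form B, [tv c u] is a transvection, and [btv u v] is the
isometry obtained by polarising it when B u v = 0: it is the root element attached
to the pair {u, v}, as [tv] is to u. *)
Definition tv c u w := w + (c * B w u) *: u.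
Definition btv u v w := w + B w u *: v + B w v *: u.

Let lin := (BDl, BZl, BDr, BZr, BNl, BNr, Balt).
Let col := (coD, coZ, coN, co0).

Lemma tv_iso c u w w' : B (tv c u w) (tv c u w') = B w w'.
Proof. rewrite /tv !lin (BC w' u); ring. Qed.

Lemma tvD c d u w : tv d u (tv c u w) = tv (c + d) u w.
Proof. by apply: co_inj => y; rewrite /tv !lin !col; ring. Qed.

Lemma tvZ c d u w : tv c (d *: u) w = tv (c * d ^+ 2) u w.
Proof. by apply: co_inj => y; rewrite /tv !lin !col; ring. Qed.

Lemma tv_btv u v w : B u v = 0 ->
  tv (- 1) v (tv (- 1) u (tv 1 (u + v) w)) = btv u v w.
Proof.
move=> uv; apply: co_inj => y; rewrite /tv /btv !lin !col.
by rewrite (BC u v) uv; ring.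
Qed.

Lemma btvD u v v' w : B u v = 0 -> B u v' = 0 -> B v v' = 0 ->
  btv u v' (btv u v w) = btv u (v + v') w.
Proof.
move=> e1 e2 e3; apply: co_inj => y; rewrite /btv !lin !col.
by rewrite (BC u v) e1 e2 e3; ring.
Qed.

Lemma btvN u v w : B u v = 0 -> btv (- u) v (btv u v w) = w.
Proof.
move=> e1; apply: co_inj => y; rewrite /btv !lin !col (BC u v) e1; ring.
Qed.

Lemma btv_commute u v u' v' w :
  B u v = 0 -> B u' v' = 0 -> B u u' = 0 -> B u v' = 0 -> B v u' = 0 ->
  B v v' = 0 -> btv u' v' (btv u v w) = btv u v (btv u' v' w).
Proof.
move=> uv uv' e1 e2 e3 e4; apply: co_inj => y; rewrite /btv !lin !col.
by rewrite (BC u u') (BC u v') (BC v u') (BC v v') e1 e2 e3 e4; ring.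
Qed.

Lemma btv_tv_commute u v c u' w : B u v = 0 -> B u u' = 0 -> B v u' = 0 ->
  tv c u' (btv u v w) = btv u v (tv c u' w).
Proof.
move=> uv uw vw; apply: co_inj => y; rewrite /tv /btv !lin !col.
by rewrite (BC u u') (BC v u') uw vw; ring.
Qed.

(** The Chevalley commutator of two short root elements sharing the block of v
and v'; the scalar B v v' is the structure constant. *)
Lemma btv_comm u v v' w x :
  B u v = 0 -> B v' w = 0 -> B u v' = 0 -> B u w = 0 -> B v w = 0 ->
  btv v' w (btv u v x) = btv u (B v v' *: w) (btv u v (btv v' w x)).
Proof.
move=> uv vw' e1 e2 e3; apply: co_inj => y; rewrite /btv !lin !col.
rewrite (BC u v') (BC u w) (BC v w) (BC u v).
rewrite e1 e2 e3 uv (BC v v') vw'; ring.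
Qed.

(** Two short root elements whose roots add up to a long root; the factor 2 is
why squares of tau appear in the relations. *)
Lemma btv_comm_long u u' v x : B u v = 0 -> B u' v = 0 ->
  btv u' v (btv u v x) = tv (B u u' *+ 2) v (btv u v (btv u' v x)).
Proof.
move=> uv uv'; apply: co_inj => y; rewrite /btv /tv !lin !col.
rewrite (BC u v) (BC u' v) (BC u u') uv uv'; ring.
Qed.

(** A short and a long root element: both a short and a long root arise. *)
Lemma btv_tv_comm u v w x : B u v = 0 -> B u w = 0 ->
  tv 1 w (btv u v x) =
  tv (- B v w ^+ 2) u (btv u (B v w *: w) (btv u v (tv 1 w x))).
Proof.
move=> uv uw; apply: co_inj => y; rewrite /btv /tv !lin !col.
rewrite (BC u v) (BC u w) (BC v w) uv uw; ring.
Qed.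

End Transvections.

Section SymplecticElements.
Variables p n : nat.
Import GRing.Theory.
Local Open Scope ring_scope.
Local Notation F := 'F_p.
Local Notation V := ('rV[F]_(n + n)).
Local Notation Pt := (basis_pt n).
Local Notation J := (symp_form p n).
Local Notation bv := (@bv p n).
Implicit Types (u v w : V) (a b : Pt) (c : F) (M N : Sp p n).

Lemma sformE u v : sform u v =
  \sum_(i < n) (u 0 (pt (i, false)) * v 0 (pt (i, true))
                - u 0 (pt (i, true)) * v 0 (pt (i, false))).
Proof.
rewrite {1}[v]rV_decomp sform_unlock linear_sum mulmx_sumr summxE; apply: eq_bigr => i _.
by rewrite -sform_unlock sformDr !sformZr !sform_pt /sgn /opp_point /=; ring.
Qed.

Lemma sformC u v : sform v u = - sform u v.
Proof. by rewrite !sformE -sumrN; apply: eq_bigr => i _; ring. Qed.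

Lemma sform_alt u : sform u u = 0.
Proof. by rewrite sformE big1 // => i _; ring. Qed.

Local Notation co := (fun (x : 'I_(n + n)) (u : V) => u 0 x).
Let coD x : {morph co x : u v / u + v}. Proof. by move=> u v; rewrite /= mxE. Qed.
Let coZ x c u : co x (c *: u) = c * co x u. Proof. by rewrite /= mxE. Qed.
Let co_inj u v : (forall x, co x u = co x v) -> u = v.
Proof. by move=> uv; apply/rowP. Qed.
Let Bl : forall u v w, sform (u + v) w = sform u w + sform v w.
Proof. exact: sformDl. Qed.
Let Bz : forall c u v, sform (c *: u) v = c * sform u v.
Proof. exact: sformZl. Qed.

Let Bc : forall u v, sform v u = - sform u v. Proof. exact: sformC. Qed.
Let Ba : forall u, sform u u = 0. Proof. exact: sform_alt. Qed.

Definition transv_def c u : Sp p n :=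
  insubd (1%g : Sp p n) (1%:M + c *: (J *m u^T *m u)).
Fact transv_key : unit. Proof. by []. Qed.
Definition transv := locked_with transv_key transv_def.

Lemma transvE c u w : w ** transv c u = tv (@sform p n) c u w.
Proof.
have E v : v *m (1%:M + c *: (J *m u^T *m u)) = tv (@sform p n) c u v.
  rewrite mulmxDr mulmx1 -scalemxAr !mulmxA [v *m J *m _]mx11_scalar.
  by rewrite -sform_unlock mul_scalar_mx scalerA.
rewrite /transv unlock spact_insubd ?E // => a b; rewrite !E.
exact: (@tv_iso _ _ (@sform p n)).
Qed.

Lemma transvJ c u M : (transv c u ^ M)%g = transv c (u ** M).
Proof.
apply: Sp_eqv => v; rewrite conjgE !spactM !transvE /tv spactDl.
rewrite spactK spactZl.
have -> // : sform v (u ** M) = sform (v ** M^-1%g) u.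
by rewrite -[RHS](sform_act M) spactK.
Qed.

Lemma transvM c d u : (transv c u * transv d u)%g = transv (c + d) u.
Proof.
apply: Sp_eqv => v; rewrite spactM !transvE.
exact: (tvD coD coZ co_inj Bl Bz Ba).
Qed.

Lemma transv0 u : transv 0 u = 1%g.
Proof. by apply: Sp_eqv => v; rewrite transvE /tv mul0r scale0r addr0 spact1. Qed.

Lemma transvN c u : (transv c u)^-1%g = transv (- c) u.
Proof. by apply/mulg1_eq; rewrite transvM addrN transv0. Qed.

Lemma transvX c u k : (transv c u ^+ k)%g = transv (k%:R * c) u.
Proof.
elim: k => [|k IHk]; first by rewrite mul0r transv0.
rewrite expgS IHk transvM; congr transv.
by rewrite -nat1r mulrDl mul1r.
Qed.

Lemma transvZ c d u : transv c (d *: u) = transv (c * d ^+ 2) u.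
Proof.
apply: Sp_eqv => v; rewrite !transvE.
exact: (tvZ coD coZ co_inj Bz Bc).
Qed.

(** When <u, v> = 0 this is w |-> w + <w, u> v + <w, v> u; writing it as a
product of transvections makes it symplectic for all u and v. *)
Definition bitransv_def u v : Sp p n :=
  (transv 1%R (u + v)%R * transv (-1)%R u * transv (-1)%R v)%g.
Fact bitransv_key : unit. Proof. by []. Qed.
Definition bitransv := locked_with bitransv_key bitransv_def.
Lemma bitransv_unlock u v :
  bitransv u v = (transv 1%R (u + v)%R * transv (-1)%R u * transv (-1)%R v)%g.
Proof. by rewrite /bitransv unlock. Qed.

Lemma bitransvE u v w : sform u v = 0 ->
  w ** bitransv u v = btv (@sform p n) u v w.
Proof.
move=> uv; rewrite !bitransv_unlock !spactM !transvE.
exact: (tv_btv coD coZ co_inj Bl Bz Bc Ba w uv).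
Qed.

Lemma bitransvJ u v M : (bitransv u v ^ M)%g = bitransv (u ** M) (v ** M).
Proof. by rewrite !bitransv_unlock !conjMg !transvJ spactDl. Qed.

Lemma bitransvNN u v : bitransv (- u) (- v) = bitransv u v.
Proof.
by rewrite !bitransv_unlock -opprD -!(scaleN1r (_ : V)) !transvZ sqrrN expr1n !mulr1.
Qed.

Lemma sform0C u v : sform u v = 0 -> sform v u = 0.
Proof. by move=> uv; rewrite sformC uv oppr0. Qed.

Lemma bitransvC u v : sform u v = 0 -> bitransv u v = bitransv v u.
Proof.
move=> uv; apply: Sp_eqv => w; rewrite (bitransvE _ uv).
by rewrite (bitransvE _ (sform0C uv)) /btv addrAC.
Qed.

Lemma bitransvZl c u v : sform u v = 0 ->
  bitransv (c *: u) v = bitransv u (c *: v).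
Proof.
move=> uv; apply: Sp_eqv => w.
have uv1 : sform (c *: u) v = 0 by rewrite sformZl uv mulr0.
have uv2 : sform u (c *: v) = 0 by rewrite sformZr uv mulr0.
rewrite (bitransvE _ uv1) (bitransvE _ uv2) /btv !sformZr !scalerA.
by rewrite (mulrC (sform w v)) (mulrC (sform w u)).
Qed.

Lemma bitransv0r u : bitransv u 0 = 1%g.
Proof.
apply: Sp_eqv => w; rewrite bitransvE ?sform0r // /btv sform0r.
by rewrite scaler0 scale0r !addr0 spact1.
Qed.

Lemma bitransvMr u v v' : sform u v = 0 -> sform u v' = 0 -> sform v v' = 0 ->
  (bitransv u v * bitransv u v')%g = bitransv u (v + v').
Proof.
move=> uv uv' vv'; apply: Sp_eqv => w.
have uvv : sform u (v + v') = 0 by rewrite sformDr uv uv' addr0.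
rewrite spactM (bitransvE _ uv) (bitransvE _ uv') (bitransvE _ uvv).
exact: (btvD coD coZ co_inj Bl Bz Bc Ba w uv uv' vv').
Qed.

Lemma bitransvX u v k : sform u v = 0 ->
  (bitransv u v ^+ k)%g = bitransv u (k%:R *: v).
Proof.
move=> uv; elim: k => [|k IHk]; first by rewrite scale0r bitransv0r.
rewrite expgS IHk bitransvMr ?sformZr ?sform_alt ?uv ?mulr0 //.
by congr bitransv; rewrite -nat1r scalerDl scale1r.
Qed.

Lemma bitransvN u v : sform u v = 0 -> (bitransv u v)^-1%g = bitransv (- u) v.
Proof.
move=> uv; have uv' : sform (- u) v = 0 by rewrite -scaleN1r sformZl uv mulr0.
apply/mulg1_eq/Sp_eqv => w.
rewrite spactM (bitransvE _ uv) (bitransvE _ uv') spact1.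
exact: (btvN coD coZ co_inj Bl Bz Bc Ba w uv).
Qed.

Lemma bitransv_commute u v u' v' :
  sform u v = 0 -> sform u' v' = 0 -> sform u u' = 0 -> sform u v' = 0 ->
  sform v u' = 0 -> sform v v' = 0 ->
  commute (bitransv u v) (bitransv u' v').
Proof.
move=> uv uv' e1 e2 e3 e4; apply: Sp_eqv => w.
rewrite !spactM !(bitransvE _ uv) !(bitransvE _ uv').
exact: (btv_commute coD coZ co_inj Bl Bz Bc w uv uv' e1 e2 e3 e4).
Qed.

Lemma bitransv_transv_commute u v c w :
  sform u v = 0 -> sform u w = 0 -> sform v w = 0 ->
  commute (bitransv u v) (transv c w).
Proof.
move=> uv uw vw; apply: Sp_eqv => x; rewrite !spactM !(bitransvE _ uv) !transvE.
exact: (btv_tv_commute coD coZ co_inj Bl Bz Bc c x uv uw vw).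
Qed.

Lemma bitransv_comm u v v' w :
  sform u v = 0 -> sform v' w = 0 -> sform u v' = 0 -> sform u w = 0 ->
  sform v w = 0 ->
  (bitransv u v * bitransv v' w)%g =
  (bitransv v' w * bitransv u v * bitransv u (sform v v' *: w)%R)%g.
Proof.
move=> uv vw' e1 e2 e3; apply: Sp_eqv => x.
have uz : sform u (sform v v' *: w) = 0 by rewrite sformZr e2 mulr0.
rewrite !spactM !(bitransvE _ uv) !(bitransvE _ vw') (bitransvE _ uz).
exact: (btv_comm coD coZ co_inj Bl Bz Bc Ba x uv vw' e1 e2 e3).
Qed.

Lemma bitransv_comm_long u u' v :
  sform u v = 0 -> sform u' v = 0 ->
  (bitransv u v * bitransv u' v)%g =
  (bitransv u' v * bitransv u v * transv (sform u u' *+ 2)%R v)%g.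
Proof.
move=> uv uv'; apply: Sp_eqv => x.
rewrite !spactM !(bitransvE _ uv) !(bitransvE _ uv') transvE.
exact: (btv_comm_long coD coZ co_inj Bl Bz Bc Ba x uv uv').
Qed.

Lemma bitransv_transv_comm u v w : sform u v = 0 -> sform u w = 0 ->
  (bitransv u v * transv 1%R w)%g =
  (transv 1%R w * bitransv u v *
    (bitransv u (sform v w *: w)%R * transv (- sform v w ^+ 2)%R u))%g.
Proof.
move=> uv uw; apply: Sp_eqv => x.
have uz : sform u (sform v w *: w) = 0 by rewrite sformZr uw mulr0.
rewrite !spactM !(bitransvE _ uv) (bitransvE _ uz) !transvE.
exact: (btv_tv_comm coD coZ co_inj Bl Bz Bc Ba x uv uw).
Qed.

(** * The block copies of SL(2,p) and the permutations of the blocks *)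

Definition bi (e : bool) : 'I_2 := if e then 1 else 0.

Definition block_img (i : 'I_n) (g : SL p 2) a : V :=
  if a.1 == i then val g (bi a.2) 0 *: bv (i, false) +
                   val g (bi a.2) 1 *: bv (i, true)
  else bv a.

Fact sp_block_key : unit. Proof. by []. Qed.
Definition sp_block :=
  locked_with sp_block_key (fun i g => Sp_of (block_img i g)).

Lemma sp_blockE i g a : bv a ** (sp_block i g) = block_img i g a.
Proof.
rewrite /sp_block unlock; apply: Sp_ofE => {}a b; rewrite /block_img.
case: a b => [j e] [k e'] /=.
case: (eqVneq j i) => [->|ji]; case: (eqVneq k i) => [->|ki];
  rewrite ?(sformDl, sformDr, sformZl, sformZr) !sform_bv /opp_point /sgn
    ?xpair_eqE /= ?eqxx ?(negPf ki) ?(eq_sym i) ?(negPf ji) ?(negPf ki) //=;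
  try ring.
have det : sval g 0 0 * sval g 1 1 - sval g 0 1 * sval g 1 0 = 1 :> 'F_p.
  exact: SL2_det.
by case: e; case: e' => /=; rewrite -?[in RHS]det; ring.
Qed.

Lemma sp_blockM i g h : (sp_block i g * sp_block i h)%g = sp_block i (g * h)%g.
Proof.
apply: Sp_eq => a; rewrite spactM !sp_blockE /block_img.
case: ifP => [_|ai]; last by rewrite sp_blockE /block_img ai.
rewrite spactDl !spactZl !sp_blockE /block_img /= eqxx !SL2_mulE.
by rewrite !scalerDr !scalerDl !scalerA addrACA.
Qed.

Fact sp_perm_key : unit. Proof. by []. Qed.
Definition sp_perm := locked_with sp_perm_key
  (fun s : 'S_n => Sp_of (fun a : Pt => bv (s a.1, a.2))).

Lemma sp_permE s a : bv a ** (sp_perm s) = bv (s a.1, a.2).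
Proof.
rewrite /sp_perm unlock; apply: (@Sp_ofE _ _ (fun a : Pt => bv (s a.1, a.2))) => {}a b.
by rewrite !sform_bv /opp_point !xpair_eqE (inj_eq perm_inj).
Qed.

Lemma sp_permM s t : (sp_perm s * sp_perm t)%g = sp_perm (s * t)%g.
Proof. by apply: Sp_eq => a; rewrite spactM !sp_permE permM. Qed.

Lemma sp_block_perm i g s : (sp_block i g ^ sp_perm s)%g = sp_block (s i) g.
Proof.
rewrite conjgE; apply: (mulgI (sp_perm s)); rewrite mulVKg.
apply: Sp_eq => a; rewrite !spactM !(sp_permE, sp_blockE) /block_img /=.
rewrite (inj_eq perm_inj); case: ifP => _; last by rewrite sp_permE.
by rewrite spactDl !spactZl !sp_permE.
Qed.

Lemma sp_block_commute i j g h : i != j ->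
  commute (sp_block i g) (sp_block j h).
Proof.
move=> ij; apply: Sp_eq => a; rewrite !spactM !sp_blockE /block_img.
case: (eqVneq a.1 i) => [ai|ai]; case: (eqVneq a.1 j) => [aj|aj].
- by rewrite -ai -aj eqxx in ij.
- by rewrite spactDl !spactZl !sp_blockE /block_img /= (negPf ij) ai eqxx.
- rewrite spactDl !spactZl !sp_blockE /block_img /= aj eqxx.
  by rewrite eq_sym (negPf ij).
by rewrite !sp_blockE /block_img (negPf ai) (negPf aj).
Qed.

End SymplecticElements.

Lemma free_evalJ (X : choiceType) (gT : groupType) (f : X -> gT)
    (u v : free_group X) :
  free_eval f (u ^ v) = free_eval f u ^ free_eval f v.
Proof. by rewrite !conjgE !free_evalM free_evalV. Qed.

Lemma free_evalR (X : choiceType) (gT : groupType) (f : X -> gT)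
    (u v : free_group X) :
  free_eval f [~ u, v] = [~ free_eval f u, free_eval f v].
Proof. by rewrite !commgEl free_evalM free_evalV free_evalJ. Qed.

Lemma commg_eq (gT : groupType) (x y z : gT) :
  x * y = y * x * z -> [~ x, y] * z^-1 = 1.
Proof.
by rewrite commgC => /mulgI <-; rewrite mulgV.
Qed.

Lemma Fp_opp1_even p : prime p -> ~~ odd p -> (-1 = 1 :> 'F_p)%R.
Proof.
move=> p_pr; case: (even_prime p_pr) => [->|->] // _; exact: val_inj.
Qed.

Section Relators.
Variables (p n : nat) (p_prime : prime p) (n_ge2 : (2 <= n)%N).
Import GRing.Theory.
Local Open Scope ring_scope.
Local Notation F := 'F_p.
Local Notation V := ('rV[F]_(n + n)).
Local Notation bv := (@bv p n).
Implicit Types (u v w : V) (c : F) (M N : Sp p n).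

Lemma sp_perm_hom : exists P : ghom 'S_n (Sp p n), P =1 @sp_perm p n.
Proof. by apply: homP => s t; rewrite sp_permM. Qed.

Lemma sp_block_hom i : exists B : ghom (SL p 2) (Sp p n), B =1 @sp_block p n i.
Proof. by apply: homP => g h; rewrite sp_blockM. Qed.

Lemma sp_block_transvection i :
  sp_block i (SL2_transvection p) = transv 1 (bv (i, true)).
Proof.
apply: Sp_eq => -[j e]; rewrite sp_blockE transvE /tv sform_bv /block_img.
rewrite /opp_point !xpair_eqE /= eq_sym !mxE /= /sgn.
case: eqVneq => [->|_] /=; last by rewrite mulr0 scale0r addr0.
by case: e; apply/rowP => y; rewrite !mxE /=; ring.
Qed.

Local Notation i0 := (Ordinal (ltnW n_ge2)).
Local Notation i1 := (Ordinal n_ge2).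
Local Notation W := (SL2_weyl p).

Definition sp_sigma : Sp p n := bitransv (bv (i0, true)) (bv (i1, false)).

Definition sp_gen (x : sp_letter n) : Sp p n :=
  match x with
  | LSigma => sp_sigma
  | LTau => sp_block i0 (SL2_transvection p)
  | LZ => sp_block i0 W
  | LU => sp_perm p (sym_gen n_ge2 (SymU n))
  | LV h => sp_perm p (sym_gen n_ge2 (SymV h))
  end.

(** The action of SL(2,p) on <e_0, e_1> and, dually, on <f_0, f_1>: sigma and U'
are the images of the two standard generators, which is why the relators of
SL(2,p) hold for them. *)
Definition levi_img (g : SL p 2) (a : basis_pt n) : V :=
  if a.1 == i0 then
    if a.2 then val g 1 1 *: bv (i0, true) - val g 1 0 *: bv (i1, true)
    else val g 0 0 *: bv (i0, false) + val g 0 1 *: bv (i1, false)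
  else if a.1 == i1 then
    if a.2 then - val g 0 1 *: bv (i0, true) + val g 0 0 *: bv (i1, true)
    else val g 1 0 *: bv (i0, false) + val g 1 1 *: bv (i1, false)
  else bv a.

(** A relation instead of a homomorphism: it suffices to know the matrices of
sigma and U', and products are followed through words. *)
Definition levi_rel (g : SL p 2) M := forall a, bv a ** M = levi_img g a.

Lemma levi_img1 a : levi_img 1%g a = bv a.
Proof.
case: a => [i e]; rewrite /levi_img !mxE /=.
by case: eqVneq => [->|_]; last case: eqVneq => [->|//];
  case: e; rewrite ?scale1r ?scale0r ?oppr0 ?scale0r ?addr0 ?add0r ?subr0.
Qed.

Lemma levi_imgM g h a N : levi_rel h N ->
  levi_img g a ** N = levi_img (g * h)%g a.
Proof.
move=> hN; rewrite {1}/levi_img.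
have E (x y : F) (b c : basis_pt n) : (x *: bv b + y *: bv c) ** N =
    x *: levi_img h b + y *: levi_img h c.
  by rewrite spactDl !spactZl !hN.
case: a => [i e]; rewrite /levi_img /= !SL2_mulE.
case: (eqVneq i i0) => [_|n0]; last case: (eqVneq i i1) => [_|n1].
- case: e; rewrite -?scaleNr E /levi_img /=;
    by apply/rowP => y; rewrite !mxE; ring.
- case: e; rewrite -?scaleNr E /levi_img /=;
    by apply/rowP => y; rewrite !mxE; ring.
by rewrite hN /levi_img (negPf n0) (negPf n1).
Qed.

Lemma levi_rel1 : levi_rel 1%g 1%g.
Proof. by move=> a; rewrite spact1 levi_img1. Qed.

Lemma levi_relM g h M N :
  levi_rel g M -> levi_rel h N -> levi_rel (g * h)%g (M * N)%g.
Proof. by move=> gM hN a; rewrite spactM gM (levi_imgM _ _ hN). Qed.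

Lemma levi_relV g M : levi_rel g M -> levi_rel g^-1%g M^-1%g.
Proof.
move=> gM a; rewrite -[in LHS](levi_img1 a) -(mulVg g).
by rewrite -(levi_imgM _ _ gM) spactKV.
Qed.

Lemma levi_rel_eval (f : bool -> SL p 2) (f' : bool -> Sp p n) (w : free_group bool) :
  (forall b, levi_rel (f b) (f' b)) -> levi_rel (free_eval f w) (free_eval f' w).
Proof.
move=> ff'; elim/free_ind: w => [|b w IHw|b w IHw].
- by rewrite !free_eval1; apply: levi_rel1.
- by rewrite !free_evalM !free_eval_gen; apply: levi_relM.
by rewrite !free_evalM !free_evalV !free_eval_gen; apply: levi_relM => //;
  apply: levi_relV.
Qed.

Lemma weyl2_block i a : a.1 = i -> bv a ** sp_block i (W ^+ 2)%g = - bv a.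
Proof.
case: a => j e /= ->; rewrite sp_blockE /block_img eqxx expg2 weyl2 !mxE.
by case: e => /=; rewrite scale0r ?addr0 ?add0r scaleN1r.
Qed.

Lemma weyl4 : (W ^+ 4)%g = 1%g.
Proof.
apply: SL2_eq; rewrite (expgnA _ 2 2) [(W ^+ 2 ^+ 2)%g]expg2 !expg2 SL2_valM.
by rewrite !weyl2 mx2_mul SL2_val1 -mx2_1; congr mx2; ring.
Qed.

Lemma weyl2_even : ~~ odd p -> (W ^+ 2)%g = 1%g.
Proof.
move=> p_even; apply: SL2_eq; rewrite expg2 weyl2 SL2_val1 -mx2_1.
by rewrite (Fp_opp1_even p_prime p_even).
Qed.

Lemma sp_sigma_fix M : bv (i0, true) ** M = bv (i0, true) ->
  bv (i1, false) ** M = bv (i1, false) -> (sp_sigma ^ M)%g = sp_sigma.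
Proof. by move=> e f; rewrite bitransvJ e f. Qed.

Lemma sp_sigma_perm (s : 'S_n) : s i0 = i0 -> s i1 = i1 ->
  (sp_sigma ^ sp_perm p s)%g = sp_sigma.
Proof. by move=> e f; rewrite sp_sigma_fix // sp_permE /= ?e ?f. Qed.

Lemma sp_sigma_block i g : i != i0 -> i != i1 ->
  (sp_sigma ^ sp_block i g)%g = sp_sigma.
Proof.
by move=> e f; rewrite sp_sigma_fix // sp_blockE /block_img /= eq_sym
  ?(negPf e) ?(negPf f).
Qed.

Variables (RS : set (free_group (sym_letter n))) (RU RZ : set (free_group bool)).
Hypotheses (RS_presents : presents (sym_gen n_ge2) RS)
  (RU_presents : presents (letter_pair (SL2_transvection p) W) RU)
  (RZ_presents : presents (letter_pair (SL2_transvection p) W) RZ).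

Lemma commg_fix1 (gT : groupType) (x y : gT) : (x ^ y = x -> [~ x, y] = 1)%g.
Proof. by move/eqP; rewrite conjg_fix => /eqP. Qed.

Lemma sp_gen_sym r : RS r -> free_eval sp_gen (free_eval (@sym_word n) r) = 1%g.
Proof.
move=> Rr; have [P PE] := sp_perm_hom.
have [E EE] := free_eval_hom sp_gen.
rewrite -EE hom_free_eval.
have -> : free_eval (E \o sym_word (n:=n)) r = P (free_eval (sym_gen n_ge2) r).
  rewrite hom_free_eval; apply: eq_free_eval => -[|h] /=;
    by rewrite EE free_eval_gen PE.
by rewrite (presents_rel RS_presents Rr) gmulf1.
Qed.

End Relators.

Section RelatorsHold.
Import GRing.Theory.
Variables (p n : nat) (p_prime : prime p) (n_ge2 : (2 <= n)%N).
Local Notation bv := (@bv p n).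
Local Notation i0 := (Ordinal (ltnW n_ge2)).
Local Notation i1 := (Ordinal n_ge2).
Local Notation W := (SL2_weyl p).
Local Notation T := (SL2_transvection p).
Local Notation f0 := (bv (i0, true)).
Local Notation e0 := (bv (i0, false)).
Local Notation f1 := (bv (i1, true)).
Local Notation e1 := (bv (i1, false)).
Local Notation S := (sp_sigma p n_ge2).
Local Notation gen := (sp_gen p n_ge2).

Variables (RS : set (free_group (sym_letter n))) (RU RZ : set (free_group bool)).
Hypotheses (RS_presents : presents (sym_gen n_ge2) RS)
  (RU_presents : presents (letter_pair T W) RU)
  (RZ_presents : presents (letter_pair T W) RZ).

Let u : 'S_n := tperm i0 i1.
Let v : 'S_n := perm (@ordS_inj n).

Lemma cyc_i0 : v i0 = i1.
Proof. by apply: val_inj; rewrite permE /= modn_small. Qed.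

Section MoreThanTwo.
Hypothesis h : (2 < n)%N.
Local Notation i2 := (Ordinal h).
Lemma cyc_i1 : v i1 = i2.
Proof. by apply: val_inj; rewrite permE /= modn_small. Qed.
Lemma cyc2_i0 : (v ^+ 2) i0 = i2.
Proof. by rewrite expg2 permM cyc_i0 cyc_i1. Qed.
Lemma cyc2_i1 (h3 : (3 < n)%N) : (v ^+ 2) i1 = Ordinal h3.
Proof. by apply: val_inj; rewrite cyclic_permX /= modn_small. Qed.
Lemma uv : u ^ v = tperm i1 i2.
Proof. by rewrite tpermJ cyc_i0 cyc_i1. Qed.
Lemma vu_i0 : (v * u) i0 = i0.
Proof. by rewrite permM cyc_i0 tpermR. Qed.
Lemma vu_i1 : (v * u) i1 = i2.
Proof. by rewrite permM cyc_i1 tpermD. Qed.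
End MoreThanTwo.

Let feE := (free_evalR, free_evalJ, free_evalX, free_evalV, free_evalM,
            free_eval_gen).

Lemma sform_bv0 (a b : basis_pt n) :
  (a.1 != b.1) || (a.2 == b.2) -> sform (bv a) (bv b) = 0%R.
Proof.
case: a b => [i e] [j e'] /= h; rewrite sform_bv /opp_point xpair_eqE /= eq_sym.
by case: eqP h => //= _; case: e; case: e'.
Qed.

Lemma sform_bv1 i : sform (bv (i, false)) (bv (i, true)) = 1%R.
Proof. by rewrite sform_bv eqxx. Qed.

Lemma commg_sp (x y z : Sp p n) : x * y = y * x * z -> [~ x, y] = z.
Proof. by rewrite commgC => /mulgI. Qed.

Lemma levi_rel_sigma : levi_rel n_ge2 T S.
Proof.
move=> [i e]; rewrite bitransvE ?sform_bv0 // /btv /levi_img /= !mxE /=.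
rewrite !sform_bv /opp_point /sgn !xpair_eqE /=.
have [->|ni0] := eqVneq i i0.
  by case: e; rewrite ?(scale1r, scale0r, subr0, addr0).
have [->|ni1] := eqVneq i i1; last by rewrite /= !scale0r !addr0.
by case: e; rewrite ?(scale1r, scale0r, subr0, addr0, add0r) // addrC.
Qed.

Lemma levi_rel_U' : levi_rel n_ge2 W
  (if odd p then sp_perm p u * sp_block i0 (W ^+ 2) else sp_perm p u).
Proof.
case: (boolP (odd p)) => [_|p_even] [i e]; rewrite ?spactM sp_permE
  /levi_img /= !mxE /= !(scale1r, scaleN1r, scale0r, add0r, addr0, subr0).
- have [->|ni0] := eqVneq i i0.
    by rewrite tpermL sp_blockE /block_img /=; case: e; rewrite ?opprK.
  have [->|ni1] := eqVneq i i1; first by rewrite tpermR weyl2_block //; case: e.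
  by rewrite tpermD 1?eq_sym // sp_blockE /block_img /= (negPf ni0).
have [->|ni0] := eqVneq i i0; first by rewrite tpermL opprK; case: e.
have [->|ni1] := eqVneq i i1; last by rewrite tpermD 1?eq_sym.
rewrite tpermR -scaleN1r (Fp_opp1_even p_prime p_even) scale1r.
by case: e; rewrite // -scaleN1r (Fp_opp1_even p_prime p_even) scale1r.
Qed.

(** All the relators reduce to the images of basis vectors under permutations and
block matrices, and to the commutator identities between transvections and
bitransvections. *)
Lemma sp_gen_rel r : sp_relators p RS RU RZ r -> free_eval gen r = 1.
Proof.
have [P PE] := sp_perm_hom p n; have [B BE] := @sp_block_hom p n i0.
have gU : gen (LU n) = P u by rewrite PE.
have gV h : gen (LV h) = P v by rewrite PE.
have gZ : gen (LZ n) = B W by rewrite BE.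
have gT : gen (LTau n) = B T by rewrite BE.
have tE : B T = transv 1%R f0 by rewrite BE sp_block_transvection.
have gS : gen (LSigma n) = S by [].
have PJ a (s : 'S_n) : (bv a ** P s)%R = bv (s a.1, a.2) by rewrite PE sp_permE.
have SP (s : 'S_n) : S ^ P s = bitransv (bv (s i0, true)) (bv (s i1, false)).
  by rewrite bitransvJ !PJ.
have TP (s : 'S_n) : B T ^ P s = transv 1%R (bv (s i0, true)).
  by rewrite tE transvJ PJ.
have BP g (s : 'S_n) : B g ^ P s = sp_block (s i0) g.
  by rewrite BE PE sp_block_perm.
have BPfix g (s : 'S_n) : s i0 = i0 -> [~ B g, P s] = 1.
  by move=> si0; apply: commg_fix1; rewrite BP si0 BE.
have BPcomm g g' (s : 'S_n) : s i0 != i0 -> [~ B g, B g' ^ P s] = 1.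
  move=> si0; rewrite BP BE; apply/eqP/commgP/sp_block_commute.
  by rewrite eq_sym.
have SPfix (s : 'S_n) : s i0 = i0 -> s i1 = i1 -> [~ S, P s] = 1.
  by move=> *; apply: commg_fix1; rewrite PE sp_sigma_perm.
have u0 : u i0 = i1 by rewrite tpermL.
have u1 : u i1 = i0 by rewrite tpermR.
have e0W : (e0 ** B W = f0)%R.
  by rewrite BE sp_blockE /block_img eqxx !mxE /= scale0r scale1r add0r.
have f0W : (f0 ** B W = - e0)%R.
  by rewrite BE sp_blockE /block_img eqxx !mxE /= scale0r scaleN1r addr0.
have e1W : (e1 ** B W = e1)%R by rewrite BE sp_blockE /block_img.
have e0V : e0 ** (B W)^-1 = (- f0)%R.
  by rewrite -[e0]opprK -f0W spactNl spactKV.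
have e1V : e1 ** (B W)^-1 = e1 by rewrite -[in LHS]e1W spactKV.
have f0W2 : f0 ** B (W ^+ 2) = (- f0)%R by rewrite BE weyl2_block.
have SZ : S ^ B W = bitransv (- e0)%R e1 by rewrite bitransvJ f0W e1W.
have ne0e1 : sform (- e0)%R e1 = 0%R.
  by rewrite -scaleN1r sformZl sform_bv0 // mulr0.
have SZc : sform f0 (- e0)%R = 1%R.
  by rewrite -scaleN1r sformZr sformC sform_bv1 mulrNN mulr1.
case=> {r}.
- by move=> r; apply: sp_gen_sym.
- rewrite !feE gZ -gmulfXn; case: eqP => [p2|_]; last by rewrite weyl4 gmulf1.
  by rewrite (weyl2_even p_prime) ?gmulf1 // p2.
- by move=> h; rewrite !feE gZ gU gV -gmulfJ BPfix // uv tpermD.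
- by move=> h _; rewrite !feE gZ gU gV -gmulfM BPfix // vu_i0.
- by rewrite !feE gZ gU BPcomm // u0 eq_sym.
- rewrite !feE gS gZ gU; apply: commg_fix1; rewrite bitransvJ !spactM.
  rewrite f0W e1W !spactNl !PJ /= u0 u1 e0V e1V bitransvNN bitransvC //.
  by rewrite sform_bv0.
- move=> h h3; rewrite !feE gS gU gV -gmulfXn -gmulfJ SPfix //.
    by rewrite tpermJ (cyc2_i0 h) (cyc2_i1 h3) tpermD.
  by rewrite tpermJ (cyc2_i0 h) (cyc2_i1 h3) tpermD.
- move=> h h4; rewrite !feE gS gU gV -gmulfJ -!gmulfM SPfix //.
    by rewrite permM vu_i0 (uv h) tpermD.
  by rewrite permM (vu_i1 h) (uv h) tpermR.
- move=> h; rewrite !feE gS gZ gV -gmulfXn BP (cyc2_i0 h).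
  by apply: commg_fix1; rewrite sp_sigma_block.
- move=> p_odd; rewrite !feE gS gZ gU; apply: commg_fix1.
  rewrite commgEl -gmulfXn BP u0 bitransvJ !spactM.
  have -> : f0 ** (B (W ^+ 2))^-1 = (- f0)%R.
    by rewrite -{1}[f0]opprK -f0W2 spactNl spactKV.
  have -> : e1 ** (B (W ^+ 2))^-1 = e1.
    by rewrite -gmulfV BE sp_blockE /block_img.
  rewrite spactNl [e1 ** _]weyl2_block // sp_blockE /block_img /=.
  exact: bitransvNN.
- by rewrite !feE gT gZ gU BPcomm // u0 eq_sym.
- by move=> h; rewrite !feE gT gU gV -gmulfJ BPfix // uv tpermD.
- by move=> h _ _; rewrite !feE gT gU gV -gmulfM BPfix // vu_i0.
- move=> _; rewrite !feE gT gZ -gmulfXn; apply: commg_fix1.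
  rewrite -gmulfJ; congr (B _); apply/conjg_fixP/commgP.
  apply: SL2_eq; rewrite expg2 [LHS]SL2_valM [RHS]SL2_valM weyl2 !mx2_mul.
  by congr mx2; ring.
- move=> r Rr; have [E EE] := free_eval_hom gen.
  rewrite -EE hom_free_eval.
  set f := E \o _; have ff b : levi_rel n_ge2 (letter_pair T W b) (f b).
    case: b; rewrite /f /= EE; last by rewrite !feE; apply: levi_rel_sigma.
    have := levi_rel_U'; case: (odd p); rewrite !feE gU PE //.
    by rewrite gZ -gmulfXn BE.
  have := levi_rel_eval r ff; rewrite (presents_rel RU_presents Rr) => h.
  by apply: Sp_eq => a; rewrite h levi_img1 spact1.
- move=> r Rr; have [E EE] := free_eval_hom gen.
  rewrite -EE hom_free_eval -(@gmulf1 _ _ B) -(presents_rel RZ_presents Rr).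
  rewrite hom_free_eval; apply: eq_free_eval => -[] /=;
    by rewrite EE free_eval_gen.
- move=> h; rewrite !feE gS gU gV -gmulfM.
  apply: commg_eq; rewrite !SP cyc_i0 (cyc_i1 h) vu_i0 (vu_i1 h).
  rewrite bitransv_comm; try exact: sform_bv0.
  by rewrite sform_bv1 scale1r.
- move=> h; rewrite !feE gS gU gV -gmulfM; apply/eqP/commgP.
  by rewrite SP vu_i0 (vu_i1 h); apply: bitransv_commute; apply: sform_bv0.
- move=> h; rewrite !feE gS gU gV -gmulfM; apply/eqP/commgP.
  rewrite SP !permM u0 u1 (cyc_i1 h) cyc_i0.
  by apply: bitransv_commute; apply: sform_bv0.
- move=> h h3; rewrite !feE gS gV -gmulfXn; apply/eqP/commgP.
  rewrite SP (cyc2_i0 h) (cyc2_i1 h3).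
  by apply: bitransv_commute; apply: sform_bv0.
- move=> _; rewrite !feE gS gZ gT gU -gmulfXn.
  apply: commg_eq; rewrite SZ bitransv_comm_long ?ne0e1 ?sform_bv0 //.
  congr (_ * _); rewrite gmulfXn tE transvX mulr1 transvJ spactM f0W.
  by rewrite SZc spactNl PJ u0 -scaleN1r transvZ sqrrN expr1n mulr1.
- move=> p_even; rewrite !feE gS gZ SZ.
  rewrite (commg_sp (bitransv_comm_long _ ne0e1)) ?sform_bv0 //.
  rewrite SZc -(transv0 e1); congr transv.
  by rewrite mulr2n -[X in (X + _)%R](Fp_opp1_even p_prime p_even) addNr.
- rewrite !feE gS gT tE; apply/eqP/commgP/bitransv_transv_commute;
    exact: sform_bv0.
- rewrite !feE gS gT gZ gU TP u0 BP u0 bitransvJ.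
  apply: commg_eq; rewrite bitransv_transv_comm; try exact: sform_bv0.
  rewrite sform_bv1.
  rewrite expr1n scale1r !sp_blockE /block_img /= !mxE /= tE transvN.
  by rewrite scale0r scale1r add0r.
- move=> h; rewrite !feE gS gT gV -gmulfXn TP (cyc2_i0 h).
  by apply/eqP/commgP/bitransv_transv_commute; apply: sform_bv0.
by rewrite !feE gT gU BPcomm // u0 eq_sym.
Qed.
End RelatorsHold.

(** * Generators of the symplectic group *)

Lemma cancel_coefficient (F : fieldType) (s q x : F) : (s * s = 1 -> q != 0 ->
  s * q * (- (s * x) / q) = - x)%R.
Proof.
move=> ss q0; have -> : (s * q * (- (s * x) / q) = - (s * s * x))%R by field.
by rewrite ss GRing.mul1r.
Qed.

Section Generation.
Variables (p n : nat) (p_prime : prime p) (n_ge2 : (2 <= n)%N).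
Import GRing.Theory.
Local Notation i0 := (Ordinal (ltnW n_ge2)).
Local Notation i1 := (Ordinal n_ge2).
Local Notation V := ('rV['F_p]_(n + n)).
Local Notation bv := (@bv p n).
Local Notation Pt := (basis_pt n).
Local Notation W := (SL2_weyl p).
Implicit Types (M N : Sp p n) (a b d : Pt) (v w : V).

Variable Q : Sp p n -> Prop.
Hypotheses (QM : forall M N, Q M -> Q N -> Q (M * N)) (QV : forall M, Q M -> Q M^-1)
  (Qperm : forall s, Q (sp_perm p s)) (Qblock0 : forall g, Q (sp_block i0 g))
  (Qsigma : Q (sp_sigma p n_ge2)).

Let Q1 : Q 1. Proof. by rewrite -(mulgV (sp_perm p 1)); apply/QM/QV. Qed.
Let QJ M N : Q M -> Q N -> Q (M ^ N).
Proof. by move=> QMM QN; rewrite conjgE; apply: (QM (QV QN)); apply: QM. Qed.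

Let Qblock i g : Q (sp_block i g).
Proof. by have := QJ (Qblock0 g) (Qperm (tperm i0 i)); rewrite sp_block_perm tpermL. Qed.

Lemma weyl_true i : (bv (i, true) ** sp_block i W = - bv (i, false))%R.
Proof. by rewrite sp_blockE /block_img eqxx !mxE /= scale0r addr0 scaleN1r. Qed.

Lemma weyl_false i : (bv (i, false) ** sp_block i W = bv (i, true))%R.
Proof. by rewrite sp_blockE /block_img eqxx !mxE /= scale0r add0r scale1r. Qed.

Lemma block_fix i g a : a.1 != i -> (bv a ** sp_block i g = bv a)%R.
Proof. by move=> ai; rewrite sp_blockE /block_img (negPf ai). Qed.

Lemma Q_transv (q : 'F_p) b : Q (transv q (bv b)).
Proof.
have Qtrue i (k : 'F_p) : Q (transv k (bv (i, true))).
  have [B BE] := @sp_block_hom p n i.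
  have := Qblock i (SL2_transvection p ^+ (k : nat)); rewrite -BE gmulfXn BE.
  by rewrite sp_block_transvection transvX mulr1 natr_Zp.
case: b => i [] //; have := QJ (Qtrue i q) (Qblock i W).
by rewrite transvJ weyl_true -scaleN1r transvZ sqrrN expr1n mulr1.
Qed.

Lemma sform_bv_neq a b : a.1 != b.1 -> sform (bv a) (bv b) = 0%R.
Proof. by move=> ab; rewrite sform_bv; case: (b =P _) ab => // ->; rewrite eqxx. Qed.

Lemma Q_bitransv (q : 'F_p) a b : a.1 != b.1 -> Q (bitransv (q *: bv a)%R (bv b)).
Proof.
move=> ab; have QN u w : sform u w = 0%R -> Q (bitransv (- u)%R w) -> Q (bitransv u w).
  by move=> uw /QV; rewrite -bitransvN // invgK.
have ab0 (e e' : bool) : sform (bv (a.1, e)) (bv (b.1, e')) = 0%R.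
  exact: sform_bv_neq.
suff Qab : Q (bitransv (bv a) (bv b)).
  rewrite bitransvZl ?sform_bv_neq // -(natr_Zp q) -bitransvX ?sform_bv_neq //.
  by elim: (q : nat) => [|k IHk]; rewrite ?expg0 // expgS; apply: QM.
have [|s [s0 s1]] := @perm_map2 n i0 i1 a.1 b.1 _ ab; first by [].
have Qtf : Q (bitransv (bv (a.1, true)) (bv (b.1, false))).
  have := QJ Qsigma (Qperm s).
  by rewrite bitransvJ !sp_permE /= s0 s1.
have Qf e : Q (bitransv (bv (a.1, e)) (bv (b.1, false))).
  case: e => //; apply: QN => //.
  by have := QJ Qtf (Qblock a.1 W); rewrite bitransvJ weyl_true block_fix // eq_sym.
case: a ab ab0 {s0 Qtf} Qf => i e; case: b {s1} => j [] /= ab ab0 Qf; last exact: Qf.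
by have := QJ (Qf e) (Qblock j W); rewrite bitransvJ weyl_false block_fix.
Qed.

Let Qk (k : nat) M := Q M /\ forall a, (a.1 < k)%N -> (bv a ** M = bv a)%R.

Let QkM k M N : Qk k M -> Qk k N -> Qk k (M * N).
Proof.
move=> [QM_ fM] [QN fN]; split=> [|a ak]; first exact: QM.
by rewrite spactM fM // fN.
Qed.

Let Qk1 k : Qk k 1. Proof. by split=> // a _; rewrite spact1. Qed.

Lemma opp_pt_neq a : opp_point a != a.
Proof. by case: a => i []; rewrite /opp_point xpair_eqE /= andbF. Qed.

Lemma sform_opp v b : sform v (bv (opp_point b)) = (sgn p b * v 0 (pt b))%R.
Proof. by rewrite sform_pt; case: b => i []; rewrite /sgn /opp_point /= ?opprK. Qed.

Lemma sgn_sq a : (sgn p a * sgn p a = 1)%R.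
Proof. by rewrite /sgn; case: ifP; rewrite ?mulrNN mulr1. Qed.

(** With v_b nonzero, the bitransvection along a suitable multiple of a basis
vector a and the partner of b removes the coordinate at a; apart from it only the
coordinate at the partner of b changes, and a transvection removes that one at
the end.  All these elements fix the partner of b. *)
Lemma clear_coordinates (k : nat) v b : (v 0 (pt b) != 0)%R -> (k <= b.1)%N ->
  (forall a, (a.1 < k)%N -> v 0 (pt a) = 0)%R ->
  exists N, [/\ Qk k N, (bv (opp_point b) ** N = bv (opp_point b))%R &
                (v ** N = v 0 (pt b) *: bv b)%R].
Proof.
set q : 'F_p := v 0%R (pt b) => q0 kb supp.
have ob : (opp_point b == b) = false by rewrite (negPf (opp_pt_neq b)).
have block_ob a : a.1 != b.1 -> (a == opp_point b) = false /\ (a == b) = false.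
  by case: a b {kb q0 supp q ob} => i e [j e'] /= ij; rewrite !xpair_eqE (negPf ij).
have clear (r : seq Pt) : exists N, [/\ Qk k N, (bv (opp_point b) ** N = bv (opp_point b))%R,
    ((v ** N) 0 (pt b) = q)%R, forall a, (a.1 < k)%N -> ((v ** N) 0 (pt a) = 0)%R &
    forall a, a \in r -> a.1 != b.1 -> ((v ** N) 0 (pt a) = 0)%R].
  elim: r => [|a r [N [QN Nb vb vk vr]]].
    by exists 1; split; rewrite ?spact1 // => a; rewrite in_nil.
  set w := v ** N in vb vk vr *.
  have [a_ok|a_ok] := boolP ((a.1 == b.1) || (w 0%R (pt a) == 0%R)).
    exists N; split=> // d; rewrite in_cons => /orP[/eqP-> ab|]; last exact: vr.
    by case/orP: a_ok ab => [->//|/eqP->].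
  have [ab wa] : a.1 != b.1 /\ w 0%R (pt a) != 0%R by apply/andP; rewrite -negb_or.
  have ka : (k <= a.1)%N by rewrite leqNgt; apply: contra wa => /vk->.
  (* The scalar for which the coordinate of w at a is cancelled. *)
  pose t := (- (sgn p b * w 0 (pt a)) / q)%R.
  pose B := bitransv (t *: bv a)%R (bv (opp_point b)).
  have tb : sform (t *: bv a)%R (bv (opp_point b)) = 0%R.
    by rewrite sformZl sform_bv_neq ?mulr0.
  have wB : (w ** B = w + sform w (t *: bv a) *: bv (opp_point b) -
      w 0 (pt a) *: bv a)%R.
    rewrite bitransvE // /btv sform_opp vb scalerA -scaleNr; congr (_ + _ *: _)%R.
    exact: cancel_coefficient (sgn_sq b) q0.
  have [aob ab_] := block_ob _ ab.
  have fixB d : d.1 != a.1 -> d != b -> (bv d ** B = bv d)%R.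
    move=> da db; rewrite bitransvE // /btv sformZr sform_bv_neq // mulr0 scale0r addr0.
    rewrite sform_bv; case: (_ =P _) => [/(can_inj (@opp_pointK n)) E|_].
      by rewrite E eqxx in db.
    by rewrite scale0r addr0.
  exists (N * B); rewrite !spactM -/w wB Nb; split.
  - apply: QkM => //; split=> [|d dk]; first by apply: Q_bitransv.
    apply: fixB; first by apply: contraTneq dk => ->; rewrite -leqNgt.
    by apply: contraTneq dk => ->; rewrite -leqNgt.
  - by apply: fixB; rewrite ?ob //= eq_sym.
  - by rewrite -scaleNr !coordD !coord_bv vb ob ab_ !mulr0 !addr0.
  - move=> d dk; rewrite -scaleNr !coordD !coord_bv vk //.
    have -> : (a == d) = false by apply: contraTF dk => /eqP<-; rewrite -leqNgt.
    have -> : (opp_point b == d) = false by apply: contraTF dk => /eqP<-; rewrite -leqNgt.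
    by rewrite !mulr0 !addr0.
  move=> d + db; rewrite in_cons -scaleNr !coordD !coord_bv.
  have -> : (opp_point b == d) = false by rewrite eq_sym; have [] := block_ob _ db.
  rewrite mulr0 addr0; case: (a =P d) => [<-|/eqP ad].
    by rewrite mulr1 addrN.
  by rewrite eq_sym (negPf ad) /= mulr0 addr0 => /vr->.
have [N [QN Nb vb _ vall]] := clear (enum {: Pt}).
set w := v ** N in vb vall.
pose t := (- (sgn p b * w 0 (pt (opp_point b))) / q)%R.
have wE : (w = q *: bv b + w 0 (pt (opp_point b)) *: bv (opp_point b))%R.
  apply: rV_point_eq => a; rewrite coordD !coord_bv.
  have [ab|ab] := eqVneq a.1 b.1; last first.
    rewrite vall ?mem_enum // (eq_sym _ a) (eq_sym _ a).
    by have [-> ->] := block_ob _ ab; rewrite !mulr0 addr0.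
  have [->|aE] : a = b \/ a = opp_point b.
    by case: (a) (b) ab => i e [j e'] /= ->; rewrite /opp_point /=; case: e; case: e'; auto.
    by rewrite eqxx ob mulr1 mulr0 addr0.
  by rewrite aE eqxx eq_sym ob mulr0 mulr1 add0r.
exists (N * transv t (bv (opp_point b))); rewrite !spactM Nb -/w; split.
- apply: QkM => //; split=> [|d dk]; first exact: Q_transv.
  rewrite transvE /tv sform_bv_neq ?mulr0 ?scale0r ?addr0 //.
  by apply: contraTneq dk => ->; rewrite -leqNgt.
- by rewrite transvE /tv sform_alt mulr0 scale0r addr0.
rewrite transvE /tv sform_opp vb {1}wE -addrA -scalerDl.
rewrite (mulrC t) cancel_coefficient ?sgn_sq // addrN.
by rewrite scale0r addr0.
Qed.

(** After clearing, a diagonal or antidiagonal block matrix normalises the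
remaining coordinate and a transposition of blocks moves it to block k. *)
Lemma reach_bv (k : 'I_n) v : v != 0%R ->
  (forall a, (a.1 < k)%N -> v 0 (pt a) = 0)%R ->
  exists N, Qk k N /\ (v ** N = bv (k, true))%R.
Proof.
move=> v0 supp; have [a va] : exists a, (v 0 (pt a) != 0)%R.
  apply: contrapT => no; case/eqP: v0; apply: rV_point_eq => a; rewrite mxE.
  by apply/eqP; apply: contrapT => /negP va; apply: no; exists a.
have ka : (k <= a.1)%N by rewrite leqNgt; apply: contra va => /supp->.
have [N [QN _ vN]] := clear_coordinates va ka supp.
set q := v 0%R (pt a) in va vN.
have fixk (g : SL p 2) : Qk k (sp_block a.1 g).
  split=> // d dk; apply: block_fix.
  by apply: contraTneq dk => ->; rewrite -leqNgt.
have [N2 [QN2 vN2]] : exists N, Qk k N /\ (v ** N = bv (a.1, true))%R.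
  have [aE|aE] : a.2 = true \/ a.2 = false by case: a.2; [left|right].
    have det : (q * q^-1 - 0 * 0 = 1 :> 'F_p)%R by rewrite mul0r subr0 mulfV.
    exists (N * sp_block a.1 (sl2 det)); split; first exact: QkM.
    rewrite spactM vN spactZl sp_blockE /block_img eqxx aE /= !mxE /=.
    by rewrite scale0r add0r scalerA mulfV ?scale1r.
  have det : (0 * 0 - q^-1 * - q = 1 :> 'F_p)%R.
    by rewrite (mul0r 0%R) add0r mulrN opprK mulVf.
  exists (N * sp_block a.1 (sl2 det)); split; first exact: QkM.
  rewrite spactM vN spactZl sp_blockE /block_img eqxx aE /= !mxE /=.
  by rewrite scale0r add0r scalerA mulfV ?scale1r.
exists (N2 * sp_perm p (tperm a.1 k)); split; last first.
  by rewrite spactM vN2 sp_permE /= tpermL.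
apply: QkM => //; split=> // -[i e] /= ik; rewrite sp_permE /= tpermD //.
  by apply: contraTneq ik => <-; rewrite -leqNgt.
by apply: contraTneq ik => <-; rewrite ltnn.
Qed.

(** The coordinate at d is a product with the partner of d, which M fixes. *)
Lemma fixed_support (k : nat) M a : (forall d, (d.1 < k)%N -> bv d ** M = bv d)%R ->
  (k <= a.1)%N -> forall d, (d.1 < k)%N -> ((bv a ** M) 0 (pt d) = 0)%R.
Proof.
move=> fM ka d dk; have := sform_act M (bv a) (bv (opp_point d)).
rewrite (fM (opp_point d)) // sform_opp sform_bv_neq; last first.
  by apply: contraTneq dk => /= <-; rewrite -leqNgt.
move=> E; have := congr1 (fun x => sgn p d * x)%R E.
by rewrite mulrA sgn_sq mul1r mulr0.
Qed.

(** An isometry fixing the first k blocks is corrected, by elements of Q fixing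
them too, to fix first f_k and then e_k: the image of e_k has coordinate 1 at e_k
because its product with f_k is 1, and clearing with e_k as pivot keeps f_k fixed. *)
Lemma Sp_generated M : Q M.
Proof.
suff fix_ind m (k : nat) M' : (n - k <= m)%N ->
    (forall a, (a.1 < k)%N -> (bv a ** M' = bv a)%R) -> Q M'.
  by apply: (fix_ind n 0%N); first exact: leq_subr.
elim: m k M' => [|m IHm] k {}M nk fM.
  suff -> : M = 1 by [].
  by apply: Sp_eq => a; rewrite spact1 fM //; have := ltn_ord a.1; move: nk; lia.
have [nk'|kn] := leqP n k; first by apply: IHm fM; move: nk'; lia.
pose j := Ordinal kn.
have [|N [[QN fN] MN]] := @reach_bv j (bv (j, true) ** M) _ (fixed_support (k := j) (a := (j, true)) fM (leqnn j)).
  apply/eqP => E; have := spactKV M (bv (j, true)); rewrite E spact0l => /esym/rowP.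
  by move=> /(_ (pt (j, true))); rewrite bvE mxE eqxx => /eqP; rewrite oner_eq0.
have fMN a : (a.1 < j)%N -> bv a ** (M * N) = bv a.
  by move=> aj; rewrite spactM fM // fN.
pose b : Pt := (j, false); set u := bv b ** (M * N).
have ub : (u 0 (pt b) = 1)%R.
  have := sform_act (M * N) (bv b) (bv (opp_point b)).
  have -> : bv (opp_point b) ** (M * N) = bv (opp_point b) by rewrite spactM MN.
  by rewrite !sform_opp bvE eqxx /sgn /= !mul1r.
have [|N2 [[QN2 fN2] N2f uN2]] := @clear_coordinates j u b _ (leqnn j) (fixed_support (k := j) (a := b) fMN (leqnn j)).
  by rewrite ub oner_eq0.
have : Q (M * N * N2).
  apply: (IHm k.+1) => [|a]; first by move: nk; lia.
  rewrite ltnS leq_eqVlt => /orP[/eqP ak|ak]; last by rewrite spactM fMN // fN2.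
  have aE : a = (j, a.2) by case: a ak => i e /= ik; congr pair; apply: val_inj.
  rewrite spactM aE; case: a.2; last by rewrite uN2 ub scale1r.
  by rewrite (spactM (bv _)) MN.
by move=> /QM/(_ (QV QN2))/QM/(_ (QV QN)); rewrite !mulgK.
Qed.

End Generation.

(** * Powers with exponents in the prime field *)

Section PrimeExponents.
Variables (p : nat) (p_prime : prime p) (G : groupType).
Import GRing.Theory.
Implicit Types (x y z : G) (k l : 'F_p) (m : nat).

(** An exponent in the prime field makes sense when x ^+ p = 1; as a function it
sends k to the power by its representative below p. *)
Definition pw x k : G := x ^+ (k : nat).

Lemma pw_nat x m : x ^+ p = 1 -> pw x m%:R%R = x ^+ m.
Proof.
move=> xp; rewrite /pw val_Fp_nat // {2}(divn_eq m p) expgnDr expgnA expgnAC.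
by rewrite xp expg1n mul1g.
Qed.

Lemma pwD x k l : x ^+ p = 1 -> pw x (k + l)%R = pw x k * pw x l.
Proof.
by move=> xp; rewrite -(natr_Zp k) -(natr_Zp l) -natrD !pw_nat // expgnDr.
Qed.

Lemma pw0 x : pw x 0%R = 1. Proof. by []. Qed.
Lemma pw1 x : pw x 1%R = x.
Proof. by rewrite /pw /= modn_small ?expg1 // -ltnS prednK ?prime_gt1. Qed.

Lemma pwN x k : x ^+ p = 1 -> pw x (- k)%R = (pw x k)^-1.
Proof.
by move=> xp; apply/esym/mulg1_eq; rewrite -pwD // addrN pw0.
Qed.

Lemma pwJ x y k : pw x k ^ y = pw (x ^ y) k. Proof. exact: conjXg. Qed.

Section Heisenberg.
Variables a b z : G.
Hypotheses (ap : a ^+ p = 1) (bp : b ^+ p = 1) (zp : z ^+ p = 1)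
  (az : commute a z) (bz : commute b z) (ab : a * b = b * a * z ^+ 2).

Lemma heis_swap_nat i j : a ^+ i * b ^+ j = b ^+ j * a ^+ i * z ^+ (2 * (i * j)).
Proof.
have swap1 m : a * b ^+ m = b ^+ m * a * z ^+ (2 * m).
  elim: m => [|m IHm]; first by rewrite muln0 !mulg1 mul1g.
  rewrite expgSr mulgA IHm -2!mulgA -(commuteX (2 * m) bz) (mulgA a) ab.
  by rewrite -!mulgA mulnS (expgnDr z 2) !mulgA.
elim: i => [|i IHi]; first by rewrite mul1g !mulg1.
rewrite expgS -mulgA IHi !mulgA swap1 -!mulgA mulSn mulnDr (expgnDr z (2 * j)).
congr (_ * (_ * _)).
by rewrite !mulgA -(commuteX2 i (2 * j) az).
Qed.

(** By induction from a b^m = b^m a z^(2m); the exponent of z grows as a square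
because the sum of the first m odd numbers is m^2. *)
Lemma heis_pow_nat m : (a * b * z^-1) ^+ m = a ^+ m * b ^+ m * z ^- (m * m).
Proof.
elim: m => [|m IHm]; first by rewrite !mul1g invg1.
rewrite expgSr IHm; apply: (mulIg (z ^+ (m.+1 * m.+1))); rewrite mulgVK.
have cz m' x : commute x z -> commute x (z ^- m') by move=> *; apply/commuteV/commuteX.
have -> : a ^+ m * b ^+ m * z ^- (m * m) * (a * b * z^-1) =
          a ^+ m * b ^+ m * (a * b) * (z ^- (m * m) * z^-1).
  rewrite -!mulgA; do 2!congr (_ * _).
  by rewrite !mulgA -(cz _ _ az) -(mulgA a (z ^- _)) -(cz _ _ bz) !mulgA.
have swap : a ^+ m * b ^+ m * (a * b) = a ^+ m.+1 * b ^+ m.+1 * z ^- (2 * m).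
  rewrite (expgSr a) (expgSr b) -!mulgA; congr (_ * _); rewrite !mulgA.
  have := heis_swap_nat 1 m; rewrite expg1 mul1n => ->.
  rewrite -[b ^+ m * a * z ^+ _ * b]mulgA -(commuteX (2 * m) bz) !mulgA mulgK.
  by [].
rewrite swap -!mulgA.
have -> : z ^- (2 * m) * (z ^- (m * m) * (z^-1 * z ^+ (m.+1 * m.+1))) = 1.
  have -> : (m.+1 * m.+1 = 1 + (m * m + 2 * m))%N by lia.
  by rewrite !expgnDr expg1 mulKg mulKg mulVg.
by rewrite mulg1.
Qed.

(** Elements of a Heisenberg group with centre generated by z and [a, b] = z^2.
The factor z^(-xy) is chosen so that [heis x y] is the symmetrised product of a^x
and b^y: this makes automorphisms act linearly on (x, y), also when p = 2. *)
Definition heis (x y : 'F_p) := pw a x * pw b y * pw z (- (x * y))%R.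

Lemma heis_swap k l : pw a k * pw b l = pw b l * pw a k * pw z (2 * (k * l))%R.
Proof.
rewrite [LHS]heis_swap_nat; congr (_ * _); rewrite -pw_nat // !natrM.
by rewrite !natr_Zp.
Qed.

Lemma heis_pow k : pw (a * b * z^-1) k = pw a k * pw b k * pw z (- (k * k))%R.
Proof.
rewrite [LHS]heis_pow_nat; congr (_ * _); rewrite pwN //; congr (_^-1).
by rewrite -pw_nat // natrM !natr_Zp.
Qed.

(** The standard unipotent generator of SL(2,p) acts as on its natural module. *)
Lemma heis_upper t (x y : 'F_p) : a ^ t = a * b * z^-1 -> b ^ t = b -> z ^ t = z ->
  heis x y ^ t = heis x (x + y)%R.
Proof.
move=> at_ bt zt; rewrite /heis !conjMg !pwJ at_ bt zt heis_pow.
have czb k l : commute (pw z k) (pw b l) by apply/commute_sym/commuteX2.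
rewrite -!mulgA; congr (_ * _); rewrite pwD // -!mulgA; congr (_ * _).
rewrite (mulgA (pw z _)) (czb _ _) -!mulgA -pwD //; congr (_ * pw z _).
by rewrite mulrDr opprD.
Qed.

(** The other generator exchanges the two coordinates up to sign; swapping the
powers of a and b produces exactly the correction of the central factor. *)
Lemma heis_weyl w (x y : 'F_p) : a ^ w = b -> b ^ w = a^-1 -> z ^ w = z ->
  heis x y ^ w = heis (- y)%R x.
Proof.
move=> aw bw zw; rewrite /heis !conjMg !pwJ aw bw zw.
have -> : pw a^-1 y = pw a (- y)%R by rewrite pwN // /pw expVgn.
rewrite heis_swap -!mulgA; congr (_ * (_ * _)); rewrite -pwD //; congr pw.
ring.
Qed.

End Heisenberg.
End PrimeExponents.

(** * Consequences of the relations in two and three blocks *)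

Section SymplecticSystem.
Variables (p n : nat) (p_prime : prime p) (n_ge2 : (2 <= n)%N).
Variables (G : groupType) (rho : ghom 'S_n G) (mu : ghom (SL p 2) G) (sigma : G).
Local Notation i0 := (Ordinal (ltnW n_ge2)).
Local Notation i1 := (Ordinal n_ge2).
Local Notation u := (tperm i0 i1 : 'S_n).
Local Notation v := (perm (@ordS_inj n) : 'S_n).
Local Notation T := (SL2_transvection p).
Local Notation W := (SL2_weyl p).
Local Notation tau := (mu T).
Local Notation Z := (mu W).
Local Notation U := (rho u).
Local Notation U' := (if odd p then U * Z ^+ 2 else U).

(** The relations for a group with homomorphisms rho from S_n and mu from
SL(2,p), which stand for the presentations of these two groups.  The presentation
of SL(2,p) on sigma and U' enters through the order of sigma and the word for U'
in root elements. *)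
Record sp_relations : Prop := SpRelations {
  rel_ZUV : (2 < n)%N -> [~ Z, rho (u ^ v)] = 1;
  rel_ZVU : (3 < n)%N -> [~ Z, rho (v * u)] = 1;
  rel_ZZU : [~ Z, Z ^ U] = 1;
  rel_sigZUZ : [~ sigma, Z * U * Z^-1] = 1;
  rel_sigUV2 : (3 < n)%N -> [~ sigma, rho (u ^ (v ^+ 2))] = 1;
  rel_sigVUUV : (4 < n)%N -> [~ sigma, rho (v * u * u ^ v)] = 1;
  rel_sigZV2 : (2 < n)%N -> [~ sigma, Z ^ rho (v ^+ 2)] = 1;
  rel_tauZU : [~ tau, Z ^ U] = 1;
  rel_tauUV : (2 < n)%N -> [~ tau, rho (u ^ v)] = 1;
  rel_tauVU : (3 < n)%N -> p = 2 -> [~ tau, rho (v * u)] = 1;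
  rel_sig_order : sigma ^+ p = 1;
  rel_sig_weyl : U' = sigma * sigma ^ U' * sigma;
  rel_sigV : (2 < n)%N -> [~ sigma, sigma ^ rho v] = sigma ^ rho (v * u);
  rel_sigVU : (2 < n)%N -> [~ sigma, sigma ^ rho (v * u)] = 1;
  rel_sigV2 : (3 < n)%N -> [~ sigma, sigma ^ rho (v ^+ 2)] = 1;
  rel_sigZ_odd : odd p -> [~ sigma, sigma ^ Z] = (tau ^+ 2) ^ (Z * U);
  rel_sigZ_even : ~~ odd p -> [~ sigma, sigma ^ Z] = 1;
  rel_sigtau : [~ sigma, tau] = 1;
  rel_sigtauU : [~ sigma, tau ^ U] = sigma ^ (Z ^ U) * tau^-1;
  rel_sigtauV2 : (2 < n)%N -> [~ sigma, tau ^ rho (v ^+ 2)] = 1;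
  rel_tautauU : [~ tau, tau ^ U] = 1 }.

Hypothesis rels : sp_relations.

Lemma commg1P (x y : G) : [~ x, y] = 1 -> commute x y.
Proof. by move=> /eqP/commgP. Qed.

Lemma commuteJ (x y z : G) : commute x y -> commute (x ^ z) (y ^ z).
Proof. by move=> xy; rewrite /commute -!conjMg xy. Qed.

Lemma commute_conj (x y : G) : commute x y -> x ^ y = x.
Proof. by move=> xy; rewrite conjgE xy mulKg. Qed.

Lemma conj_commute (x y : G) : x ^ y = x -> commute x y.
Proof. by move=> xy; rewrite /commute [LHS]conjgC xy. Qed.

Let rhoM s t : rho (s * t) = rho s * rho t. Proof. exact: gmulfM. Qed.
Let UU : U * U = 1. Proof. by rewrite -gmulfM tperm2 gmulf1. Qed.

Lemma tau_order : tau ^+ p = 1.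
Proof.
rewrite -gmulfXn (_ : T ^+ p = 1) ?gmulf1 //; apply: SL2_eq.
by rewrite upperX SL2_val1 -mx2_1 GRing.pcharf0 // pchar_Fp.
Qed.

Lemma weyl2_central g : commute (W ^+ 2) g.
Proof.
apply: SL2_eq; rewrite expg2 [LHS]SL2_valM [RHS]SL2_valM weyl2 [val g]mx2_eta.
by rewrite !mx2_mul; congr mx2; ring.
Qed.

Lemma tau_Z2 : tau ^ (Z ^+ 2) = tau.
Proof.
rewrite -gmulfXn; apply/commute_conj/gmulf_commute/commute_sym.
exact: weyl2_central.
Qed.

Lemma tau2_even : ~~ odd p -> tau ^+ 2 = 1.
Proof.
case: (even_prime p_prime) => [p2|->] // _.
by rewrite -(congr1 (fun k => tau ^+ k) p2) tau_order.
Qed.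

(** In SL(2,p) the matrix W is the product lower * upper * lower, where lower is
the conjugate of T by W. *)
Lemma weyl_word : Z = tau ^ Z * tau * tau ^ Z.
Proof.
rewrite -!gmulfJ -!gmulfM; congr (mu _).
have W4 : W * W * (W * W) = 1.
  by apply: SL2_eq; rewrite SL2_valM weyl2 mx2_mul SL2_val1 -mx2_1; congr mx2; ring.
have -> : T ^ W = W * W * W * T * W.
  by rewrite -[T ^ W]mul1g -W4 conjgE -!mulgA mulKVg.
by apply: SL2_eq; rewrite !SL2_valM !mx2_mul; congr mx2; ring.
Qed.

(* Here z2, t and s are Z, tau and tau ^ Z in the second block.  The conjugates
   are variables, so that rewriting does not unfold them. *)
Section RankTwo.
Variables z2 b t s : G.
Hypotheses (z2E : z2 = Z ^ U) (bE : b = sigma ^ z2) (tE : t = tau ^ U)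
  (sE : s = tau ^ (Z * U)).
Local Notation c := (Z * U * Z^-1).

Lemma conjUU x : (x ^ U) ^ U = x. Proof. by rewrite -conjgM UU conjg1. Qed.
Lemma Z_z2 : commute Z z2.
Proof. by rewrite z2E; apply/commg1P/rel_ZZU/rels. Qed.
Lemma ZU : Z * U = U * z2. Proof. by rewrite z2E -conjgC. Qed.
Lemma z2U : z2 * U = U * Z. Proof. by rewrite conjgC z2E conjUU. Qed.

Lemma sig_c : sigma ^ c = sigma.
Proof. exact/commute_conj/commg1P/rel_sigZUZ/rels. Qed.

Lemma cE : c = Z * z2^-1 * U.
Proof. by apply: (mulIg Z); rewrite mulgVK -!mulgA -z2U mulKg. Qed.

Lemma cE' : c = U * z2 * Z^-1. Proof. by rewrite ZU. Qed.

Lemma sig_U : sigma ^ U = sigma ^ (Z * z2^-1).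
Proof. by rewrite -[in LHS]sig_c cE conjgM conjUU. Qed.

Lemma sig_Zc : sigma ^ (Z * c) = b.
Proof.
have -> : Z * c = U * (z2 * z2 * Z^-1) by rewrite cE' !mulgA ZU.
rewrite conjgM sig_U -conjgM bE; congr (_ ^ _).
by rewrite -!mulgA mulKg (mulgA Z) Z_z2 -mulgA mulgV mulg1.
Qed.

Lemma tau_z2 : tau ^ z2 = tau.
Proof. by rewrite z2E; apply/commute_conj/commg1P/rel_tauZU/rels. Qed.

(** The relation for [sigma, sigma^Z], conjugated by c = Z U Z^-1, which centralises
sigma and sends sigma^Z to b.  For p = 2 both sides are trivial. *)
Lemma sig_long : [~ sigma, b] = tau ^+ 2.
Proof.
rewrite -sig_Zc conjgM -[X in [~ X, _]]sig_c -conjRg.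
case: (boolP (odd p)) => [p_odd|p_even]; last first.
  by rewrite (rel_sigZ_even rels p_even) conj1g tau2_even.
rewrite (rel_sigZ_odd rels p_odd) -conjgM.
have -> : Z * U * c = z2.
  by rewrite cE' ZU !mulgA -(mulgA U) z2U mulgA UU mul1g Z_z2 mulgK.
by rewrite conjXg tau_z2.
Qed.

Lemma sig_tau : commute sigma tau. Proof. exact/commg1P/rel_sigtau/rels. Qed.

(** The relation for [sigma, tau^U] says that t sends sigma to the symmetrised
product of sigma and b in the Heisenberg group. *)
Lemma sig_t : sigma ^ t = sigma * b * tau^-1.
Proof. by rewrite -mulgA bE tE z2E -(rel_sigtauU rels) commgEl mulKVg. Qed.

Lemma b_tau : commute b tau.
Proof. by rewrite -tau_z2 bE; apply: commuteJ sig_tau. Qed.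

Lemma t_z2 : t ^ z2 = s.
Proof. by rewrite tE sE z2E -conjJg conjgM. Qed.

Lemma sig_s : commute sigma s.
Proof.
rewrite -sig_c (_ : s = tau ^ c); first exact: commuteJ sig_tau.
rewrite cE (commuteV Z_z2) sE !conjgM; do 2!congr (_ ^ _).
by rewrite -[in RHS]tau_z2 conjgK.
Qed.

Lemma s_z2 : s ^ z2 = t.
Proof. by rewrite -t_z2 -conjgM -expg2 tE z2E -conjXg -conjJg tau_Z2. Qed.

Lemma b_t : commute b t.
Proof. by rewrite -s_z2 bE; apply: commuteJ sig_s. Qed.

Lemma b_s : b ^ s = b * (b ^ z2) * tau^-1.
Proof.
by rewrite -t_z2 [in LHS]bE -conjJg sig_t !conjMg conjVg tau_z2 -bE.
Qed.

Lemma tau_t : commute tau t.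
Proof. by rewrite tE; apply/commg1P/rel_tautauU/rels. Qed.
Lemma tau_s : commute tau s.
Proof. by rewrite -t_z2 -tau_z2; apply: commuteJ tau_t. Qed.

Lemma sig_b : sigma * b = b * sigma * tau ^+ 2.
Proof. by rewrite -sig_long -commgC. Qed.

Lemma z2_word : z2 = s * t * s.
Proof. by rewrite z2E {1}weyl_word 2!conjMg sE tE conjgM. Qed.

(** Computing sigma^z2 from z2 = s t s, where s centralises sigma and the effect
of t on sigma and of s on b are known, gives an equation whose only unknown is
b^z2 = sigma^(z2^2); solving it shows that z2^2 inverts sigma. *)
Lemma b_z2 : b ^ z2 = sigma^-1.
Proof.
have ts := commute_conj tau_s; have ss := commute_conj sig_s.
have E : sigma * b * (b ^ z2) = b * tau ^+ 2.
  have Eb : sigma * (b * (b ^ z2) * tau^-1) * tau^-1 = b.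
    rewrite [RHS]bE [in RHS]z2_word 2!conjgM ss sig_t 2!conjMg conjVg ss b_s.
    by rewrite ts.
  by rewrite -[X in _ = X * _]Eb expg2 !mulgA !mulgVK.
move: E; rewrite sig_b -2!mulgA => /mulgI E; apply: (mulgI (tau ^+ 2)).
have -> : tau ^+ 2 * (b ^ z2) = sigma^-1 * tau ^+ 2 by rewrite -{2}E mulKg.
by have /commute_sym/commuteV := commuteX 2 sig_tau.
Qed.

Lemma b_order : b ^+ p = 1.
Proof. by rewrite bE -conjXg (rel_sig_order rels) conj1g. Qed.

(** SL(2,p) in the second block acts on the Heisenberg group of sigma, b and tau
as on row vectors: the generators of SL(2,p) do, by [sig_t] and [b_z2]. *)
Lemma heis_act g (x y : 'F_p) :
  heis sigma b tau x y ^ (mu g ^ U) =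
  heis sigma b tau (x * val g 0 0 + y * val g 1 0)%R
                   (x * val g 0 1 + y * val g 1 1)%R.
Proof.
have sp := rel_sig_order rels; have tp := tau_order.
elim/SL2_gen_ind: g x y => [x y|g h IHg IHh x y|x y|x y].
- by rewrite gmulf1 conj1g conjg1 !mxE /=; congr heis; ring.
- rewrite gmulfM (conjMg (mu g)) conjgM IHg IHh !SL2_mulE; congr heis; ring.
- rewrite -tE (heis_upper p_prime b_order tp sig_tau b_tau sig_b) //.
  + by rewrite !mxE /=; congr heis; ring.
  + exact: sig_t.
  + exact/commute_conj/b_t.
  exact/commute_conj/tau_t.
rewrite -z2E (heis_weyl p_prime sp tp sig_tau b_tau sig_b) //.
- by rewrite !mxE /=; congr heis; ring.
- exact: b_z2.
exact: tau_z2.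
Qed.

End RankTwo.

Let sigP := sig_long (erefl (Z ^ U)) (erefl (sigma ^ (Z ^ U))).

Lemma Z_perm (w : 'S_n) : w i0 = i0 -> commute Z (rho w).
Proof.
move: w; apply: stab1_ind => [|w w' cw cw'|n2|n3].
- by rewrite gmulf1; apply: commute1.
- by rewrite gmulfM; apply: commuteM.
- exact/commg1P/(rel_ZUV rels n2).
exact/commg1P/(rel_ZVU rels n3).
Qed.

Lemma sig_perm (w : 'S_n) : w i0 = i0 -> w i1 = i1 -> sigma ^ rho w = sigma.
Proof.
move: w; apply: stab2_ind => [|w w' cw cw'|n3|n4].
- by rewrite gmulf1 conjg1.
- by rewrite gmulfM conjgM cw.
- exact/commute_conj/commg1P/(rel_sigUV2 rels n3).
exact/commute_conj/commg1P/(rel_sigVUUV rels n4).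
Qed.

(** The square of tau is the commutator of sigma and sigma^(Z^U), and both are
centralised by the permutations that fix the points 0 and 1. *)
Lemma tau2_perm (w : 'S_n) : w i0 = i0 -> w i1 = i1 -> commute (tau ^+ 2) (rho w).
Proof.
move=> w0 w1; apply: conj_commute; rewrite -sigP conjRg conjJg sig_perm //.
suff -> : (Z ^ U) ^ rho w = Z ^ U by [].
have -> : (Z ^ U) ^ rho w = (Z ^ rho (w ^ u^-1)) ^ U.
  rewrite -!conjgM -!gmulfM; congr (Z ^ rho _).
  by rewrite conjgE invgK !mulgA mulgVK.
rewrite (commute_conj (Z_perm _)) // conjgE invgK !permM.
by rewrite tpermL w1 tpermV tpermR.
Qed.

(** For odd p, tau is a power of its square, which commutes with the permutations
fixing 0 and 1; for p = 2 there is a separate relation. *)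
Lemma tau_perm (w : 'S_n) : w i0 = i0 -> commute tau (rho w).
Proof.
have tuv (n2 : (2 < n)%N) : commute tau (rho (u ^ v)).
  exact/commg1P/(rel_tauUV rels n2).
have c1 : commute tau (rho 1) by rewrite gmulf1; apply: commute1.
have cM w' w'' : commute tau (rho w') -> commute tau (rho w'') ->
  commute tau (rho (w' * w'')) by rewrite gmulfM; apply: commuteM.
have [p2|p_odd] := even_prime p_prime.
  move: w; apply: stab1_ind => // n3.
  exact/commg1P/(rel_tauVU rels n3 p2).
move: w; apply: stab12_ind => // w w0 w1.
have -> : tau = (tau ^+ 2) ^+ uphalf p.
  by rewrite -expgnA mul2n odd_uphalfK // expgS tau_order mulg1.
by apply/commute_sym/commuteX/commute_sym/tau2_perm.
Qed.

Lemma mu_perm g (w : 'S_n) : w i0 = i0 -> commute (mu g) (rho w).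
Proof.
move=> w0; elim/SL2_gen_ind: g => [|g h cg ch||].
- by rewrite gmulf1; apply/commute_sym/commute1.
- by rewrite gmulfM; apply/commute_sym/commuteM; apply: commute_sym.
- exact: tau_perm.
exact: Z_perm.
Qed.

Lemma mu_mu g h : commute (mu g) (mu h ^ U).
Proof.
have tauZ : commute tau (Z ^ U) by apply/commg1P/(rel_tauZU rels).
elim/SL2_gen_ind: h => [|h h' ch ch'||].
- by rewrite gmulf1 conj1g; apply: commute1.
- by rewrite gmulfM (conjMg (mu h)); apply: commuteM.
- apply: commute_sym; elim/SL2_gen_ind: g => [|g g' cg cg'||].
  + by rewrite gmulf1; apply: commute1.
  + by rewrite gmulfM; apply: commuteM.
  + exact/commute_sym/commg1P/(rel_tautauU rels).
  by rewrite -(conjUU Z); apply: commuteJ.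
apply: commute_sym; elim/SL2_gen_ind: g => [|g g' cg cg'||].
- by rewrite gmulf1; apply: commute1.
- by rewrite gmulfM; apply: commuteM.
- exact: commute_sym.
exact/commute_sym/commg1P/(rel_ZZU rels).
Qed.

(** The permutation w is a product m V^2 k with m fixing 0 and k fixing 0 and 1.
The relations deal with V^2, which sends 0 to 2, while m commutes with the first
copy of SL(2,p) and k with sigma. *)
Lemma sig_mu g (w : 'S_n) : w i0 != i0 -> w i0 != i1 ->
  sigma ^ (mu g ^ rho w) = sigma.
Proof.
move=> w0 w1; have n2 : (2 < n)%N.
  have := ltn_ord (w i0); have := w0; have := w1.
  by rewrite -!(inj_eq val_inj) /=; case: (nat_of_ord (w i0)) => [|[|k]] //; lia.
have v2 : (v ^+ 2) i0 = Ordinal n2.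
  by apply: val_inj; rewrite expg2 permM cyc0 /= cycS.
have sv2 h : commute sigma (mu h ^ rho (v ^+ 2)).
  elim/SL2_gen_ind: h => [|h h' ch ch'||].
  - by rewrite gmulf1 conj1g; apply: commute1.
  - by rewrite gmulfM (conjMg (mu h)); apply: commuteM.
  - exact/commg1P/(rel_sigtauV2 rels n2).
  exact/commg1P/(rel_sigZV2 rels n2).
have [k [k0 k1 k2]] : exists k : 'S_n, [/\ k i0 = i0, k i1 = i1 &
    k (Ordinal n2) = w i0].
  apply: perm_map3 => //=.
  by rewrite !inE !negb_or /= [i0 == _]eq_sym w0 [i1 == _]eq_sym w1.
pose m := w * k^-1 * (v ^+ 2)^-1.
have wE : w = m * v ^+ 2 * k by rewrite /m mulgVK mulgVK.
have m0 : m i0 = i0 by rewrite !permM -k2 permK -v2 permK.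
have -> : mu g ^ rho w = (mu g ^ rho (v ^+ 2)) ^ rho k.
  rewrite wE rhoM (rhoM m) 2!(conjgM (mu g)).
  by rewrite (commute_conj (mu_perm g m0)).
rewrite -{1}(sig_perm k0 k1) -(conjJg sigma).
by rewrite (commute_conj (sv2 g)) sig_perm.
Qed.

End SymplecticSystem.

(** * The monomial subgroup *)

Section CommutingProducts.
Variables (G : groupType) (I : eqType).
Implicit Types (F H : I -> G) (r q : seq I).

Lemma commute_prod_notin F (x : G) r :
  (forall j, j \in r -> commute x (F j)) -> commute x (\prod_(j <- r) F j).
Proof.
move=> cx; rewrite big_seq; apply: commute_prod => j; exact: cx.
Qed.

Lemma prodM_commute F H r : uniq r ->
  (forall i j, i != j -> commute (F i) (H j)) ->
  \prod_(i <- r) (F i * H i) = \prod_(i <- r) F i * \prod_(i <- r) H i.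
Proof.
move=> + FH; elim: r => [|i r IHr] /=; first by rewrite !big_nil mulg1.
case/andP=> ir /IHr{}IHr; rewrite !big_cons IHr -!mulgA; congr (_ * _).
rewrite !mulgA; congr (_ * _); apply: commute_prod_notin => j jr.
by apply/commute_sym/FH; apply: contraNneq ir => <-.
Qed.

Lemma perm_prod_commute F r q : perm_eq r q -> uniq r ->
  (forall i j, i != j -> commute (F i) (F j)) ->
  \prod_(i <- r) F i = \prod_(i <- q) F i.
Proof.
move=> rq ur FF; elim: r q rq ur => [|i r IHr] q rq ur.
  by move: rq; rewrite perm_sym => /perm_nilP->.
have iq : i \in q by rewrite -(perm_mem rq) mem_head.
have uq : uniq q by rewrite -(perm_uniq rq).
case/splitPr: q / iq rq uq => q1 q2 rq uq; rewrite big_cons.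
have rq' : perm_eq r (q1 ++ q2).
  by rewrite -(perm_cons i) (perm_trans rq) // perm_catC /= perm_cons perm_catC.
rewrite (IHr _ rq') //; last by case/andP: ur.
rewrite !big_cat big_cons /= !mulgA; congr (_ * _).
apply: commute_prod_notin => j jq; apply: FF.
have iq1 : i \notin q1.
  by move: uq; rewrite cat_uniq /= negb_or => /and3P[_ /andP[]].
by apply: contraNneq iq1 => ->.
Qed.

End CommutingProducts.

Section MonomialGroup.
Import GRing.Theory.
Variables (p n : nat) (p_prime : prime p) (n_ge2 : (2 <= n)%N).
Variables (G : groupType) (rho : ghom 'S_n G) (mu : ghom (SL p 2) G) (sigma : G).
Hypothesis rels : sp_relations n_ge2 rho mu sigma.
Variable phi : ghom G (Sp p n).
Local Notation i0 := (Ordinal (ltnW n_ge2)).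
Local Notation i1 := (Ordinal n_ge2).
Hypotheses (phi_rho : forall s, phi (rho s) = sp_perm p s)
  (phi_mu : forall g, phi (mu g) = sp_block i0 g)
  (phi_sigma : phi sigma = sp_sigma p n_ge2).
Local Notation u01 := (tperm i0 i1 : 'S_n).
Local Notation v := (perm (@ordS_inj n) : 'S_n).
Local Notation T := (SL2_transvection p).
Local Notation W := (SL2_weyl p).
Local Notation tau := (mu T).
Local Notation Z := (mu W).
Local Notation U := (rho u01).
Local Notation bv := (@bv p n).
Local Notation Pt := (basis_pt n).
Implicit Types (x y w : G) (a b d : Pt) (i j : 'I_n) (g h : SL p 2) (s t : 'S_n).

Definition mu_ i g : G := mu g ^ rho (tperm i0 i).

(** Two permutations sending 0 to the same point differ by one that fixes 0, and
this commutes with the first copy of SL(2,p). *)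
Lemma muE s g : mu g ^ rho s = mu_ (s i0) g.
Proof.
rewrite /mu_; set t := tperm _ _; have -> : s = (s * t) * t.
  by rewrite -mulgA tperm2 mulg1.
have m0 : (s * t) i0 = i0 by rewrite permM tpermR.
by rewrite gmulfM conjgM (commute_conj (mu_perm p_prime rels g m0)).
Qed.

Lemma mu_J i g s : mu_ i g ^ rho s = mu_ (s i) g.
Proof. by rewrite {1}/mu_ -conjgM -gmulfM muE permM tpermL. Qed.

Lemma mu_0 g : mu g = mu_ i0 g.
Proof. by rewrite -(conjg1 (mu g)) -(@gmulf1 _ _ rho) muE perm1. Qed.

Lemma mu_1 g : mu g ^ U = mu_ i1 g.
Proof. by rewrite muE tpermL. Qed.

Lemma mu_M i g h : mu_ i (g * h) = mu_ i g * mu_ i h.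
Proof. by rewrite /mu_ gmulfM (conjMg (mu g)). Qed.

Lemma mu_1g i : mu_ i 1 = 1.
Proof. by rewrite /mu_ gmulf1 conj1g. Qed.

(** The pair of blocks (i, j) is the image of the first two under a permutation. *)
Lemma mu_comm i j g h : i != j -> commute (mu_ i g) (mu_ j h).
Proof.
move=> ij; have [|s [<- <-]] := @perm_map2 n i0 i1 i j _ ij; first by [].
rewrite -[mu_ (s i0) g]muE -mu_J -mu_1; apply: commuteJ.
exact: mu_mu rels g h.
Qed.

Lemma sig_mu_ i g : i != i0 -> i != i1 -> sigma ^ mu_ i g = sigma.
Proof.
have {1 2 3}-> : i = tperm i0 i i0 by rewrite tpermL.
by rewrite -muE; apply: sig_mu rels _ _.
Qed.

Lemma phi_mu_ i g : phi (mu_ i g) = sp_block i g.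
Proof.
by rewrite /mu_ gmulfJ phi_mu phi_rho sp_block_perm tpermL.
Qed.

Definition nu (m : 'I_n -> SL p 2) : G := \prod_(i < n) mu_ i (m i).

Lemma nuM m m' : nu m * nu m' = nu (fun i => m i * m' i).
Proof.
rewrite /nu -prodM_commute ?index_enum_uniq //; last first.
  by move=> i j; apply: mu_comm.
by apply: eq_bigr => i _; rewrite mu_M.
Qed.

Lemma nu1 : nu (fun=> 1) = 1.
Proof. by rewrite /nu big1 // => i _; apply: mu_1g. Qed.

Lemma nuJ m s : nu m ^ rho s = nu (fun i => m (s^-1 i)).
Proof.
rewrite /nu conjg_prod.
transitivity (\prod_(j <- map s (index_enum 'I_n)) mu_ j (m (s^-1 j))).
  by rewrite big_map; apply: eq_bigr => i _; rewrite mu_J permK.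
apply: perm_prod_commute; last by move=> i j; apply: mu_comm.
  apply: uniq_perm; rewrite ?(map_inj_uniq perm_inj) ?index_enum_uniq //.
  move=> i; rewrite mem_index_enum; apply/mapP; exists (s^-1 i) => //.
  by rewrite permKV.
by rewrite (map_inj_uniq perm_inj) index_enum_uniq.
Qed.

Lemma nu_delta i g : nu (fun j => if j == i then g else 1) = mu_ i g.
Proof.
rewrite -[RHS](big_pred1_eq *%g i (mu_^~ g)) big_mkcond /nu.
by apply: eq_bigr => j _; case: eqP => // _; apply: mu_1g.
Qed.

(** * Monomial elements and the signed permutations they induce *)

Definition maps x a b := exists2 c : 'F_p, c != 0%R & (bv a ** phi x = c *: bv b)%R.

(** Besides a monomial matrix, the definition asks for an expression by block
elements and a permutation, since elements of this form are determined by their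
matrices ([monomial_eq1]). *)
Definition monomial x :=
  [/\ exists m s, x = nu m * rho s,
      forall a, exists b, maps x a b & forall b, exists a, maps x a b].

Lemma mapsM x y a b d : maps x a b -> maps y b d -> maps (x * y) a d.
Proof.
move=> [c c0 xa] [c' c'0 yb]; exists (c * c')%R; first by rewrite mulf_neq0.
by rewrite gmulfM spactM xa spactZl yb scalerA.
Qed.

Lemma mapsV x a b : maps x a b -> maps x^-1 b a.
Proof.
move=> [c c0 xa]; exists c^-1%R; first by rewrite invr_eq0.
have -> : bv b = (c^-1 *: (bv a ** phi x))%R by rewrite xa scalerA mulVf ?scale1r.
by rewrite gmulfV spactZl spactKV.
Qed.

Lemma maps1 a : maps 1 a a.
Proof. by exists 1%R; rewrite ?oner_eq0 // gmulf1 spact1 scale1r. Qed.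

Lemma maps_fun x a b d : maps x a b -> maps x a d -> b = d.
Proof.
move=> [c c0 xa] [c' c'0 xa']; apply/eqP; apply/idPn => bd.
have := congr1 (fun w : 'rV['F_p]_(n + n) => w 0%R (pt b)) (etrans (esym xa) xa').
rewrite !coord_bv eqxx [d == b]eq_sym (negPf bd) mulr1 mulr0 => /eqP.
by rewrite (negPf c0).
Qed.

Lemma sgn_neq0 a : sgn p a != 0%R.
Proof. by rewrite /sgn; case: ifP; rewrite ?oppr_eq0 oner_eq0. Qed.

Lemma maps_opp x a b : monomial x -> maps x a b ->
  maps x (opp_point a) (opp_point b).
Proof.
move=> [_ /(_ (opp_point a)) [d xd] _] xa; suff -> : opp_point b = d by [].
case: xa xd => c c0 xa [c' c'0 xd].
have := sform_act (phi x) (bv a) (bv (opp_point a)).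
rewrite xa xd sformZl sformZr !sform_bv eqxx; case: eqP => [-> //|_].
by rewrite !mulr0 => /esym/eqP; rewrite (negPf (sgn_neq0 _)).
Qed.

Lemma monomialM x y : monomial x -> monomial y -> monomial (x * y).
Proof.
move=> [[m [s ->]] xf xb] [[m' [s' ->]] yf yb]; split=> [|a|d].
- exists (fun i => m i * m' (s i)), (s * s').
  have -> : nu m * rho s * (nu m' * rho s') =
      nu m * (nu m' ^ rho s^-1) * (rho s * rho s').
    by rewrite gmulfV conjgE invgK -!mulgA mulKg.
  rewrite nuJ nuM gmulfM; congr (nu _ * _); apply/funext => i.
  by rewrite invgK.
- have [b xa] := xf a; have [d yb'] := yf b; exists d; exact: mapsM xa yb'.
have [b yb'] := yb d; have [a xa] := xb b; exists a; exact: mapsM xa yb'.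
Qed.

Lemma monomialV x : monomial x -> monomial x^-1.
Proof.
move=> [[m [s ->]] xf xb]; split=> [|a|b].
- exists (fun i => (m (s^-1 i))^-1), s^-1.
  rewrite gmulfV invMg.
  have -> : (nu m)^-1 = nu (fun i => (m i)^-1).
    apply/mulg1_eq; rewrite nuM -[RHS]nu1; congr nu; apply/funext => i.
    by rewrite mulgV.
  by rewrite [LHS]conjgCV invgK nuJ.
- by have [b xb'] := xb a; exists b; apply: mapsV.
by have [a xa] := xf b; exists a; apply: mapsV.
Qed.

Lemma monomial1 : monomial 1.
Proof.
split=> [|a|a]; [|by exists a; apply: maps1..].
by exists (fun=> 1), 1; rewrite nu1 gmulf1 mulg1.
Qed.

Definition act_pt s (a : Pt) : Pt := (s a.1, a.2).
Definition flip_pt i (a : Pt) : Pt := if a.1 == i then opp_point a else a.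

Lemma maps_rho s a : maps (rho s) a (act_pt s a).
Proof. by exists 1%R; rewrite ?oner_eq0 // phi_rho sp_permE scale1r. Qed.

Lemma monomial_rho s : monomial (rho s).
Proof.
split=> [|a|b]; first by exists (fun=> 1), s; rewrite nu1 mul1g.
  by exists (act_pt s a); apply: maps_rho.
exists (act_pt s^-1 b); have := maps_rho s (act_pt s^-1 b).
by rewrite /act_pt /= permKV -surjective_pairing.
Qed.

Lemma maps_weyl i a : maps (mu_ i W) a (flip_pt i a).
Proof.
exists (if (a.1 == i) && a.2 then -1 else 1)%R.
  by case: ifP; rewrite ?oppr_eq0 oner_eq0.
rewrite phi_mu_ sp_blockE /block_img /flip_pt; case: a => j e /=.
case: eqP => [->|_] /=; last by rewrite scale1r.
by case: e => /=; rewrite !mxE /= ?(scale0r, scale1r, addr0, add0r).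
Qed.

Lemma mu_monomial i g : (forall a, exists b, maps (mu_ i g) a b) ->
  (forall b, exists a, maps (mu_ i g) a b) -> monomial (mu_ i g).
Proof.
split=> //; exists (fun j => if j == i then g else 1), 1.
by rewrite gmulf1 mulg1 nu_delta.
Qed.

Lemma monomial_weyl i : monomial (mu_ i W).
Proof.
apply: mu_monomial => a; first by exists (flip_pt i a); apply: maps_weyl.
exists (flip_pt i a); have := maps_weyl i (flip_pt i a).
by rewrite {2}/flip_pt /flip_pt; case: ifP => ai; rewrite /= ai ?opp_pointK.
Qed.

Lemma maps_diag i g a : val g 0%R 1%R = 0%R :> 'F_p -> val g 1%R 0%R = 0%R :> 'F_p ->
  maps (mu_ i g) a a.
Proof.
move=> g01 g10; have := SL2_det g; rewrite g01 mul0r subr0 => det.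
have g00 : val g 0%R 0%R != 0%R :> 'F_p.
  by apply: contra_eq_neq det => ->; rewrite mul0r eq_sym oner_eq0.
have g11 : val g 1%R 1%R != 0%R :> 'F_p.
  by apply: contra_eq_neq det => ->; rewrite mulr0 eq_sym oner_eq0.
rewrite /maps phi_mu_ sp_blockE /block_img.
case: a => j e /=; case: eqP => [->|_]; last by exists 1%R; rewrite ?oner_eq0 ?scale1r.
case: e => /=; rewrite ?g01 ?g10 scale0r ?addr0 ?add0r.
  by exists (val g 1%R 1%R).
by exists (val g 0%R 0%R).
Qed.

Lemma monomial_diag i g : val g 0%R 1%R = 0%R :> 'F_p ->
  val g 1%R 0%R = 0%R :> 'F_p -> monomial (mu_ i g).
Proof.
by move=> g01 g10; apply: mu_monomial => a; exists a; apply: maps_diag.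
Qed.

Lemma phi_nuE m a : (bv a ** phi (nu m) =
  val (m a.1) (bi a.2) 0 *: bv (a.1, false) +
  val (m a.1) (bi a.2) 1 *: bv (a.1, true))%R.
Proof.
have E r b : uniq r -> (bv b ** phi (\prod_(i <- r) mu_ i (m i))%g =
    if b.1 \in r then block_img b.1 (m b.1) b else bv b)%R.
  elim: r b => [|i r IHr] b /=; first by rewrite big_nil gmulf1 spact1.
  case/andP=> ir ur; rewrite big_cons gmulfM spactM phi_mu_ sp_blockE in_cons.
  rewrite {1}/block_img; case: (eqVneq b.1 i) => [bi_|bi_] /=; last exact: IHr.
  rewrite spactDl !spactZl !IHr //= bi_ (negPf ir).
  by rewrite /block_img bi_ eqxx.
by rewrite /nu E ?index_enum_uniq // mem_index_enum /block_img eqxx.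
Qed.

Lemma phi_nu_rhoE m s a : (bv a ** phi (nu m * rho s)%g =
  val (m a.1) (bi a.2) 0 *: bv (s a.1, false) +
  val (m a.1) (bi a.2) 1 *: bv (s a.1, true))%R.
Proof.
by rewrite gmulfM spactM phi_nuE spactDl !spactZl phi_rho !sp_permE.
Qed.

Lemma maps_self m s a : maps (nu m * rho s) a a ->
  s a.1 = a.1 /\ val (m a.1) (bi a.2) (bi (~~ a.2)) = 0%R :> 'F_p.
Proof.
case: a => i e [c c0]; rewrite phi_nu_rhoE /= => E.
have coord b := congr1 (fun w : 'rV['F_p]_(n + n) => w 0%R (pt b)) E.
move: coord => /= coord.
have si : s i = i.
  apply/eqP; apply: contraNT c0 => si; have := coord (i, e).
  by rewrite mxE !coord_bv !xpair_eqE eqxx (negPf si) /= !mulr0 addr0 eqxx mulr1 => <-.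
split=> //; have := coord (i, ~~ e); rewrite mxE !coord_bv !xpair_eqE si eqxx /=.
by case: e {E coord} => /=; rewrite ?mulr0 ?mulr1 ?addr0 ?add0r.
Qed.

Lemma monomial_nu m : (forall i, m i = W \/ m i = 1) -> monomial (nu m).
Proof.
move=> mW; rewrite /nu; apply: big_ind => [||i _].
- exact: monomial1.
- exact: monomialM.
by case: (mW i) => ->; [apply: monomial_weyl|rewrite mu_1g; apply: monomial1].
Qed.

(** Every signed permutation of the basis is induced by a monomial element, so roots
can be moved to standard positions. *)
Lemma monomial_exists s (fl : 'I_n -> bool) :
  exists2 w, monomial w & forall a, maps w a (s a.1, a.2 (+) fl a.1).
Proof.
exists (nu (fun i => if fl i then W else 1) * rho s).
  apply: monomialM; last exact: monomial_rho.
  by apply: monomial_nu => i; case: (fl i); [left|right].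
move=> [i e]; exists (if fl i && e then -1 else 1)%R.
  by case: ifP; rewrite ?oppr_eq0 oner_eq0.
rewrite phi_nu_rhoE /=; case: (fl i); case: e => /=;
  by rewrite !mxE /= ?(scale0r, scale1r, addr0, add0r).
Qed.

(** The matrix of [nu m * rho s] shows the permutation s and the 2 x 2 blocks m i,
and S_n and SL(2,p) are given as permutations and matrices. *)
Lemma monomial_eq1 x : monomial x -> (forall a, (bv a ** phi x = bv a)%R) -> x = 1.
Proof.
move=> [[m [s ->]] _ _] fix_x.
have ms a : s a.1 = a.1 /\ val (m a.1) (bi a.2) (bi (~~ a.2)) = 0%R :> 'F_p.
  by apply: maps_self; exists 1%R; rewrite ?oner_eq0 // scale1r fix_x.
have -> : s = 1.
  by apply/permP => i; rewrite perm1; have [] := ms (i, false).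
rewrite gmulf1 mulg1 -nu1; congr nu; apply/funext => i.
have [_ /= m01] := ms (i, false); have [_ /= m10] := ms (i, true).
have [si _] := ms (i, false).
have coord e : val (m i) (bi e) (bi e) = 1%R :> 'F_p.
  have := congr1 (fun w : 'rV['F_p]_(n + n) => w 0%R (pt (i, e))) (fix_x (i, e)).
  rewrite phi_nu_rhoE /= mxE !coord_bv bvE !xpair_eqE (ms (i, e)).1 !eqxx /=.
  by case: e => /=; rewrite ?mulr0 ?mulr1 ?addr0 ?add0r.
apply: SL2_eq; rewrite [LHS]mx2_eta SL2_val1 -mx2_1 m01 m10.
by rewrite (coord false) (coord true).
Qed.

(** * Root elements *)

Local Notation f0 := ((i0, true) : Pt).
Local Notation e1 := ((i1, false) : Pt).
Local Notation c := (Z * U * Z^-1).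

(** The root subgroup of the pair {a, b}: sigma is the bitransvection along f_0
and e_1.  That the choice of w does not matter is [short_rootE]. *)
Definition short_root a b x := exists w k,
  [/\ monomial w, maps w f0 a, maps w e1 b & x = (sigma ^+ k) ^ w].
Definition long_root a x := exists w k,
  [/\ monomial w, maps w f0 a & x = (tau ^+ k) ^ w].

Definition powers x w := exists k, x ^ w = x ^+ k.

Lemma powers1 x : powers x 1. Proof. by exists 1%N; rewrite conjg1. Qed.
Lemma powersM x w w' : powers x w -> powers x w' -> powers x (w * w').
Proof.
move=> [k kE] [k' k'E]; exists (k * k')%N.
by rewrite conjgM kE conjXg k'E -expgnA mulnC.
Qed.

Lemma powers_fix x w : x ^ w = x -> powers x w.
Proof. by move=> xw; exists 1%N. Qed.

(** Conjugating an upper unitriangular matrix by an upper triangular one. *)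
Lemma tau_diag g : val g 1%R 0%R = 0%R :> 'F_p -> powers tau (mu g).
Proof.
move=> g10; have := SL2_det g; rewrite g10 mulr0 subr0 => det.
exists (val g 1%R 1%R ^+ 2 : 'F_p)%R.
rewrite -gmulfJ -gmulfXn; congr (mu _); apply: (mulgI g).
rewrite -conjgC; apply: SL2_eq; rewrite [LHS]SL2_valM [RHS]SL2_valM.
rewrite upperX natr_Zp [val g]mx2_eta !mx2_mul g10.
congr mx2; try ring.
by rewrite mxE /= expr2 mulrA det; ring.
Qed.

(** Diagonal elements of the second block act on sigma as on the first coordinate of
the Heisenberg group; those of the first block are conjugate to them by
c = Z U Z^-1, which centralises sigma. *)
Lemma sig_diag1 g : val g 0%R 1%R = 0%R :> 'F_p ->
  sigma ^ mu_ i1 g = pw sigma (val g 0%R 0%R : 'F_p).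
Proof.
move=> g01; have := heis_act p_prime rels (erefl _) (erefl _) (erefl _) (erefl _) g 1%R 0%R.
rewrite mu_1 g01 /heis !mul1r !mul0r !addr0 mulr0 oppr0 !pw0 pw1 // !mulg1.
by [].
Qed.

Lemma mu_0c g : mu g ^ c = mu_ i1 (g ^ W).
Proof.
rewrite 2!conjgM -gmulfJ mu_1; apply: commute_conj.
by rewrite mu_0; apply/commuteV/mu_comm.
Qed.

Lemma sig_diag0 g : val g 1%R 0%R = 0%R :> 'F_p -> powers sigma (mu g).
Proof.
move=> g10; have gW : val (g ^ W) 0%R 1%R = 0%R :> 'F_p.
  have E : W * g ^ W = g * W by rewrite -conjgC.
  have := congr1 (fun h : SL p 2 => (val h 1 1 : 'F_p)%R) E.
  rewrite !SL2_mulE g10 !mxE /= !mul0r !mulr0 !add0r mulN1r addr0.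
  by move/eqP; rewrite oppr_eq0 => /eqP.
have := sig_diag1 gW; rewrite -mu_0c -{1}(sig_c rels) -conjJg => E.
exists (val (g ^ W) 0%R 0%R : 'F_p); apply: (conjg_inj c).
by rewrite E conjXg (sig_c rels).
Qed.

(** The monomial elements fixing the lines of f_0 and e_1 are made of diagonal
matrices in the first two blocks and of parts that centralise sigma. *)
Lemma sig_powers x : monomial x -> maps x f0 f0 -> maps x e1 e1 ->
  powers sigma x.
Proof.
move=> [[m [s ->]] _ _] /maps_self[/= s0 m0] /maps_self[/= s1 m1].
apply: powersM; last exact/powers_fix/(sig_perm rels).
rewrite /nu; apply: (big_ind (powers sigma)) => [||i _].
- exact: powers1.
- exact: powersM.
have [->|ni0] := eqVneq i i0; first by rewrite -mu_0; apply: sig_diag0.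
have [->|ni1] := eqVneq i i1; last exact/powers_fix/sig_mu_.
by exists (val (m i1) 0%R 0%R : 'F_p); apply: sig_diag1.
Qed.

Lemma tau_powers x : monomial x -> maps x f0 f0 -> powers tau x.
Proof.
move=> [[m [s ->]] _ _] /maps_self[/= s0 m0].
apply: powersM; last exact/powers_fix/commute_conj/(mu_perm p_prime rels).
rewrite /nu; apply: (big_ind (powers tau)) => [||i _].
- exact: powers1.
- exact: powersM.
have [->|ni0] := eqVneq i i0; first by rewrite -mu_0; apply: tau_diag.
by rewrite mu_0; apply/powers_fix/commute_conj/mu_comm; rewrite eq_sym.
Qed.

Lemma short_rootE a b x w : monomial w -> maps w f0 a -> maps w e1 b ->
  short_root a b x <-> exists k, x = (sigma ^+ k) ^ w.
Proof.
move=> Mw wa wb; split=> [[w' [k [Mw' wa' wb' ->]]]|[k ->]]; last first.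
  by exists w, k.
have [|||j jE] := @sig_powers (w' * w^-1).
- exact/monomialM/monomialV.
- exact: mapsM wa' (mapsV wa).
- exact: mapsM wb' (mapsV wb).
exists (j * k)%N; rewrite -[w'](mulgVK w) conjgM conjXg jE.
by rewrite expgnA.
Qed.

Lemma long_rootE a x w : monomial w -> maps w f0 a ->
  long_root a x <-> exists k, x = (tau ^+ k) ^ w.
Proof.
move=> Mw wa; split=> [[w' [k [Mw' wa' ->]]]|[k ->]]; last by exists w, k.
have [||j jE] := @tau_powers (w' * w^-1).
- exact/monomialM/monomialV.
- exact: mapsM wa' (mapsV wa).
exists (j * k)%N; rewrite -[w'](mulgVK w) conjgM conjXg jE.
by rewrite expgnA.
Qed.

Lemma short_rootJ a b a' b' x w : monomial w -> maps w a a' -> maps w b b' ->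
  short_root a b x -> short_root a' b' (x ^ w).
Proof.
move=> Mw wa wb [w' [k [Mw' wa' wb' ->]]]; exists (w' * w), k; split.
- exact: monomialM.
- exact: mapsM wa' wa.
- exact: mapsM wb' wb.
by rewrite conjgM.
Qed.

Lemma long_rootJ a a' x w : monomial w -> maps w a a' ->
  long_root a x -> long_root a' (x ^ w).
Proof.
move=> Mw wa [w' [k [Mw' wa' ->]]]; exists (w' * w), k; split.
- exact: monomialM.
- exact: mapsM wa' wa.
by rewrite conjgM.
Qed.

Lemma ZUZ_monomial : [/\ monomial c, maps c f0 e1 & maps c e1 f0].
Proof.
have MZ : monomial Z by rewrite mu_0; apply: monomial_weyl.
have Zm a : maps Z a (flip_pt i0 a) by rewrite mu_0; apply: maps_weyl.
have f0_ : maps Z f0 (i0, false) by have := Zm f0.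
have e0_ : maps Z (i0, false) f0 by have := Zm (i0, false).
have e1_ : maps Z e1 e1 by have := Zm e1.
have U0 : maps U (i0, false) e1.
  by have := maps_rho u01 (i0, false); rewrite /act_pt /= tpermL.
have U1 : maps U e1 (i0, false).
  by have := maps_rho u01 e1; rewrite /act_pt /= tpermR.
split.
- apply: monomialM; last exact: monomialV.
  by apply: monomialM => //; apply: monomial_rho.
- exact: mapsM (mapsM f0_ U0) (mapsV e1_).
exact: mapsM (mapsM e1_ U1) (mapsV f0_).
Qed.

(** The element Z U Z^-1 centralises sigma and exchanges the lines of f_0 and e_1. *)
Lemma short_rootC a b x : short_root a b x -> short_root b a x.
Proof.
have [Mc cf ce] := ZUZ_monomial.
move=> [w [k [Mw wa wb ->]]]; exists (c * w), k; split.
- exact: monomialM.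
- exact: mapsM cf wb.
- exact: mapsM ce wa.
by rewrite (conjgM _ c) (conjXg sigma c) (sig_c rels).
Qed.

Lemma uniq_leq_n (r : seq 'I_n) : uniq r -> (size r <= n)%N.
Proof. by move=> /card_uniqP <-; rewrite -[n in leqRHS]card_ord max_card. Qed.

(** Two roots with four distinct indices are brought to the first four blocks; the
signs of the basis vectors there can be prescribed. *)
Lemma config4 (n3 : (3 < n)%N) a b d d' e e' : uniq [:: a.1; b.1; d.1; d'.1] ->
  exists w, [/\ monomial w, maps w f0 a, maps w e1 b,
    maps w (Ordinal (ltnW n3), e) d & maps w (Ordinal n3, e') d'].
Proof.
move=> ud; have ub : uniq [:: i0; i1; Ordinal (ltnW n3); Ordinal n3] by [].
have [s [s0 s1 s2 s3]] := perm_map4 ub ud.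
have [w Mw wm] := monomial_exists s (fun i => if i == i0 then ~~ a.2 else
  if i == i1 then b.2 else if i == Ordinal n3 then e' (+) d'.2 else e (+) d.2).
exists w; split=> //.
- by have := wm f0; rewrite /= s0 negbK -surjective_pairing.
- by have := wm e1; rewrite /= s1 -surjective_pairing.
- by have := wm (Ordinal (ltnW n3), e); rewrite /= s2 addKb -surjective_pairing.
by have := wm (Ordinal n3, e'); rewrite /= s3 addKb -surjective_pairing.
Qed.

Lemma config3 (n2 : (2 < n)%N) a b d e : uniq [:: a.1; b.1; d.1] ->
  exists w, [/\ monomial w, maps w f0 a, maps w e1 b & maps w (Ordinal n2, e) d].
Proof.
move=> ud; have ub : uniq [:: i0; i1; Ordinal n2] by [].
have [s [s0 s1 s2]] := perm_map3 ub ud.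
have [w Mw wm] := monomial_exists s (fun i => if i == i0 then ~~ a.2 else
  if i == i1 then b.2 else e (+) d.2).
exists w; split=> //.
- by have := wm f0; rewrite /= s0 negbK -surjective_pairing.
- by have := wm e1; rewrite /= s1 -surjective_pairing.
by have := wm (Ordinal n2, e); rewrite /= s2 addKb -surjective_pairing.
Qed.

Lemma config2 a b : a.1 != b.1 ->
  exists w, [/\ monomial w, maps w f0 a & maps w e1 b].
Proof.
move=> ab; have [|s [s0 s1]] := @perm_map2 n i0 i1 a.1 b.1 _ ab; first by [].
have [w Mw wm] := monomial_exists s (fun i => if i == i0 then ~~ a.2 else b.2).
exists w; split=> //.
- by have := wm f0; rewrite /= s0 negbK -surjective_pairing.
by have := wm e1; rewrite /= s1 -surjective_pairing.
Qed.

Lemma short_root_neq a b x : short_root a b x -> a.1 != b.1.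
Proof.
move=> [w [k [[[m [s wE]] _ _] wa wb _]]].
have pos d d' : maps w d d' -> d'.1 = s d.1.
  rewrite wE; case: d d' => i e [j e'] [q q0] /=; rewrite phi_nu_rhoE /= => E.
  apply/eqP; apply: contraNT q0 => ji.
  have := congr1 (fun z : 'rV['F_p]_(n + n) => z 0%R (pt (j, e'))) E.
  rewrite mxE !coord_bv !xpair_eqE eqxx /= [s i == j]eq_sym (negPf ji) /=.
  by rewrite !mulr0 addr0 eqxx mulr1 => <-.
by rewrite (pos _ _ wa) (pos _ _ wb) (inj_eq perm_inj).
Qed.

Lemma comm_pow (x y z : G) k l : commute x z -> commute y z -> [~ x, y] = z ->
  [~ x ^+ k, y ^+ l] = z ^+ (k * l).
Proof.
move=> xz yz xy; have xJ : x ^ y = x * z by rewrite -xy commgEl mulKVg.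
have xJl (j : nat) : x ^ (y ^+ j) = x * z ^+ j.
  elim: j => [|j IHj]; first by rewrite conjg1 mulg1.
  rewrite expgSr conjgM IHj conjMg xJ conjXg (commute_conj (commute_sym yz)).
  by rewrite -mulgA -expgS.
rewrite commgEl conjXg xJl expgMn; last exact: commuteX.
by rewrite mulKg -expgnA mulnC.
Qed.

Lemma commute_root_pow (x y w : G) k l : commute x y ->
  commute ((x ^+ k) ^ w) ((y ^+ l) ^ w).
Proof. by move=> xy; apply/commuteJ/commuteX2. Qed.

(** In standard position the two root elements are powers of tau and tau^U. *)
Lemma long_long_commute a d x y : a.1 != d.1 ->
  long_root a x -> long_root d y -> commute x y.
Proof.
move=> ad; have [w [Mw wa wd]] := @config2 a (opp_point d) ad.
have Uf : maps U f0 (i1, true) by have := maps_rho u01 f0; rewrite /act_pt tpermL.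
have wd' : maps w (i1, true) d by have := maps_opp Mw wd; rewrite opp_pointK.
move/(long_rootE _ Mw wa) => [k ->].
have MU := monomialM (monomial_rho u01) Mw.
move/(long_rootE _ MU (mapsM Uf wd')) => [l ->].
rewrite conjgM (conjXg tau U); apply: commute_root_pow.
exact/commg1P/(rel_tautauU rels).
Qed.

Lemma long_commute a x y : long_root a x -> long_root a y -> commute x y.
Proof.
move=> [w [k [Mw wa ->]]] /(long_rootE _ Mw wa) [l ->].
exact: commute_root_pow.
Qed.

Lemma short_long_commute1 a b x y : short_root a b x -> long_root a y -> commute x y.
Proof.
move=> [w [k [Mw wa wb ->]]] /(long_rootE _ Mw wa) [l ->].
by apply: commute_root_pow; apply: sig_tau rels.
Qed.

Lemma short_long_commute a b d x y : uniq [:: a.1; b.1; d.1] ->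
  short_root a b x -> long_root d y -> commute x y.
Proof.
move=> ud; have n2 := uniq_leq_n ud.
have [w [Mw wa wb wd]] := @config3 n2 a b d true ud.
have v2 : (v ^+ 2) i0 = Ordinal n2.
  by apply: val_inj; rewrite expg2 permM cyc0 /= cycS.
have Vm : maps (rho (v ^+ 2)) f0 (Ordinal n2, true).
  by have := maps_rho (v ^+ 2) f0; rewrite /act_pt v2.
move/(short_rootE _ Mw wa wb) => [k ->].
have MV := monomialM (monomial_rho (v ^+ 2)) Mw.
move/(long_rootE _ MV (mapsM Vm wd)) => [l ->].
rewrite conjgM (conjXg tau (rho _)); apply: commute_root_pow.
exact/commg1P/(rel_sigtauV2 rels n2).
Qed.

Lemma short_commute a b x y : short_root a b x -> short_root a b y -> commute x y.
Proof.
move=> [w [k [Mw wa wb ->]]] /(short_rootE _ Mw wa wb) [l ->].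
exact: commute_root_pow.
Qed.

(** Standard position: sigma and sigma^(V U), with the common vector f_0. *)
Lemma short_share_commute a b d x y : uniq [:: a.1; b.1; d.1] ->
  short_root a b x -> short_root a d y -> commute x y.
Proof.
move=> ud; have n2 := uniq_leq_n ud.
have [w [Mw wa wb wd]] := @config3 n2 a b d false ud.
have m0 : maps (rho (v * u01)) f0 f0.
  by have := maps_rho (v * u01) f0; rewrite /act_pt /= permM cyc0 tpermR.
have m1 : maps (rho (v * u01)) e1 (Ordinal n2, false).
  have := maps_rho (v * u01) e1; rewrite /act_pt /= permM.
  have -> : v i1 = Ordinal n2 by apply: val_inj; rewrite /= cycS.
  by rewrite tpermD.
move/(short_rootE _ Mw wa wb) => [k ->].
have MV := monomialM (monomial_rho (v * u01)) Mw.
move/(short_rootE _ MV (mapsM m0 wa) (mapsM m1 wd)) => [l ->].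
rewrite conjgM (conjXg sigma (rho _)); apply: commute_root_pow.
exact/commg1P/(rel_sigVU rels n2).
Qed.

Lemma short_disjoint_commute a b d d' x y : uniq [:: a.1; b.1; d.1; d'.1] ->
  short_root a b x -> short_root d d' y -> commute x y.
Proof.
move=> ud; have n3 := uniq_leq_n ud.
have [w [Mw wa wb wd wd']] := @config4 n3 a b d d' true false ud.
have v0 : (v ^+ 2) i0 = Ordinal (ltnW n3).
  by apply: val_inj; rewrite expg2 permM cyc0 /= cycS // ltnW.
have v1 : (v ^+ 2) i1 = Ordinal n3.
  by apply: val_inj; rewrite cyclic_permX /= modn_small.
have m0 : maps (rho (v ^+ 2)) f0 (Ordinal (ltnW n3), true).
  by have := maps_rho (v ^+ 2) f0; rewrite /act_pt v0.
have m1 : maps (rho (v ^+ 2)) e1 (Ordinal n3, false).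
  by have := maps_rho (v ^+ 2) e1; rewrite /act_pt v1.
move/(short_rootE _ Mw wa wb) => [k ->].
have MV := monomialM (monomial_rho (v ^+ 2)) Mw.
move/(short_rootE _ MV (mapsM m0 wd) (mapsM m1 wd')) => [l ->].
rewrite conjgM (conjXg sigma (rho _)); apply: commute_root_pow.
exact/commg1P/(rel_sigV2 rels n3).
Qed.

(** Standard position: sigma and sigma^V, whose commutator is sigma^(V U). *)
Lemma short_short_comm a b d x y : uniq [:: a.1; b.1; d.1] ->
  short_root a b x -> short_root (opp_point b) d y -> short_root a d [~ x, y].
Proof.
move=> ud; have n2 := uniq_leq_n ud.
have [w [Mw wa wb wd]] := @config3 n2 a b d false ud.
have v1 : v i1 = Ordinal n2 by apply: val_inj; rewrite /= cycS.
have m0 : maps (rho v) f0 (i1, true).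
  by have := maps_rho v f0; rewrite /act_pt /= cyc0.
have m1 : maps (rho v) e1 (Ordinal n2, false).
  by have := maps_rho v e1; rewrite /act_pt /= v1.
have m0' : maps (rho (v * u01)) f0 f0.
  by have := maps_rho (v * u01) f0; rewrite /act_pt /= permM cyc0 tpermR.
have m1' : maps (rho (v * u01)) e1 (Ordinal n2, false).
  by have := maps_rho (v * u01) e1; rewrite /act_pt /= permM v1 tpermD.
move/(short_rootE _ Mw wa wb) => [k ->].
have MV := monomialM (monomial_rho v) Mw.
move/(short_rootE _ MV (mapsM m0 (maps_opp Mw wb)) (mapsM m1 wd)) => [l ->].
rewrite conjgM (conjXg sigma (rho v)) -conjRg.
have c1 : commute sigma (sigma ^ rho (v * u01)).
  exact/commg1P/(rel_sigVU rels n2).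
have c2 : commute (sigma ^ rho v) (sigma ^ rho (v * u01)).
  apply: (@short_share_commute (Ordinal n2, false) (i1, true) f0) => //.
    by apply: short_rootC; exists (rho v), 1%N; split=> //; apply: monomial_rho.
  apply: short_rootC; exists (rho (v * u01)), 1%N; split=> //.
  exact: monomial_rho.
rewrite (comm_pow k l c1 c2 (rel_sigV rels n2)) -(conjXg sigma) -conjgM.
exists (rho (v * u01) * w), (k * l)%N; split=> //.
- exact/monomialM/Mw/monomial_rho.
- exact: mapsM m0' wa.
exact: mapsM m1' wd.
Qed.

Lemma maps_weyl1 : maps (mu_ i1 W) f0 f0 /\ maps (mu_ i1 W) e1 (i1, true).
Proof.
by split; [have := maps_weyl i1 f0|have := maps_weyl i1 e1].
Qed.

(** Standard position: sigma and sigma^(Z^U) in the Heisenberg group, with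
commutator tau^2. *)
Lemma short_long_comm_result a b x y :
  short_root a b x -> short_root a (opp_point b) y -> long_root a [~ x, y].
Proof.
move=> [w [k [Mw wa wb ->]]]; have [m0 m1] := maps_weyl1.
have MV := monomialM (monomial_weyl i1) Mw.
move/(short_rootE _ MV (mapsM m0 wa) (mapsM m1 (maps_opp Mw wb))) => [l ->].
rewrite conjgM (conjXg sigma (mu_ _ _)) -conjRg.
have c1 : commute sigma tau := sig_tau rels.
have c2 : commute (sigma ^ mu_ i1 W) tau.
  by rewrite -mu_1; apply: b_tau (erefl _) (erefl _).
have c3 : [~ sigma, sigma ^ mu_ i1 W] = tau ^+ 2.
  by rewrite -mu_1; apply: sig_long (erefl _) (erefl _).
rewrite (comm_pow k l (commuteX 2 c1) (commuteX 2 c2) c3) -expgnA.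
by exists w, (2 * (k * l))%N.
Qed.

(** Standard position: powers of sigma and of tau^U; the commutator is read off
from the action of tau^U on the Heisenberg group. *)
Lemma short_long_comm a b x y : short_root a b x -> long_root (opp_point b) y ->
  exists z z', [/\ [~ x, y] = z * z', short_root a (opp_point b) z & long_root a z'].
Proof.
move=> [w [k [Mw wa wb ->]]]; have [m0 m1] := maps_weyl1.
have Uf : maps U f0 (i1, true) by have := maps_rho u01 f0; rewrite /act_pt tpermL.
have MU := monomialM (monomial_rho u01) Mw.
move/(long_rootE _ MU (mapsM Uf (maps_opp Mw wb))) => [l ->].
have := heis_act p_prime rels (erefl _) (erefl _) (erefl _) (erefl _)
  (T ^+ l) (k%:R)%R 0%R.
rewrite upperX !mxE /= /heis !(mulr0, mulr1, mul0r, addr0, add0r, oppr0, pw0).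
rewrite pw_nat ?(rel_sig_order rels) // !mulg1.
rewrite mu_1; set r := (_ * _)%R; set r' := (- _)%R => E.
exists (pw (sigma ^ (Z ^ U)) r ^ w), (pw tau r' ^ w); split.
- rewrite conjgM (conjXg tau U) mu_1 -conjRg.
  have -> : mu_ i1 T ^+ l = mu_ i1 (T ^+ l).
    by rewrite -!mu_1 gmulfXn (conjXg (mu T)).
  by rewrite commgEl E -(mulgA (sigma ^+ k)) mulKg (conjMg (pw _ _)).
- rewrite pwJ mu_1 -pwJ.
  exists (mu_ i1 W * w), (r : nat); split.
  + exact: monomialM (monomial_weyl i1) Mw.
  + exact: mapsM m0 wa.
  + exact: mapsM m1 (maps_opp Mw wb).
  by rewrite conjgM (conjXg sigma (mu_ _ _)).
by exists w, (r' : nat).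
Qed.

(** * Groups generated by root elements *)

(** Roots of type C_n are the unordered pairs {a, b} of basis vectors with b not
the partner of a; they are long when a = b. *)
Definition root a b x := if a == b then long_root a x else short_root a b x.

Inductive root_gen (Psi : Pt -> Pt -> Prop) : G -> Prop :=
| root_gen1 : root_gen Psi 1
| root_genM a b x y : Psi a b -> root a b x -> root_gen Psi y ->
    root_gen Psi (x * y).

Lemma rootC a b x : root a b x -> root b a x.
Proof.
rewrite /root eq_sym; case: eqP => [->//|_]; exact: short_rootC.
Qed.

Lemma rootJ a b a' b' x w : monomial w -> maps w a a' -> maps w b b' ->
  root a b x -> root a' b' (x ^ w).
Proof.
move=> Mw wa wb; rewrite /root.
have -> : (a' == b') = (a == b).
  apply/eqP/eqP => [E|E]; last by rewrite E in wa; apply: maps_fun wa wb.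
  by rewrite -E in wb; apply: maps_fun (mapsV wa) (mapsV wb).
by case: eqP => _; [apply: long_rootJ|apply: short_rootJ].
Qed.

Lemma tau_pow_inv k : exists j : nat, (tau ^+ k)^-1 = tau ^+ j.
Proof.
exists (k * p.-1)%N; apply/mulg1_eq; rewrite -expgnDr -mulnS prednK ?prime_gt0 //.
by rewrite mulnC expgnA (tau_order p_prime) expg1n.
Qed.

Lemma sig_pow_inv k : exists j : nat, (sigma ^+ k)^-1 = sigma ^+ j.
Proof.
exists (k * p.-1)%N; apply/mulg1_eq; rewrite -expgnDr -mulnS prednK ?prime_gt0 //.
by rewrite mulnC expgnA (rel_sig_order rels) expg1n.
Qed.

Lemma rootV a b x : root a b x -> root a b x^-1.
Proof.
rewrite /root; case: eqP => _ [w [k]].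
  by move=> [Mw wa ->]; have [j jE] := tau_pow_inv k; exists w, j; rewrite -conjVg jE.
by move=> [Mw wa wb ->]; have [j jE] := sig_pow_inv k; exists w, j; rewrite -conjVg jE.
Qed.

Lemma rootM a b x y : root a b x -> root a b y -> root a b (x * y).
Proof.
rewrite /root; case: eqP => _ [w [k]].
  move=> [Mw wa ->] /(long_rootE _ Mw wa)[l ->].
  by exists w, (k + l)%N; rewrite -conjMg -expgnDr.
move=> [Mw wa wb ->] /(short_rootE _ Mw wa wb)[l ->].
by exists w, (k + l)%N; rewrite -conjMg -expgnDr.
Qed.

Section Generated.
Implicit Types Psi : Pt -> Pt -> Prop.

Lemma root_gen_mul Psi x y : root_gen Psi x -> root_gen Psi y -> root_gen Psi (x * y).
Proof.
elim=> [|a b z t Pab rz _ IH] ry; first by rewrite mul1g.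
by rewrite -mulgA; apply: root_genM Pab rz (IH ry).
Qed.

Lemma root_gen_root Psi a b x : Psi a b -> root a b x -> root_gen Psi x.
Proof.
by move=> Pab rx; rewrite -[x]mulg1; apply: root_genM Pab rx (root_gen1 _).
Qed.

Lemma root_gen_inv Psi x : root_gen Psi x -> root_gen Psi x^-1.
Proof.
elim=> [|a b z t Pab rz _ IH]; first by rewrite invg1; apply: root_gen1.
by rewrite invMg; apply: root_gen_mul IH (root_gen_root Pab (rootV rz)).
Qed.

Lemma root_gen_sub Psi Psi' x : (forall a b, Psi a b -> Psi' a b) ->
  root_gen Psi x -> root_gen Psi' x.
Proof.
move=> sub; elim=> [|a b z t Pab rz _ IH]; first exact: root_gen1.
exact: root_genM (sub _ _ Pab) rz IH.
Qed.

Lemma root_genJ Psi Psi' y x :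
  (forall a b z, Psi a b -> root a b z -> root_gen Psi' (z ^ y)) ->
  root_gen Psi x -> root_gen Psi' (x ^ y).
Proof.
move=> conj; elim=> [|a b z t Pab rz _ IH]; first by rewrite conj1g; apply: root_gen1.
by rewrite conjMg; apply: root_gen_mul (conj _ _ _ Pab rz) IH.
Qed.

(** If commutators with the root group of (a, b) stay in Psi, that root group
normalises the group generated by Psi and splits off. *)
Lemma root_gen_split Psi a b x :
  (forall d e y z, Psi d e -> root d e y -> root a b z -> root_gen Psi [~ y, z]) ->
  root_gen (fun d e => Psi d e \/ (d = a /\ e = b)) x ->
  exists z y, [/\ x = z * y, root a b z \/ z = 1 & root_gen Psi y].
Proof.
move=> comm; elim=> [|d e z t [Pde|[-> ->]] rz _ [z' [t' [-> rz' Pt']]]].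
- by exists 1, 1; split; [rewrite mulg1|right|apply: root_gen1].
- exists z', (z ^ z' * t'); split=> //.
    by rewrite mulgA (conjgC z z') -!(mulgA z').
  apply: root_gen_mul Pt'; case: rz' => [rz'|->]; last first.
    by rewrite conjg1; apply: root_gen_root Pde rz.
  have -> : z ^ z' = z * [~ z, z'] by rewrite commgEl mulKVg.
  exact: root_gen_mul (root_gen_root Pde rz) (comm _ _ _ _ Pde rz rz').
exists (z * z'), t'; split=> //; first by rewrite mulgA.
left; case: rz' => [|->]; first exact: rootM.
by rewrite mulg1.
Qed.
End Generated.
(** * Weights and the commutator formula *)

(** With e_0, e_1, ... at heights 1, 2, ... and their partners at the opposite
heights, a root has nonzero weight, and the roots of weight at least 1 form a
positive system: f_0 and e_1 define a simple root, which belongs to sigma. *)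
Definition rk (a : Pt) : int := (if a.2 then - (a.1.+1%:Z) else a.1.+1%:Z)%R.
Definition wt a b : int := (rk a + rk b)%R.
Definition weight_ge (h : int) a b : Prop := (h <= wt a b)%R.

Lemma rk_opp a : rk (opp_point a) = (- rk a)%R.
Proof. by case: a => i []; rewrite /rk /= ?opprK. Qed.

Lemma rk_inj a b : rk a = rk b -> a = b.
Proof.
case: a b => [i e] [j e']; rewrite /rk /=; case: e; case: e' => // E;
  try lia; congr pair; apply: val_inj => /=; lia.
Qed.

Lemma same_index a b : a.1 = b.1 -> b = a \/ b = opp_point a.
Proof.
case: a b => [i e] [j e'] /= <-; rewrite /opp_point /=.
by case: e; case: e'; [left|right|right|left].
Qed.

Lemma opp_wt0 a : wt a (opp_point a) = 0%R.
Proof. by rewrite /wt rk_opp addrN. Qed.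

Lemma wtC a b : wt a b = wt b a. Proof. exact: addrC. Qed.

Lemma comm1_gen Psi x y : commute x y -> root_gen Psi [~ x, y].
Proof. by move=> /commgP/eqP->; apply: root_gen1. Qed.

Lemma comm_gen_sym Psi x y : root_gen Psi [~ y, x] -> root_gen Psi [~ x, y].
Proof. by move=> yx; rewrite -invgR; apply: root_gen_inv. Qed.

Lemma short_long_weight a b d x y : short_root a b x -> long_root d y ->
  (0 < wt a b)%R -> (0 < wt d d)%R ->
  root_gen (weight_ge (wt a b + wt d d)%R) [~ x, y].
Proof.
move=> rx ry w1 w2; have ab := short_root_neq rx.
wlog da : a b rx w1 ab / d.1 != a.1 => [wl|].
  have [da|] := eqVneq d.1 a.1; last exact: wl.
  rewrite (wtC a) in w1 *; apply: (wl b a (short_rootC rx) w1).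
    by rewrite eq_sym.
  by rewrite da.
have [db|db] := eqVneq d.1 b.1; last first.
  apply/comm1_gen/(short_long_commute _ rx ry).
  by rewrite /= !inE negb_or ab eq_sym da eq_sym db.
case: (same_index (esym db)) => dE; rewrite dE in ry w2 *.
  exact/comm1_gen/(short_long_commute1 (short_rootC rx) ry).
have [z [z' [-> rz rz']]] := short_long_comm rx ry.
apply: root_gen_mul.
  apply: (@root_gen_root _ a (opp_point b)).
    by rewrite /weight_ge /wt !rk_opp; lia.
  by rewrite /root ifN //; apply: contraNneq ab => ->.
apply: (@root_gen_root _ a a); last by rewrite /root eqxx.
by rewrite /weight_ge /wt !rk_opp; move: w1 w2; rewrite /wt !rk_opp; lia.
Qed.

Lemma short_share_weight a b d e x y : short_root a b x -> short_root d e y ->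
  d.1 = a.1 -> e.1 != b.1 -> (0 < wt a b)%R -> (0 < wt d e)%R ->
  root_gen (weight_ge (wt a b + wt d e)%R) [~ x, y].
Proof.
move=> rx ry da eb w1 w2; have ab := short_root_neq rx.
have de := short_root_neq ry; rewrite da in de.
have u3 : uniq [:: b.1; a.1; e.1].
  by rewrite /= !inE negb_or eq_sym ab eq_sym eb de.
case: (same_index (esym da)) => dE; rewrite dE in ry w2 *.
  apply/comm1_gen/(short_share_commute _ rx ry).
  by rewrite /= !inE negb_or ab de eq_sym eb.
have rz := short_short_comm u3 (short_rootC rx) ry.
apply: (@root_gen_root _ b e); first by rewrite /weight_ge /wt !rk_opp; lia.
by rewrite /root ifN //; apply: contraNneq eb => ->.
Qed.

Lemma short_same_weight a b d e x y : short_root a b x -> short_root d e y ->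
  d.1 = a.1 -> e.1 = b.1 -> (0 < wt a b)%R -> (0 < wt d e)%R ->
  root_gen (weight_ge (wt a b + wt d e)%R) [~ x, y].
Proof.
move=> rx ry da eb w1 w2; have ab := short_root_neq rx.
case: (same_index (esym da)) => dE; case: (same_index (esym eb)) => eE;
  rewrite dE eE in ry w2 *.
- exact/comm1_gen/(short_commute rx ry).
- apply: (@root_gen_root _ a a); first by rewrite /weight_ge /wt !rk_opp; lia.
  by rewrite /root eqxx; apply: short_long_comm_result rx ry.
- apply: (@root_gen_root _ b b); first by rewrite /weight_ge /wt !rk_opp; lia.
  rewrite /root eqxx.
  exact: short_long_comm_result (short_rootC rx) (short_rootC ry).
by move: w1 w2; rewrite /wt !rk_opp; lia.
Qed.

Lemma short_short_weight a b d e x y : short_root a b x -> short_root d e y ->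
  (0 < wt a b)%R -> (0 < wt d e)%R ->
  root_gen (weight_ge (wt a b + wt d e)%R) [~ x, y].
Proof.
move=> rx ry w1 w2; have ab := short_root_neq rx; have de := short_root_neq ry.
have rx' := short_rootC rx; have ry' := short_rootC ry.
have [da|da] := eqVneq d.1 a.1.
  have [eb|eb] := eqVneq e.1 b.1; first exact: short_same_weight.
  exact: short_share_weight.
have [ea|ea] := eqVneq e.1 a.1.
  rewrite (wtC d) in w2 *; have [db|db] := eqVneq d.1 b.1.
    exact: short_same_weight.
  exact: short_share_weight.
have [db|db] := eqVneq d.1 b.1.
  by rewrite (wtC a) in w1 *; apply: short_share_weight.
have [eb|eb] := eqVneq e.1 b.1.
  by rewrite (wtC a) (wtC d) in w1 w2 *; apply: short_share_weight.
apply/comm1_gen/(short_disjoint_commute _ rx ry).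
by rewrite /= !inE !negb_or ab de (eq_sym a.1) da (eq_sym a.1) ea
  (eq_sym b.1) db (eq_sym b.1) eb.
Qed.

(** The commutator formulas, gathered by weight.  The roots that arise are
sums of positive multiples of the two given ones, so they weigh at least as much
as the sum of the two. *)
Lemma comm_weight a b d e x y : root a b x -> root d e y ->
  (0 < wt a b)%R -> (0 < wt d e)%R ->
  root_gen (weight_ge (wt a b + wt d e)%R) [~ x, y].
Proof.
rewrite /root; case: eqP => [<-|_]; case: eqP => [<-|_] rx ry w1 w2.
- have [ad|ad] := eqVneq a.1 d.1.
    case: (same_index ad) => dE; rewrite dE in ry w2 *.
      exact/comm1_gen/(long_commute rx ry).
    by move: w1 w2; rewrite /wt !rk_opp; lia.
  exact/comm1_gen/(long_long_commute ad rx ry).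
- by rewrite addrC; apply/comm_gen_sym/short_long_weight.
- exact: short_long_weight.
exact: short_short_weight.
Qed.

(** * The matrices of products of root elements *)

Definition entry (M : Sp p n) a b : 'F_p := ((bv a ** M) 0 (pt b))%R.

Lemma entry1 a b : entry 1 a b = (a == b)%:R%R.
Proof. by rewrite /entry spact1 bvE. Qed.

Lemma entryM M N a b :
  entry (M * N) a b = (\sum_x entry M a (qt x) * entry N (qt x) b)%R.
Proof.
rewrite /entry spactM [in LHS](rV_decomp (bv a ** M)%R).
rewrite sum_point /=.
have E (I : Type) (r : seq I) (F : I -> 'rV['F_p]_(n + n)) :
    ((\sum_(i <- r) F i) ** N = \sum_(i <- r) (F i ** N))%R.
  elim: r => [|i r IHr]; first by rewrite !big_nil spact0l.
  by rewrite !big_cons spactDl IHr.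
rewrite E summxE; apply: eq_bigr => i _.
by rewrite spactDl !spactZl !ptK !mxE.
Qed.

(** The shape of the matrices of products of root elements of weight at least h. *)
Definition level (h : int) (M : Sp p n) :=
  forall a b, (rk b - rk a < h)%R -> entry M a b = (a == b)%:R%R.

(** In the product, the terms with both factors off the diagonal sit at distance at
least 2h. *)
Lemma level_entryM (h : int) M N a b : (0 < h)%R -> level h M -> level h N ->
  (rk b - rk a <= h)%R ->
  entry (M * N) a b = (entry M a b + entry N a b - (a == b)%:R)%R.
Proof.
move=> h_gt0 lM lN ab; rewrite entryM.
have pick (F : 'I_(n + n) -> 'F_p) d :
    (\sum_x (d == qt x)%:R * F x = F (pt d))%R.
  rewrite (bigD1 (pt d)) //= big1 ?addr0 => [|x xd].
    by rewrite ptK eqxx mul1r.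
  suff /negPf-> : d != qt x by rewrite mul0r.
  by apply: contraNneq xd => ->; rewrite qtK.
have -> : (\sum_x entry M a (qt x) * entry N (qt x) b =
    \sum_x (a == qt x)%:R * entry N (qt x) b +
    \sum_x (b == qt x)%:R * (entry M a (qt x) - (a == qt x)%:R))%R.
  rewrite -big_split /=; apply: eq_bigr => x _.
  have [lt_h|ge_h] := boolP (rk (qt x) - rk a < h)%R.
    by rewrite (lM _ _ lt_h) subrr mulr0 addr0.
  have lt_h : (rk b - rk (qt x) < h)%R by move: ab ge_h h_gt0; lia.
  by rewrite (lN _ _ lt_h) [b == _]eq_sym; ring.
by rewrite !pick !ptK; ring.
Qed.

Lemma levelM (h : int) M N : (0 < h)%R -> level h M -> level h N -> level h (M * N).
Proof.
move=> h_gt0 lM lN a b ab; rewrite (level_entryM h_gt0 lM lN); last by move: ab; lia.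
by rewrite lM // lN //; ring.
Qed.

(** The matrix of a root element is a transvection or bitransvection with a
coefficient c whose vanishing makes the element trivial, because tau and sigma
have order p. *)
Lemma root_phi a b x : root a b x -> exists c : 'F_p, (c = 0%R -> x = 1) /\
  forall d, (bv d ** phi x = bv d + c *: (sform (bv d) (bv a) *: bv b +
    (if a == b then 0 else sform (bv d) (bv b)) *: bv a))%R.
Proof.
have nat0 k (y : G) : y ^+ p = 1 -> (k%:R = 0 :> 'F_p)%R -> y ^+ k = 1.
  by move=> yp k0; rewrite -(pw_nat p_prime k yp) k0.
rewrite /root; case: eqP => [<-|_] [w [k]].
  move=> [_ [c1 c10 wa] ->]; exists (k%:R * c1 ^+ 2)%R; split=> [/eqP|d].
    rewrite mulf_eq0 sqrf_eq0 (negPf c10) orbF => /eqP k0.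
    by rewrite nat0 ?conj1g // tau_order.
  rewrite gmulfJ gmulfXn phi_mu sp_block_transvection transvX transvJ wa transvZ.
  by rewrite transvE /tv mulr1 scale0r addr0 scalerA.
move=> [_ [c1 c10 wa] [c2 c20 wb] ->]; exists (k%:R * (c1 * c2))%R; split=> [/eqP|d].
  rewrite !mulf_eq0 (negPf c10) (negPf c20) !orbF => /eqP k0.
  by rewrite nat0 ?conj1g // (rel_sig_order rels).
have s0 : sform (bv f0) (bv e1) = 0%R by rewrite sform_bv.
rewrite gmulfJ gmulfXn phi_sigma /sp_sigma bitransvX // bitransvJ spactZl wa wb.
have ab : sform (c1 *: bv a)%R (k%:R *: (c2 *: bv b))%R = 0%R.
  by rewrite sformZr -[in LHS]wa -[in LHS]wb sform_act s0 mulr0.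
rewrite (bitransvE _ ab) /btv !sformZr -addrA; congr (_ + _)%R.
rewrite scalerDr !scalerA; congr (_ *: _ + _ *: _)%R; ring.
Qed.

Lemma sform_neq0 a b : sform (bv a) (bv b) != 0%R -> b = opp_point a.
Proof. by rewrite sform_bv; case: (b =P _) => // _ /eqP. Qed.

Lemma coord_transv d b a e (c k l : 'F_p) :
  ((bv d + c *: (k *: bv b + l *: bv a)) 0 (pt e) =
    (d == e)%:R + c * (k * (b == e)%:R + l * (a == e)%:R))%R.
Proof.
have addE (u w : 'rV['F_p]_(n + n)) : ((u + w) 0 (pt e) = u 0 (pt e) + w 0 (pt e))%R.
  by rewrite mxE.
have scaleE q (w : 'rV['F_p]_(n + n)) : ((q *: w) 0 (pt e) = q * w 0 (pt e))%R.
  by rewrite mxE.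
by rewrite addE scaleE addE !scaleE !bvE.
Qed.

Lemma root_level a b x : (0 < wt a b)%R -> root a b x -> level (wt a b) (phi x).
Proof.
move=> w_gt0 /root_phi[c [_ xE]] d e de; rewrite /entry xE coord_transv.
have z1 : (sform (bv d) (bv a) * (b == e)%:R = 0 :> 'F_p)%R.
  apply/eqP; rewrite mulf_eq0 -implyNb; apply/implyP => /sform_neq0 aE.
  case: (b =P e) => [bE|_]; last by rewrite eqxx.
  move: de; rewrite -bE aE /wt rk_opp; lia.
have z2 : (sform (bv d) (bv b) * (a == e)%:R = 0 :> 'F_p)%R.
  apply/eqP; rewrite mulf_eq0 -implyNb; apply/implyP => /sform_neq0 bE.
  case: (a =P e) => [aE|_]; last by rewrite eqxx.
  move: de; rewrite -aE bE /wt rk_opp; lia.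
by rewrite z1 add0r; case: (a =P b) => _; rewrite ?z2 ?mul0r mulr0 addr0.
Qed.

(** The position in row -a and column b is touched by the root {a, b} alone. *)
Lemma root_entry0 a b d e x : (0 < wt a b)%R -> root d e x ->
  ~ (d = a /\ e = b) -> ~ (d = b /\ e = a) -> entry (phi x) (opp_point a) b = 0%R.
Proof.
move=> w_gt0 /root_phi[c [_ xE]] n1 n2; rewrite /entry xE.
have ab : (opp_point a == b) = false.
  by apply/eqP => ab; move: w_gt0; rewrite -ab /wt rk_opp; lia.
rewrite coord_transv ab add0r.
have z1 : (sform (bv (opp_point a)) (bv d) * (e == b)%:R = 0 :> 'F_p)%R.
  apply/eqP; rewrite mulf_eq0 -implyNb; apply/implyP => /sform_neq0.
  by rewrite opp_pointK => da; case: (e =P b) => [eb|_]; [case: n1|rewrite eqxx].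
have z2 : (sform (bv (opp_point a)) (bv e) * (d == b)%:R = 0 :> 'F_p)%R.
  apply/eqP; rewrite mulf_eq0 -implyNb; apply/implyP => /sform_neq0.
  by rewrite opp_pointK => ea; case: (d =P b) => [db|_]; [case: n2|rewrite eqxx].
by rewrite z1 add0r; case: (d =P e) => _; rewrite ?z2 ?mul0r mulr0.
Qed.

Lemma root_entry_eq0 a b x : (0 < wt a b)%R -> root a b x ->
  entry (phi x) (opp_point a) b = 0%R -> x = 1.
Proof.
move=> w_gt0 /root_phi[c [c0 xE]]; rewrite /entry xE.
have ab : (opp_point a == b) = false.
  by apply/eqP => ab; move: w_gt0; rewrite -ab /wt rk_opp; lia.
rewrite coord_transv ab add0r eqxx mulr1.
have -> : ((if a == b then 0 else sform (bv (opp_point a)) (bv b)) *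
    (a == b)%:R = 0 :> 'F_p)%R by case: eqP; rewrite ?mulr0 ?mul0r.
rewrite addr0 sform_bv opp_pointK eqxx => /eqP; rewrite mulf_eq0.
by rewrite (negPf (sgn_neq0 _)) orbF => /eqP.
Qed.

Lemma root_gen_level (h : int) Psi x : (0 < h)%R ->
  (forall a b, Psi a b -> weight_ge h a b) -> root_gen Psi x -> level h (phi x).
Proof.
move=> h_gt0 Psi_h; elim=> [|a b z t Pab rz _ IH].
  by rewrite gmulf1 => a b _; rewrite entry1.
rewrite gmulfM; apply: levelM => //; have hw := Psi_h _ _ Pab.
have w_gt0 : (0 < wt a b)%R by move: hw; rewrite /weight_ge; lia.
move=> d e de; apply: (root_level w_gt0 rz).
by move: hw; rewrite /weight_ge; lia.
Qed.

Lemma root_gen_entry0 Psi a b x : (0 < wt a b)%R ->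
  (forall d e, Psi d e -> weight_ge (wt a b) d e) -> ~ Psi a b -> ~ Psi b a ->
  root_gen Psi x -> entry (phi x) (opp_point a) b = 0%R.
Proof.
move=> w_gt0 Psi_h n1 n2.
have ab : (opp_point a == b) = false.
  by apply/eqP => ab; move: w_gt0; rewrite -ab /wt rk_opp; lia.
elim=> [|d e z t Pde rz gt_ IH]; first by rewrite gmulf1 entry1 ab.
rewrite gmulfM (level_entryM w_gt0) ?IH ?ab.
- rewrite (root_entry0 w_gt0 rz) ?subr0 ?addr0 // => -[dE eE]; subst d e.
    by case: n1.
  by case: n2.
- have hw := Psi_h _ _ Pde; have dw : (0 < wt d e)%R.
    by move: hw w_gt0; rewrite /weight_ge; lia.
  by move=> d' e' de'; apply: (root_level dw rz); move: hw de'; rewrite /weight_ge; lia.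
- exact: root_gen_level w_gt0 Psi_h gt_.
by rewrite rk_opp /wt; lia.
Qed.

(** * The positive root group embeds *)

Lemma weight_bound a b : (wt a b <= 2 * Posz n)%R.
Proof.
rewrite /wt /rk; case: a b => [i e] [j e'] /=.
by have := ltn_ord i; have := ltn_ord j; case: e; case: e'; lia.
Qed.

(** Induction on the number of weights from h upwards, and for each weight on
the roots r of that weight still allowed to occur.  Splitting off the root (a, b)
gives x = z y with z in its root group; the entry of the matrix at (-a, b) is that
of z alone, so it vanishes and z = 1. *)
Lemma positive_inj (h : int) x : (0 < h)%R -> root_gen (weight_ge h) x ->
  phi x = 1 -> x = 1.
Proof.
have [m] := ubnP (absz (2 * Posz n + 1 - h)%R); elim: m h x => // m IHm h x lt_m h_gt0 gx x1.
have [h_big|h_small] := boolP (2 * Posz n < h)%R.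
  elim: gx => // a b z t ab _ _ _.
  by have := weight_bound a b; move: ab; rewrite /weight_ge; lia.
pose Psi (r : seq (Pt * Pt)) a b :=
  weight_ge (h + 1)%R a b \/ wt a b = h /\ (a, b) \in r.
have Psi_h r a b : Psi r a b -> weight_ge h a b.
  by rewrite /Psi /weight_ge => -[|[]]; lia.
have {gx} : root_gen (Psi (enum {: Pt * Pt})) x.
  apply: root_gen_sub gx => a b; rewrite /Psi /weight_ge mem_enum inE.
  by move=> ab; have [E|E] := eqVneq (wt a b) h; [right|left; lia].
elim: (enum _) x x1 => [|[a b] r IHr] x x1 gx.
  apply: (IHm (h + 1)%R) => //; try lia.
  by apply: root_gen_sub gx => a b [|[]].
have subr z : (forall d e y, Psi ((a, b) :: r) d e -> root d e y ->
    root_gen (Psi r) y) -> root_gen (Psi ((a, b) :: r)) z -> root_gen (Psi r) z.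
  move=> Hr; elim=> [|d e y t Pde ry _ IH]; first exact: root_gen1.
  exact: root_gen_mul (Hr _ _ _ Pde ry) IH.
have mono : (forall y, wt a b = h -> root a b y -> root_gen (Psi r) y) -> x = 1.
  move=> Hab; apply: (IHr) => //; apply: subr gx => d e y.
  rewrite /Psi in_cons => -[wde|[wde /orP[/eqP[dE eE]|der]]] ry.
  - by apply: root_gen_root ry; left.
  - by subst d e; apply: Hab.
  by apply: root_gen_root ry; right.
have [wab|wab] := eqVneq (wt a b) h; last by apply: mono => y /eqP; rewrite (negPf wab).
have [abr|abr] := boolP ((a, b) \in r).
  by apply: mono => y _ ry; apply: root_gen_root ry; right.
have [bar|bar] := boolP ((b, a) \in r).
  apply: mono => y _ ry; apply: root_gen_root (rootC ry); right.
  by rewrite wtC.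
have w_gt0 : (0 < wt a b)%R by rewrite wab.
have [||z [y [xE rz gy]]] := @root_gen_split (Psi r) a b x.
- move=> d e y z Pde ry rz; have := Psi_h _ _ _ Pde => hde.
  have wde : (0 < wt d e)%R by move: hde; rewrite /weight_ge; lia.
  apply: root_gen_sub (comm_weight ry rz wde w_gt0) => d' e'.
  by rewrite /Psi /weight_ge; left; move: hde; rewrite /weight_ge; lia.
- apply: root_gen_sub gx => d e; rewrite /Psi in_cons.
  by move=> [|[wde /orP[/eqP[-> ->]|]]]; [left; left|right|left; right].
have z1 : z = 1.
  case: rz => // rz; apply: (root_entry_eq0 w_gt0 rz).
  have y0 : entry (phi y) (opp_point a) b = 0%R.
    apply: (root_gen_entry0 w_gt0 _ _ _ gy) => [d e /Psi_h||]; first by rewrite wab.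
      by rewrite /Psi /weight_ge => -[|[_]]; [lia|exact/negP].
    by rewrite /Psi /weight_ge wtC => -[|[_]]; [lia|exact/negP].
  have ab : (opp_point a == b) = false.
    by apply/eqP => ab; move: w_gt0; rewrite -ab /wt rk_opp; lia.
  have := entry1 (opp_point a) b; rewrite -x1 xE gmulfM (level_entryM w_gt0).
  - by rewrite y0 ab addr0 subr0.
  - exact: root_level.
  - by rewrite wab; apply: root_gen_level gy => // d e /Psi_h.
  by rewrite rk_opp /wt; lia.
by apply: IHr => //; rewrite xE z1 mul1g.
Qed.

(** * Bruhat decomposition *)

Local Notation Upos := (root_gen (weight_ge 1%R)).

(** In SL(2,p), an upper unitriangular matrix with entry k is
lower * antidiagonal * lower, where both lower factors have entry 1/k. *)
Lemma tau_weyl_word k : (k%:R != 0 :> 'F_p)%R -> exists l g,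
  [/\ val g 0%R 0%R = 0%R :> 'F_p, val g 1%R 1%R = 0%R :> 'F_p &
      tau ^+ k = (tau ^+ l) ^ Z * mu g * (tau ^+ l) ^ Z].
Proof.
move=> k0; pose q : 'F_p := k%:R%R; exists (- q^-1 : 'F_p)%R.
have det : (0 * 0 - q * - q^-1 = 1 :> 'F_p)%R by rewrite (mul0r 0%R) mulrN opprK add0r (mulfV k0).
have det' : (1 * 1 - 0 * q^-1 = 1 :> 'F_p)%R by rewrite mul0r subr0 mulr1.
exists (sl2 det); split; [by rewrite mxE..|].
have -> : (tau ^+ (- q^-1 : 'F_p)%R) ^ Z = mu (sl2 det').
  rewrite -gmulfXn -gmulfJ; congr (mu _); apply: (mulgI W); rewrite -conjgC.
  apply: SL2_eq; rewrite [LHS]SL2_valM [RHS]SL2_valM upperX natr_Zp !mx2_mul.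
  by congr mx2; ring.
rewrite -gmulfXn -!gmulfM; congr (mu _); apply: SL2_eq.
rewrite upperX -/q [RHS]SL2_valM (SL2_valM (sl2 det')) !mx2_mul.
by congr mx2; field.
Qed.

Lemma monomialJ x y : monomial x -> monomial y -> monomial (x ^ y).
Proof.
by move=> Mx My; apply: monomialM (monomialV My) _; apply: monomialM.
Qed.

Lemma root_sigma : root f0 e1 sigma.
Proof.
rewrite /root; have -> : (f0 == e1) = false by [].
by exists 1, 1%N; split; [exact: monomial1|exact: maps1..|rewrite conjg1].
Qed.

(** The relation U' = sigma * sigma^U' * sigma, solved for sigma and conjugated
by the inverse of U'. *)
Lemma sigma_weyl_word : exists y w, [/\ root (i1, true) (i0, false) y, monomial w &
  sigma = y * w * y].
Proof.
pose u' : G := if odd p then U * Z ^+ 2 else U.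
have Mu : monomial u'.
  have MU : monomial U := monomial_rho u01.
  have MZ : monomial Z by rewrite mu_0; apply: monomial_weyl.
  by rewrite /u'; case: ifP => // _; rewrite expg2; do 2!apply: monomialM => //.
have uf : maps u' f0 (i1, true) /\ maps u' e1 (i0, false).
  have U0 : maps U f0 (i1, true).
    by have := maps_rho u01 f0; rewrite /act_pt /= tpermL.
  have U1 : maps U e1 (i0, false).
    by have := maps_rho u01 e1; rewrite /act_pt /= tpermR.
  rewrite /u'; case: ifP => // _; rewrite expg2 mulgA.
  have Zm a : maps Z a (flip_pt i0 a) by rewrite mu_0; apply: maps_weyl.
  split; first exact: mapsM (mapsM U0 (Zm (i1, true))) (Zm (i1, true)).
  exact: mapsM (mapsM U1 (Zm (i0, false))) (Zm (i0, true)).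
have uf' : maps u'^-1 f0 (i1, true) /\ maps u'^-1 e1 (i0, false).
  have /= o1 := maps_opp Mu uf.1; have /= o2 := maps_opp Mu uf.2.
  by split; apply: mapsV.
exists (sigma^-1 ^ u'^-1), u'; split=> //.
  exact: (rootJ (monomialV Mu) uf'.1 uf'.2) (rootV root_sigma).
have := rel_sig_weyl rels; rewrite -/u' => uE.
have uE' : sigma^-1 * u' * sigma^-1 = sigma ^ u' by rewrite {1}uE -!mulgA mulKg mulgV mulg1.
apply: (conjg_inj u'); rewrite -uE' (conjMg (_ * u')) (conjMg (sigma^-1 ^ u'^-1)).
by rewrite conjgKV conjgE mulKg.
Qed.

(** A long root element is a conjugate of some tau^k.  A nontrivial power of
sigma is a conjugate of sigma by a diagonal element, so the case of sigma
suffices for short roots. *)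
Lemma rank_one a b x : root a b x -> x = 1 \/ exists y w y',
  [/\ root (opp_point a) (opp_point b) y, monomial w,
      root (opp_point a) (opp_point b) y' & x = y * w * y'].
Proof.
have nat0 k (y : G) : y ^+ p = 1 -> (k%:R = 0 :> 'F_p)%R -> y ^+ k = 1.
  by move=> yp k0; rewrite -(pw_nat p_prime k yp) k0.
have MZ : monomial Z by rewrite mu_0; apply: monomial_weyl.
rewrite {1}/root; case: eqP => [<-|ab] [w [k]] [Mw wa].
  move=> ->; have [k0|k0] := eqVneq (k%:R : 'F_p)%R 0%R.
    by left; rewrite nat0 ?conj1g // tau_order.
  right; have [l [g [g0 g1 E]]] := tau_weyl_word k0.
  have Zf : maps Z f0 (i0, false).
    by have := maps_weyl i0 f0; rewrite -mu_0.
  exists (((tau ^+ l) ^ Z) ^ w), (mu g ^ w), (((tau ^+ l) ^ Z) ^ w).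
  have ry : root (opp_point a) (opp_point a) (((tau ^+ l) ^ Z) ^ w).
    rewrite /root eqxx; exists (Z * w), l; split; first exact: monomialM.
      by apply: mapsM Zf _; have := maps_opp Mw wa.
    by rewrite (conjgM _ Z).
  split=> //; last by rewrite E (conjMg _ _ w) (conjMg _ (mu g) w).
  apply: monomialJ => //.
  have -> : mu g = Z * mu (W^-1 * g) by rewrite -gmulfM mulKVg.
  apply: monomialM => //; rewrite mu_0; apply: monomial_diag.
    have := SL2_mulE W (W^-1 * g) 1%R 1%R; rewrite mulKVg g1 !mxE /= mul0r addr0.
    by move/esym/eqP; rewrite mulN1r oppr_eq0 => /eqP.
  have := SL2_mulE W (W^-1 * g) 0%R 0%R; rewrite mulKVg g0 !mxE /= mul0r add0r mul1r.
  by move=> <-.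
move=> wb ->; have [k0|k0] := eqVneq (k%:R : 'F_p)%R 0%R.
  by left; rewrite nat0 ?conj1g // (rel_sig_order rels).
right; pose q : 'F_p := k%:R%R.
have det : (q * q^-1 - 0 * 0 = 1 :> 'F_p)%R by rewrite mul0r subr0 mulfV.
have := @sig_diag1 (sl2 det); rewrite !mxE /= => /(_ erefl).
rewrite (pw_nat p_prime k (rel_sig_order rels)) => <-; set h := mu_ _ _.
have [y [w' [ry Mw' E]]] := sigma_weyl_word.
have Mh : monomial h by apply: monomial_diag; rewrite mxE.
have Mhw : monomial (h * w) by apply: monomialM.
have hf c : maps h c c by apply: maps_diag; rewrite mxE.
have ha : maps (h * w) f0 a by apply: mapsM (hf _) wa.
have hb : maps (h * w) e1 b by apply: mapsM (hf _) wb.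
have ry' : root (opp_point a) (opp_point b) (y ^ (h * w)).
  apply: rootC; apply: (rootJ Mhw _ _ ry); first by have := maps_opp Mhw hb.
  by have := maps_opp Mhw ha.
exists (y ^ (h * w)), (w' ^ (h * w)), (y ^ (h * w)); split=> //.
  exact: monomialJ.
by rewrite -conjgM {1}E (conjMg _ y) (conjMg y).
Qed.

Definition bruhat x := exists u w u',
  [/\ Upos u, monomial w, Upos u' & x = u * w * u'].

(** The element m stands for the reflection in the simple root {a, b}: it makes no
other positive root negative.  Write x = u w z y with z in the root group of
{a, b}; then y can be moved across m.  If w keeps the root positive then z can be
moved to the left of w; otherwise z is replaced by its rank one expression, whose
first factor can be moved to the left of w and whose last factor becomes positive
after m. *)
Lemma bruhat_reflection a b m (f : Pt -> Pt) : monomial m ->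
  (forall d, maps m d (f d)) -> (0 < wt a b)%R ->
  f (opp_point a) = b -> f (opp_point b) = a ->
  (forall d e, (0 < wt d e)%R -> ~ (d = a /\ e = b) -> ~ (d = b /\ e = a) ->
     (0 < wt (f d) (f e))%R) ->
  forall x, bruhat x -> bruhat (x * m).
Proof.
move=> Mm mf w_gt0 fa fb fpos _ [u [w [u' [Uu Mw Uu' ->]]]].
pose Psi d e := [/\ (0 < wt d e)%R, ~ (d = a /\ e = b) & ~ (d = b /\ e = a)].
have pos1 d e : (0 < wt d e)%R -> weight_ge 1%R d e by rewrite /weight_ge; lia.
have [||z [y [u'E rz gy]]] := @root_gen_split Psi a b u'.
- move=> d e y z [de _ _] ry rz.
  apply: root_gen_sub (comm_weight ry rz de w_gt0) => d' e'.
  rewrite /weight_ge => ge; split; first by move: ge de w_gt0; lia.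
    by move=> [E1 E2]; move: ge de; rewrite E1 E2; lia.
  by move=> [E1 E2]; move: ge de; rewrite E1 E2 (wtC b); lia.
- elim: Uu' => [|d e y t de ry _ IH]; first exact: root_gen1.
  have de' : (0 < wt d e)%R by move: de; rewrite /weight_ge; lia.
  apply: root_gen_mul IH; have [dE|n1] := pselect (d = a /\ e = b).
    by apply: root_gen_root ry; right.
  have [[dE eE]|n2] := pselect (d = b /\ e = a).
    by rewrite dE eE in ry; apply: root_gen_root (rootC ry); right.
  by apply: root_gen_root ry; left.
have Uy : Upos (y ^ m).
  apply: root_genJ gy => d e t [de n1 n2] rt.
  apply: (root_gen_root (a := f d) (b := f e)); first exact/pos1/fpos.
  exact: rootJ Mm (mf d) (mf e) rt.
have simple : bruhat (u * w * y * m).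
  exists u, (w * m), (y ^ m); split=> //; first exact: monomialM.
  by rewrite -!mulgA -conjgC.
rewrite u'E; case: rz => [rz|->]; last by rewrite mul1g.
have [->|[y1 [w1 [y2 [ry1 Mw1 ry2 zE]]]]] := rank_one rz; first by rewrite mul1g.
have [_ _ wb] := Mw; have {wb}[[a' wa] [b' wb]] := (wb a, wb b).
have Mw' := monomialV Mw.
have [pos|npos] := boolP (0 < wt a' b')%R.
  have rz' := rootJ Mw' (mapsV wa) (mapsV wb) rz.
  exists (u * z ^ w^-1), (w * m), (y ^ m); split=> //; last first.
  - by rewrite conjgE invgK -!mulgA !mulKg -conjgC.
  - exact: monomialM.
  by apply: root_gen_mul => //; apply: root_gen_root rz'; apply: pos1.
have neg : (0 < wt (opp_point a') (opp_point b'))%R.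
  have [E|] := eqVneq (wt a' b') 0%R; last by move: npos; rewrite /wt !rk_opp; lia.
  have bE : b' = opp_point a' by apply: rk_inj; rewrite rk_opp; move: E; rewrite /wt; lia.
  have := maps_opp Mw wa; rewrite -bE => /(maps_fun wb) ba.
  by move: w_gt0; rewrite ba opp_wt0.
have ry1' := rootJ Mw' (mapsV (maps_opp Mw wa)) (mapsV (maps_opp Mw wb)) ry1.
have ry2' := rootJ Mm (mf (opp_point a)) (mf (opp_point b)) ry2.
exists (u * y1 ^ w^-1), (w * w1 * m), (y2 ^ m * y ^ m); split.
- by apply: root_gen_mul => //; apply: root_gen_root ry1'; apply: pos1.
- by do 2!apply: monomialM => //.
- apply: root_gen_mul => //; rewrite fa fb in ry2'.
  by apply: root_gen_root ry2'; apply: pos1; rewrite wtC.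
have E1 : y1 ^ w^-1 * w = w * y1 by rewrite -conjgCV.
have E2 : m * (y2 ^ m * y ^ m) = y2 * y * m by rewrite -conjMg -conjgC.
transitivity (u * (y1 ^ w^-1 * w) * w1 * (m * (y2 ^ m * y ^ m))).
  by rewrite E1 E2 zE !mulgA.
by move: (y1 ^ _) (y2 ^ _) (y ^ _) => z1 z2 z3; rewrite !mulgA.
Qed.

Lemma bruhat_pos x y : Upos y -> bruhat x -> bruhat (x * y).
Proof.
move=> Uy [u [w [u' [Uu Mw Uu' ->]]]]; exists u, w, (u' * y); split=> //.
  exact: root_gen_mul.
by rewrite !mulgA.
Qed.

(** Z and its inverse induce the reflection in the simple long root 2 e_0. *)
Lemma bruhat_weyl m x : monomial m -> (forall d, maps m d (flip_pt i0 d)) ->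
  bruhat x -> bruhat (x * m).
Proof.
move=> Mm mf; apply: (@bruhat_reflection (i0, false) (i0, false) _ (flip_pt i0)) => //.
case=> [i e] [j e'] /= w_gt0 n1 _.
have m1 : ~ ((i : nat) = 0%N /\ e = false /\ (j : nat) = 0%N /\ e' = false).
  by move=> [i_ [e_ [j_ e'_]]]; apply: n1; rewrite e_ e'_; split; congr pair; apply: val_inj.
have E (k : 'I_n) : (k == i0) = ((k : nat) == 0%N) by rewrite -val_eqE.
move: w_gt0 m1; rewrite /flip_pt /wt /rk /= !E; clear.
case: e; case: e'; case: eqP; case: eqP => /=; lia.
Qed.

(** An adjacent transposition is the reflection in the simple short root made of
f_i and e_j. *)
Lemma bruhat_swap (i j : 'I_n) x : j = i.+1 :> nat -> bruhat x ->
  bruhat (x * rho (tperm i j)).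
Proof.
move=> ji; apply: (@bruhat_reflection (i, true) (j, false) _ (act_pt (tperm i j))).
- exact: monomial_rho.
- exact: maps_rho.
- by rewrite /wt /rk /=; lia.
- by rewrite /act_pt /= tpermL.
- by rewrite /act_pt /= tpermR.
case=> [k e] [l e'] /= w_gt0 n1 n2; rewrite /act_pt /=.
have E (k' : 'I_n) : (tperm i j k' : nat) =
    if (k' : nat) == i then i.+1 else if (k' : nat) == i.+1 then i : nat else k'.
  rewrite -ji; case: tpermP => [->|->|/eqP k1 /eqP k2]; rewrite ?eqxx //.
    by rewrite ji; case: eqP => //; lia.
  by rewrite !val_eqE (negPf k1) (negPf k2).
have m1 : ~ ((k : nat) = i /\ e = true /\ (l : nat) = i.+1 /\ e' = false).
  by move=> [k_ [e_ [l_ e'_]]]; apply: n1; rewrite e_ e'_; split; congr pair; apply: val_inj;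
    rewrite //= l_ ji.
have m2 : ~ ((k : nat) = i.+1 /\ e = false /\ (l : nat) = i /\ e' = true).
  by move=> [k_ [e_ [l_ e'_]]]; apply: n2; rewrite e_ e'_; split; congr pair; apply: val_inj;
    rewrite //= k_ ji.
move: w_gt0 m1 m2; rewrite /wt /rk /= !E; clear.
case: e; case: e'; (do ?case: eqP) => /=; lia.
Qed.

Hypothesis gens : forall Q : G -> Prop, Q 1 ->
  (forall x y, Q x -> Q y -> Q (x * y)) -> Q sigma ->
  (forall g, Q (mu g)) -> (forall s, Q (rho s)) -> forall x, Q x.

(** Right multiplication by tau is handled as Z * tau^Z * Z^-1, since tau itself
is a negative root element and tau^Z a positive one. *)
Lemma bruhat_all x : bruhat x.
Proof.
have MZ : monomial Z by rewrite mu_0; apply: monomial_weyl.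
have Zm a : maps Z a (flip_pt i0 a) by rewrite mu_0; apply: maps_weyl.
have ZVm a : maps Z^-1 a (flip_pt i0 a).
  apply: mapsV; have := Zm (flip_pt i0 a).
  by rewrite {2}/flip_pt /flip_pt; case: ifP => ai; rewrite /= ai ?opp_pointK.
suff closed y : forall z, bruhat z -> bruhat (z * y).
  have := closed x 1; rewrite mul1g; apply.
  by exists 1, 1, 1; split; rewrite ?mulg1 //; [exact: root_gen1|exact: monomial1|exact: root_gen1].
elim/gens: y => [z|y y' Qy Qy' z Bz|z||].
- by rewrite mulg1.
- by rewrite mulgA; apply/Qy'/Qy.
- apply: bruhat_pos; apply: root_gen_root root_sigma.
  by rewrite /weight_ge /wt /rk.
- elim/SL2_gen_ind=> [z|g h Qg Qh z Bz|z Bz|z].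
  + by rewrite gmulf1 mulg1.
  + by rewrite gmulfM mulgA; apply/Qh/Qg.
  + have -> : z * tau = z * Z * (tau ^ Z) * Z^-1.
      by rewrite conjgE -!mulgA mulVKg mulgV mulg1.
    apply: (bruhat_weyl (monomialV MZ) ZVm); apply: bruhat_pos (bruhat_weyl MZ Zm Bz).
    apply: (root_gen_root (a := (i0, false)) (b := (i0, false))).
      by rewrite /weight_ge /wt /rk.
    by rewrite /root eqxx; exists Z, 1%N; split=> //; have := Zm f0.
  exact: bruhat_weyl.
move=> s; apply: (@sym_adjacent_ind n (fun s => forall z, bruhat z -> bruhat (z * rho s)) _ _ 0%N).
- by move=> z; rewrite gmulf1 mulg1.
- by move=> s' t Qs Qt z Bz; rewrite gmulfM mulgA; apply/Qt/Qs.
- by move=> i j _ ji z; apply: bruhat_swap.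
by [].
Qed.

(** The matrix of the monomial part of a kernel element is unitriangular, so the
monomial part is trivial. *)
Lemma phi_inj x : phi x = 1 -> x = 1.
Proof.
move=> x1; have [u [w [u' [Uu Mw Uu' xE]]]] := bruhat_all x.
have lev y : Upos y -> level 1%R (phi y) by apply: root_gen_level.
have wE : w = u^-1 * x * u'^-1 by rewrite xE !mulgA mulVg mul1g mulgK.
have lw : level 1%R (phi w).
  rewrite wE 2!gmulfM x1 mulg1 -gmulfM.
  by apply/lev/root_gen_mul; apply: root_gen_inv.
have w1 : w = 1.
  apply: monomial_eq1 => // a; have [_ /(_ a)[b wa] _] := Mw.
  have aa : entry (phi w) a a = 1%R.
    by rewrite lw ?eqxx // /wt subrr.
  case: wa => q q0 E; move: aa; rewrite /entry E coord_bv.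
  case: (b =P a) => [<-|_]; first by rewrite mulr1 => ->; rewrite scale1r.
  by rewrite mulr0 => /eqP; rewrite eq_sym oner_eq0.
rewrite w1 mulg1 in xE; apply: (positive_inj (h := 1%R)) x1 => //.
by rewrite xE; apply: root_gen_mul.
Qed.

End MonomialGroup.

(** * The presented group *)

Lemma weyl_word_sigma p (T := SL2_transvection p) (W := SL2_weyl p) :
  W = T * T ^ W * T.
Proof.
have det : (1 * 1 - 0 * -1 = 1 :> 'F_p)%R by rewrite GRing.mul0r GRing.subr0 GRing.mulr1.
have -> : T ^ W = sl2 det.
  apply: (mulgI W); rewrite -conjgC; apply: SL2_eq.
  by rewrite [LHS]SL2_valM [RHS]SL2_valM !mx2_mul; congr mx2; ring.
apply: SL2_eq; rewrite [RHS]SL2_valM (SL2_valM T) !mx2_mul.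
by congr mx2; ring.
Qed.

Section PresentedSymplecticGroup.
Variables (p n : nat) (p_prime : prime p) (n_ge2 : (2 <= n)%N).
Variables (RS : set (free_group (sym_letter n))) (RU RZ : set (free_group bool)).
Local Notation T := (SL2_transvection p).
Local Notation W := (SL2_weyl p).
Hypotheses (RS_presents : presents (sym_gen n_ge2) RS)
  (RU_presents : presents (letter_pair T W) RU)
  (RZ_presents : presents (letter_pair T W) RZ).
Local Notation R := (sp_relators p RS RU RZ).
Local Notation G := (presented R).
Local Notation i0 := (Ordinal (ltnW n_ge2)).
Local Notation i1 := (Ordinal n_ge2).
Local Notation u := (tperm i0 i1 : 'S_n).
Local Notation v := (perm (@ordS_inj n) : 'S_n).
Local Notation sigma := (free_gen (LSigma n)).
Local Notation tau := (free_gen (LTau n)).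
Local Notation Z := (free_gen (LZ n)).
Local Notation U := (free_gen (LU n)).
Local Notation V h := (free_gen (LV h)).
Variable pi : ghom (free_group (sp_letter n)) G.
Hypothesis pi_rel : forall r, R r -> pi r = 1.

(** The values of words, as a predicate fit for induction on generators. *)
Lemma free_eval_onto (X : choiceType) (gT : groupType) (g : X -> gT)
    (P : gT -> Prop := fun x => exists w, free_eval g w = x) :
  [/\ P 1, forall x y, P x -> P y -> P (x * y) & forall x, P (g x)].
Proof.
split=> [|x y [w <-] [w' <-]|x]; first by exists 1; apply: free_eval1.
  by exists (w * w'); apply: free_evalM.
by exists (free_gen x); apply: free_eval_gen.
Qed.

Lemma sym_hom : exists rho : ghom 'S_n G, rho u = pi U /\
  forall h : (2 < n)%N, rho v = pi (V h).
Proof.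
have [|r Rr|rho rhoE] := @presents_hom _ _ G _ (fun g => pi (sym_word g)) _ RS_presents.
- by have [P1 PM Pg] := free_eval_onto (sym_gen n_ge2); apply: sym_gen_ind.
- have := pi_rel (rel_sym p RU RZ Rr); rewrite hom_free_eval; exact.
by exists rho; split=> [|h]; [apply: (rhoE (SymU n))|apply: (rhoE (SymV h))].
Qed.

Lemma SL2_hom : exists mu : ghom (SL p 2) G, mu T = pi tau /\ mu W = pi Z.
Proof.
have [|r Rr|mu muE] := @presents_hom _ _ G _ (fun b => pi (letter_pair tau Z b)) _ RZ_presents.
- have [P1 PM Pg] := free_eval_onto (letter_pair T W).
  by apply: SL2_gen_ind => //; [apply: (Pg false)|apply: (Pg true)].
- have := pi_rel (rel_SL_tau_Z p RS RU Rr); rewrite hom_free_eval; exact.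
by exists mu; split; [apply: (muE false)|apply: (muE true)].
Qed.

(** Every relation of SL(2,p) between T and W holds between sigma and U', so the
words needed later are checked on 2 x 2 matrices. *)
Lemma sigma_word (w : free_group bool) : free_eval (letter_pair T W) w = 1 ->
  free_eval (letter_pair (pi sigma) (pi (if odd p then U * Z ^+ 2 else U))) w = 1.
Proof.
apply: presents_eval RU_presents _ => r Rr.
have := pi_rel (rel_SL_sigma_U p RS RZ Rr); rewrite hom_free_eval => <-.
by apply: eq_free_eval => -[].
Qed.

(** The order of sigma and the word for U' are relations between T and W in
SL(2,p); the others are relators. *)
Lemma presented_relations (rho : ghom 'S_n G) (mu : ghom (SL p 2) G) :
  rho u = pi U -> (forall h : (2 < n)%N, rho v = pi (V h)) ->
  mu T = pi tau -> mu W = pi Z -> sp_relations n_ge2 rho mu (pi sigma).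
Proof.
move=> rU rV mT mW.
have divP (x y : G) : x * y^-1 = 1 -> x = y by move=> E; rewrite -[x](mulgVK y) E mul1g.
have rM s t : rho (s * t) = rho s * rho t by apply: gmulfM.
have rJ s t : rho (s ^ t) = rho s ^ rho t by apply: gmulfJ.
have rX s k : rho (s ^+ k) = rho s ^+ k by apply: gmulfXn.
have piR x y : pi [~ x, y] = [~ pi x, pi y] by apply: gmulfR.
have piJ x y : pi (x ^ y) = pi x ^ pi y by apply: gmulfJ.
have piX x k : pi (x ^+ k) = pi x ^+ k by apply: gmulfXn.
have piM x y : pi (x * y) = pi x * pi y by apply: gmulfM.
have piV x : pi x^-1 = (pi x)^-1 by apply: gmulfV.
have piE := (piR, piJ, piX, piM, piV).
have p0 : T ^+ p = 1.
  by apply: SL2_eq; rewrite upperX SL2_val1 -mx2_1 GRing.pcharf0 // pchar_Fp.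
split.
- by move=> h; have := pi_rel (rel_Z_UV p RS RU RZ h); rewrite !piE rJ rU (rV h) mW.
- by move=> h; have h2 := ltnW h; have := pi_rel (rel_Z_VU p RS RU RZ h2 h); rewrite !piE rM rU (rV h2) mW.
- by have := pi_rel (rel_Z_ZU p RS RU RZ); rewrite !piE rU mW.
- by have := pi_rel (rel_sigma_ZUZ p RS RU RZ); rewrite !piE rU mW.
- by move=> h; have h2 := ltnW h; have := pi_rel (rel_sigma_UV2 p RS RU RZ h2 h); rewrite !piE rJ rX rU (rV h2).
- move=> h; have h2 := ltnW (ltnW h); have := pi_rel (rel_sigma_VUUV p RS RU RZ h2 h).
  by rewrite !piE (rM (v * u)) (rM v) rJ rU (rV h2).
- by move=> h; have := pi_rel (rel_sigma_ZV2 p RS RU RZ h); rewrite !piE rX (rV h) mW.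
- by have := pi_rel (rel_tau_ZU p RS RU RZ); rewrite !piE rU mW mT.
- by move=> h; have := pi_rel (rel_tau_UV p RS RU RZ h); rewrite !piE rJ rU (rV h) mT.
- by move=> h p2; have h2 := ltnW h; have := pi_rel (rel_tau_VU RS RU RZ h2 h p2); rewrite !piE rM rU (rV h2) mT.
- have := @sigma_word (free_gen false ^+ p); rewrite !free_evalX !free_eval_gen.
  exact.
- apply: divP; have := @sigma_word (free_gen true *
    (free_gen false * free_gen false ^ free_gen true * free_gen false)^-1).
  rewrite !(free_evalM, free_evalV, free_evalJ, free_eval_gen) /=.
  rewrite -weyl_word_sigma mulgV => /(_ erefl).
  by rewrite rU mW; case: ifP => _; rewrite ?piE.
- by move=> h; have := pi_rel (rel_sigma_sigmaV p RS RU RZ h); rewrite !piE rM rU (rV h) => /divP.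
- by move=> h; have := pi_rel (rel_sigma_sigmaVU p RS RU RZ h); rewrite !piE rM rU (rV h).
- by move=> h; have h2 := ltnW h; have := pi_rel (rel_sigma_sigmaV2 p RS RU RZ h2 h); rewrite !piE rX (rV h2).
- by move=> h; have := pi_rel (rel_sigma_sigmaZ_odd RS RU RZ h); rewrite !piE rU mT mW => /divP.
- by move=> h; have := pi_rel (rel_sigma_sigmaZ_even RS RU RZ h); rewrite !piE mW.
- by have := pi_rel (rel_sigma_tau p RS RU RZ); rewrite !piE mT.
- by have := pi_rel (rel_sigma_tauU p RS RU RZ); rewrite !piE rU mT mW => /divP.
- by move=> h; have := pi_rel (rel_sigma_tauV2 p RS RU RZ h); rewrite !piE rX (rV h) mT.
by have := pi_rel (rel_tau_tauU p RS RU RZ); rewrite !piE rU mT.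
Qed.

End PresentedSymplecticGroup.

Theorem theorem6p7 (p n : nat) (p_prime : prime p) (n_ge2 : (2 <= n)%N)
    (RS : set (free_group (sym_letter n))) (RU RZ : set (free_group bool))
    (RS_presents : presents (sym_gen n_ge2) RS)
    (RU_presents :
       presents (letter_pair (SL2_transvection p) (SL2_weyl p)) RU)
    (RZ_presents :
       presents (letter_pair (SL2_transvection p) (SL2_weyl p)) RZ) :
  isomorphic (presented (sp_relators p RS RU RZ)) (Sp p n).
Proof.
have [pi piE] := pres_hom (sp_relators p RS RU RZ).
have pi_rel r : sp_relators p RS RU RZ r -> pi r = 1.
  by move=> Rr; rewrite piE; apply: pres_pi_rel.
have [rho [rU rV]] := sym_hom RS_presents pi_rel.
have [mu [mT mW]] := SL2_hom RZ_presents pi_rel.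
have rels := presented_relations p_prime RU_presents pi_rel rU rV mT mW.
have [phi phiE] := presented_hom (@sp_gen_rel _ _ p_prime _ _ _ _
  RS_presents RU_presents RZ_presents).
have phi_gen x : phi (pi (free_gen x)) = sp_gen p n_ge2 x.
  by rewrite piE phiE free_eval_gen.
have phi_rho s : phi (rho s) = sp_perm p s.
  have [P PE] := sp_perm_hom p n; rewrite -PE.
  elim/(sym_gen_ind (n_ge2 := n_ge2)): s => [|s t Es Et|[|h]].
  - by rewrite !gmulf1.
  - by rewrite !gmulfM Es Et.
  - by rewrite PE; apply: etrans (phi_gen (LU n)); rewrite -rU.
  by rewrite PE; apply: etrans (phi_gen (LV h)); rewrite -rV.
have phi_mu g : phi (mu g) = sp_block (Ordinal (ltnW n_ge2)) g.
  have [B BE] := sp_block_hom p (Ordinal (ltnW n_ge2)); rewrite -BE.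
  elim/SL2_gen_ind: g => [|g h Eg Eh||].
  - by rewrite !gmulf1.
  - by rewrite !gmulfM Eg Eh.
  - by rewrite BE mT (phi_gen (LTau n)).
  by rewrite BE mW (phi_gen (LZ n)).
have phi_sigma := phi_gen (LSigma n).
have phi1 x : phi x = 1 -> x = 1.
  apply: (phi_inj p_prime rels phi_rho phi_mu phi_sigma) => Q Q1 QM Qsigma Qmu Qrho.
  have sigV : (pi (free_gen (LSigma n)))^-1 = pi (free_gen (LSigma n)) ^+ p.-1.
    by apply/mulg1_eq; rewrite -expgS prednK ?prime_gt0 // (rel_sig_order rels).
  have Qgen l : Q (pi (free_gen l)) /\ Q (pi (free_gen l))^-1.
    have QsX k : Q (pi (free_gen (LSigma n)) ^+ k).
      by elim: k => [|k IHk]; rewrite ?expg0 // expgS; apply: QM.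
    case: l => [||||h]; first by rewrite sigV.
    - by rewrite -mT -gmulfV.
    - by rewrite -mW -gmulfV.
    - by rewrite -rU -gmulfV.
    by rewrite -rV -gmulfV.
  apply: pres_ind => w; rewrite -piE; elim/free_ind: w => [|l w Qw|l w Qw].
  - by rewrite gmulf1.
  - by rewrite gmulfM; apply: QM => //; have [] := Qgen l.
  by rewrite gmulfM gmulfV; apply: QM => //; have [] := Qgen l.
have phi_inj : injective phi.
  move=> x y xy; rewrite -[x](mulgVK y) (phi1 (x * y^-1)) ?mul1g //.
  by rewrite gmulfM gmulfV xy mulgV.
have phi_surj M : exists x, phi x = M.
  move: M; apply: (@Sp_generated _ _ p_prime n_ge2 (fun M => exists x, phi x = M)) =>
    [_ _ [x <-] [y <-]|_ [x <-]|s|g|].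
  - by exists (x * y); rewrite gmulfM.
  - by exists x^-1; rewrite gmulfV.
  - by exists (rho s).
  - by exists (mu g).
  by exists (pi (free_gen (LSigma n))).
have [psi psiK] := choice phi_surj.
by exists phi, psi => // x; apply: phi_inj; rewrite psiK.
Qed.
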